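(* Let $L\subseteq\mathbb R^n$ be a convex body and $K\in\mathscr K(\mathbb R^n)$ such that $K\subseteq L$. There exists $\nu_K\in(0,1]$, depending only on $K$, such that the following holds. Let $\mu=(\mu_j)_{j\ge1}$ be an admissible weight satisfying $\mu_j\ge j$ for $j\ge1$. Let $M_0>b_0>0$ and $m\in\mathbb N_{\ge1}$. Assume that $(\mu,m M_0,a_K,b_0)$ is admissible and let $\mathbf N=\mathbf N(\mu,mM_0,a_K,b_0)$. Then, for each $(\mu^{|\mathbf N},M_0)$-smooth map $f:L\to\mathbb R^m$ with $\|f\|_K\ge b_0$ and each Lebesgue measurable set $E\subseteq K$ with $|E|>0$, $$\|f\|_K\le\mathbf C_{\mathbf N}\Big(\frac{m\,|K|^{\nu_K}}{|K|^{\nu_K}-(|K|-|E|)^{\nu_K}}\Big)^{\mathbf N}\|f\|_E.$$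
   Context: $|E|$ denotes Lebesgue measure. A convex body is a compact convex set with nonempty interior. Weights and smoothness. An admissible weight is a sequence $\mu=(\mu_j)_{j\ge1}$ of reals with $0<\mu_1\le\mu_2\le\cdots$. Given $M_0>0$ put $M_j=M_0\mu_1\cdots\mu_j$, $j\ge1$. For $N\in\mathbb N_{\ge1}\cup\{\infty\}$ and nonempty compact $L\subseteq\mathbb R^n$, a map $f=(f_1,\dots,f_m):L\to\mathbb R^m$ is $(\mu^{|N},M_0)$-smooth if it is of class $C^N$ in some open neighborhood of $L$ and $\sup_{x\in L}\sum_{i=1}^m\sum_{|\alpha|=j}\frac{j!}{\alpha!}|\partial^\alpha f_i(x)|\le M_j$ for all integers $0\le j<N+1$. Also $\|f\|_E:=\sup_{x\in E}\sum_{i=1}^m|f_i(x)|$. Degree. For $A,a,b>0$ let $j_0$ be the smallest nonnegative integer $\ge\log(A/b)$. The tuple $(\mu,A,a,b)$ is admissible if $\sum_{j=j_0+1}^\infty 1/\mu_j>a\,e$; then $\mathbf N(\mu,A,a,b):=2\sup\{k\in\mathbb N:\sum_{j=j_0+1}^k\frac1{a\mu_j}<e\}$ (empty sums are $0$). The constant $\mathbf C_{\mathbf N}$. Fix an increasing continuous, (piecewise) $C^1$ function $\tilde\mu:[1,\infty)\to(0,\infty)$ with $\tilde\mu(j)=\mu_j$ for integers $j\ge1$ (left derivatives are used at points of nondifferentiability), put $\gamma_{\tilde\mu}(k):=\sup_{1\le s\le k}\frac{s\tilde\mu'(s)}{\tilde\mu(s)}$, and $\mathbf C_{\mathbf N}:=(4e^{4+\gamma_{\tilde\mu}(\mathbf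 N)})^{\mathbf N}$. Admissible sets. A family $(K_w,a_w,\Upsilon_w)_{w\in W}$, where $W$ is any set, $K_w\subseteq[0,1]^n$ is compact, $a_w\in K_w$, and $\Upsilon_w:[0,\infty)^n\to\mathbb R^n$ is a map, is an admissible collection of degree $d\in\mathbb N_{\ge1}$ if there are constants $\delta_1,\delta_2,\delta_3>0$, $q\in\mathbb N_{\ge1}$ and polynomial maps $R_w:\mathbb R^n\to\mathbb R^n$ of degree at most $d$ such that for all $w\in W$: (1) $K_w$ is star-shaped with respect to $a_w$ and $|K_w|\ge\delta_1$; (2) $\Upsilon_w(x_1,\dots,x_n)=R_w(x_1^{1/q},\dots,x_n^{1/q})$; (3) $\delta_2\le\sum_\kappa|c_{w,\kappa}|\le\delta_3$, where $c_{w,\kappa}$ are the coefficients of the polynomial $\operatorname{Jac}(R_w)$ (the Jacobian determinant); (4) writing $a_w=(a_{w,1},\dots,a_{w,n})$, $a_{w,i}=0$ whenever $\Upsilon_w$ is not a polynomial map with respect to the variable $x_i$. A nonempty compact set $K\subseteq\mathbb R^n$ is admissible (of degree $d$) if there is an admissible collection (of degree $d$) $(K_w,a_w,\Upsilon_w)_{w\in K}$ indexed by $K$ with $\Upsilon_w(a_w)=w$ for each $w\in K$ and $K=\bigcup_{w\in K}\Upsilon_w(K_w)$. $\mathscr K(\mathbb R^n)$ is the family of all admissible sets. For each $K\in\mathscr K(\mathbb R^n)$ such a collection and its degree $d$ are fixed, and $$a_K:=4\,\tfrac{(d+1)^{d+1}}{(d-1)^{d-1}}\max\{\operatorname{diam}(K),1\}\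 \text{ if }d\ge2,\qquad a_K:=\operatorname{diam}(K)\ \text{ if }d=1.$$ *)

(* Defs.v *)
From HB Require Import structures.
From mathcomp Require Import all_boot all_order all_algebra.
From mathcomp Require Import all_classical all_reals all_analysis.
(* The notations of mpoly clash with those of mathcomp-analysis. *)
From mathcomp Require mpoly.
Import -(notations) mpoly.

Set Implicit Arguments.
Unset Strict Implicit.
Unset Printing Implicit Defensive.

Import Order.TTheory GRing.Theory Num.Theory numFieldNormedType.Exports.

Local Open Scope classical_set_scope.
Local Open Scope ring_scope.

(* Lebesgue measure on R^n for n >= 1: the outer measure generated by the
   volume of closed boxes, whose Caratheodory-measurable sets are the Lebesgue
   measurable sets. *)

(* [p] is the pair of opposite corners; the box is empty when p.1 <= p.2
   fails in some coordinate. *)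
Definition box (R : realType) (n : nat) (p : 'rV[R]_n * 'rV[R]_n) :
    set 'rV[R]_n :=
  [set x | forall i, p.1 0 i <= x 0 i <= p.2 0 i].

Definition box_volume (R : realType) (n : nat) (p : 'rV[R]_n * 'rV[R]_n) : R :=
  \prod_(i < n) Num.max 0 (p.2 0 i - p.1 0 i).

Definition lebesgue_n (R : realType) (n : nat) (A : set 'rV[R]_n) : \bar R :=
  ereal_inf [set (\sum_(0 <= k <oo) (box_volume (B k))%:E)%E | B in
    [set B : nat -> 'rV[R]_n * 'rV[R]_n | A `<=` \bigcup_k box (B k)]].

Definition lebesgue_measurable (R : realType) (n : nat) (A : set 'rV[R]_n) :
    Prop :=
  caratheodory_measurable (@lebesgue_n R n) A.

Definition volume (R : realType) (n : nat) (A : set 'rV[R]_n) : R :=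
  fine (lebesgue_n A).

(* The norm of 'rV[R]_n in the library is the sup norm. *)
Definition euclidean_dist (R : realType) (n : nat) (x y : 'rV[R]_n) : R :=
  Num.sqrt (\sum_(i < n) (x 0 i - y 0 i) ^+ 2).

Definition diam (R : realType) (n : nat) (A : set 'rV[R]_n) : R :=
  sup [set euclidean_dist p.1 p.2 | p in A `*` A].

Definition convex_body (R : realType) (n : nat) (L : set 'rV[R]_n) : Prop :=
  [/\ compact L, convex_set L & interior L !=set0].

(* Sequences indexed by j >= 1 are functions on nat whose value at 0 is never
   used. *)
Definition admissible_weight (R : realType) (mu : nat -> R) : Prop :=
  0 < mu 1%N /\ forall j, (1 <= j)%N -> mu j <= mu j.+1.

Definition weight_bound (R : realType) (mu : nat -> R) (M0 : R) (j : nat) : R :=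
  M0 * \prod_(1 <= i < j.+1) mu i.

Definition partial (R : realType) (n : nat) (i : 'I_n) (g : 'rV[R]_n -> R) :
    'rV[R]_n -> R :=
  fun x => 'D_(delta_mx 0 i) g x.

Fixpoint Ck_on (R : realType) (n : nat) (k : nat) (U : set 'rV[R]_n)
    (g : 'rV[R]_n -> R) : Prop :=
  {in U, continuous g} /\
  if k is k'.+1 then
    forall i : 'I_n,
      (forall x, U x -> derivable g x (delta_mx 0 i)) /\
      Ck_on k' U (partial i g)
  else True.

(* Multi-indices of length j are the functions alpha : 'I_n -> 'I_j.+1 whose
   values add up to j. *)
Definition mpartial (R : realType) (n j : nat) (alpha : {ffun 'I_n -> 'I_j.+1})
    (g : 'rV[R]_n -> R) : 'rV[R]_n -> R :=
  foldr (fun i h => iter (alpha i) (partial i) h) g (enum 'I_n).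

Definition derivative_size (R : realType) (n m : nat)
    (f : 'rV[R]_n -> 'rV[R]_m) (j : nat) (x : 'rV[R]_n) : R :=
  \sum_(i < m)
    \sum_(alpha : {ffun 'I_n -> 'I_j.+1} | (\sum_(k < n) alpha k == j)%N)
      (j`!)%:R / (\prod_(k < n) (alpha k)`!)%:R *
      `|mpartial alpha (fun y => f y 0 i) x|.

(* Only the values of [f] on the open neighborhood [U] matter. *)
Definition weight_smooth (R : realType) (n m : nat) (mu : nat -> R) (N : nat)
    (M0 : R) (L : set 'rV[R]_n) (f : 'rV[R]_n -> 'rV[R]_m) : Prop :=
  (exists U : set 'rV[R]_n, [/\ open U, L `<=` U &
     forall i : 'I_m, Ck_on N U (fun x => f x 0 i)]) /\
  (forall j, (j <= N)%N -> forall x, L x ->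
     derivative_size f j x <= weight_bound mu M0 j).

Definition norm_on (R : realType) (n m : nat) (E : set 'rV[R]_n)
    (f : 'rV[R]_n -> 'rV[R]_m) : R :=
  sup [set \sum_(i < m) `|f x 0 i| | x in E].

Definition degree_start (R : realType) (A b : R) : nat :=
  `|Num.ceil (Num.max 0 (ln (A / b)))%R|%N.

Definition admissible_tuple (R : realType) (mu : nat -> R) (A a b : R) : Prop :=
  [/\ 0 < A, 0 < a, 0 < b &
    ((a * expR 1)%:E <
     \sum_((degree_start A b).+1 <= j <oo) ((mu j)^-1)%:E)%E].

(* The supremum is finite, hence attained, when the tuple is admissible. *)
Definition degree (R : realType) (mu : nat -> R) (A a b : R) : nat :=
  (2 * Num.truncn (sup [set (k%:R : R) | k in
    [set k : nat | (\sum_((degree_start A b).+1 <= j < k.+1) (a * mu j)^-1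
                    < expR 1)%R]]))%N.

Definition C1_on_itv (R : realType) (g : R -> R) (a b : R) : Prop :=
  exists dg : R -> R, {within `[a, b], continuous dg} /\
    {in `]a, b[, forall s : R, is_derive s 1 g (dg s)}.

(* Piecewise: with respect to a locally finite subdivision of [1, +oo[. *)
Definition weight_interpolation (R : realType) (mu : nat -> R) (mut : R -> R) :
    Prop :=
  [/\ forall s, 1 <= s -> 0 < mut s,
      {in `[1, +oo[ &, {homo mut : s t / s <= t}},
      {within `[1, +oo[, continuous mut},
      exists t : nat -> R, [/\ t 0%N = 1, forall k, t k < t k.+1,
        t @ \oo --> +oo & forall k, C1_on_itv mut (t k) (t k.+1)]
    & forall j, (1 <= j)%N -> mut j%:R = mu j].

(* Left derivative, and at the left endpoint 1 of the domain the right one. *)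
Definition weight_derivative (R : realType) (mut : R -> R) (s : R) : R :=
  let quotient h := (mut (s + h) - mut s) / h in
  if 1 < s then lim (quotient @ 0^'-) else lim (quotient @ 0^'+).

Definition gamma_weight (R : realType) (mut : R -> R) (k : R) : R :=
  sup [set s * weight_derivative mut s / mut s | s in `[1, k]].

Definition C_const (R : realType) (mut : R -> R) (N : nat) : R :=
  (4 * expR (4 + gamma_weight mut N%:R)) ^+ N.

Definition star_shaped (R : realType) (n : nat) (A : set 'rV[R]_n)
    (a : 'rV[R]_n) : Prop :=
  forall x (t : R), A x -> 0 <= t <= 1 -> A (a + t *: (x - a)).

Definition orthant (R : realType) (n : nat) : set 'rV[R]_n :=
  [set x | forall i, 0 <= x 0 i].

Definition set_coord (R : realType) (n : nat) (x : 'rV[R]_n) (i : 'I_n) (t : R) :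
    'rV[R]_n :=
  \row_j (if j == i then t else x 0 j).

(* [Ups] is a map on [0, +oo[^n: its values elsewhere are irrelevant. *)
Definition polynomial_in (R : realType) (n : nat) (i : 'I_n)
    (Ups : 'rV[R]_n -> 'rV[R]_n) : Prop :=
  forall (j : 'I_n) (x : 'rV[R]_n), orthant x ->
    exists p : {poly R}, forall t, 0 <= t -> Ups (set_coord x i t) 0 j = p.[t].

Definition poly_jacobian (R : realType) (n : nat) (P : 'I_n -> mpoly n R) :
    mpoly n R :=
  \det (\matrix_(i, j) mderiv j (P i)).

Definition coef_norm (R : realType) (n : nat) (p : mpoly n R) : R :=
  \sum_(k <- msupp p) `|mcoeff k p|.

(* The index set W is a subset of a type [T]; [msize] is the total degree plus
   one (and 0 for the zero polynomial). *)
Definition admissible_collection (R : realType) (n : nat) (T : Type)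
    (W : set T) (d : nat) (KW : T -> set 'rV[R]_n) (aW : T -> 'rV[R]_n)
    (Ups : T -> 'rV[R]_n -> 'rV[R]_n) : Prop :=
  (1 <= d)%N /\
  (forall w, W w -> [/\ compact (KW w),
     KW w `<=` [set x | forall i, 0 <= x 0 i <= 1] & KW w (aW w)]) /\
  exists (delta1 delta2 delta3 : R) (q : nat) (P : T -> 'I_n -> mpoly n R),
    [/\ 0 < delta1, 0 < delta2, 0 < delta3, (1 <= q)%N &
    forall w, W w ->
      (forall i, (msize (P w i) <= d.+1)%N) /\
      [/\ star_shaped (KW w) (aW w) /\ (delta1%:E <= lebesgue_n (KW w))%E,
          forall x, orthant x ->
            Ups w x = \row_i meval (fun j => x 0 j `^ (q%:R^-1)) (P w i),
          delta2 <= coef_norm (poly_jacobian (P w)) <= delta3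
        & forall i, ~ polynomial_in i (Ups w) -> aW w 0 i = 0]].

Definition admissible_set (R : realType) (n : nat) (d : nat) (K : set 'rV[R]_n) :
    Prop :=
  [/\ K !=set0, compact K &
    exists (KW : 'rV[R]_n -> set 'rV[R]_n) (aW : 'rV[R]_n -> 'rV[R]_n)
           (Ups : 'rV[R]_n -> 'rV[R]_n -> 'rV[R]_n),
      [/\ admissible_collection K d KW aW Ups,
          forall w, K w -> Ups w (aW w) = w
        & K = \bigcup_(w in K) (Ups w @` KW w)]].

Definition a_const (R : realType) (n : nat) (d : nat) (K : set 'rV[R]_n) : R :=
  if (2 <= d)%N then
    4 * (d.+1 ^ d.+1)%:R / (d.-1 ^ d.-1)%:R * Num.max (diam K) 1
  else diam K.

(* Main.v *)
Require Import Defs.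
From HB Require Import structures.
From mathcomp Require Import all_boot all_order perm all_algebra.
From mathcomp Require Import all_classical all_reals all_analysis.
From mathcomp Require mpoly.
Import -(notations) mpoly.
From mathcomp Require Import zify ring lra.

Import Order.TTheory GRing.Theory Num.Theory numFieldNormedType.Exports.

Local Open Scope classical_set_scope.
Local Open Scope ring_scope.

(** Let w be a maximum point of f on K. It suffices to bound one component of f at w
    along a polynomial curve that starts at w, stays in L, and meets E in k + 1
    well-spaced points, where N = 2k. On such a curve the j-th derivative of the
    component is at most a_K^j M_j (Faa di Bruno, with a majorant of the curve obtained
    by Lagrange interpolation), so that either Lagrange interpolation at the points in E
    has a small error, or Bang's argument applied to the difference with the interpolating
    polynomial contradicts the divergence of the sum of 1/(a_K mu_j).

    If |K| - |E| is bounded below, the curve is a segment from w to a point of E: an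
    averaging argument over dilated copies of E produces a ray meeting E often, and nu_K
    is chosen so small that 1 - (1 - |E|/|K|)^nu_K is below the resulting spacing. If
    |K| - |E| is small, the curve is s |-> Upsilon_w(a_w + s^q (x - a_w)): the preimage of
    K \ E in K_w is small, uniformly in w, since the coefficients of R_w are bounded, the
    Jacobian of R_w is bounded below off a small set, and so Upsilon_w cannot map a set of
    large measure to a set of small measure; averaging over x yields a good curve. *)

(** * Lagrange interpolation and coefficientwise domination *)

(** The final bound carries r^(2k) with r = 1/(1 - (1 - |E|/|K|)^nu), while k + 1 nodes with spacing
    tau/k cost a factor of order tau^(-k): the geometry has to supply 1/tau <= 8 r^2. A segment from
    w to E yields tau of order |E|/diam(K)^n only. This is not enough when E nearly fills a set K
    that is thin for its diameter, since r then tends to 1; hence the curves inside K.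

    These curves must have degree d, not q d. The parameter s^q cancels the roots, because a_w
    vanishes in each coordinate where a genuine root occurs.

    For d >= 2 the j-th derivative along a curve mixes the derivatives of f of all orders up to j.
    As mu_j >= j, the quotients M_l/l! are nondecreasing, so all orders are absorbed by M_j, and a_K
    absorbs the Taylor coefficients of the curve.

    The collection may depend on w in any manner, so compactness gives no uniformity in w. Every
    constant is instead produced by interpolation from n, d, q and bounds that hold for all w. *)

Definition dominated {R : realType} (p P : {poly R}) : Prop :=
  forall r, `|p`_r| <= P`_r.

Lemma dominated_ge0 {R : realType} (p P : {poly R}) r :
  dominated p P -> 0 <= P`_r.
Proof. by move=> pP; apply: le_trans (pP r). Qed.

Lemma dominatedD {R : realType} (p P q Q : {poly R}) :
  dominated p P -> dominated q Q -> dominated (p + q) (P + Q).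
Proof.
move=> pP qQ r; rewrite !coefD; apply: le_trans (ler_normD _ _) _.
exact: lerD.
Qed.

Lemma dominated0 (R : realType) : @dominated R 0 0.
Proof. by move=> r; rewrite coef0 normr0. Qed.

Lemma dominated1 (R : realType) : @dominated R 1 1.
Proof. by move=> r; rewrite coef1 normr_nat. Qed.

Lemma dominatedM {R : realType} (p P q Q : {poly R}) :
  dominated p P -> dominated q Q -> dominated (p * q) (P * Q).
Proof.
move=> pP qQ r; rewrite !coefM; apply: le_trans (ler_norm_sum _ _ _) _.
by apply: ler_sum => i _; rewrite normrM ler_pM.
Qed.

Lemma dominatedZ {R : realType} (a A : R) (p P : {poly R}) :
  `|a| <= A -> dominated p P -> dominated (a *: p) (A *: P).
Proof. by move=> aA pP r; rewrite !coefZ normrM ler_pM. Qed.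

Lemma dominated_deriv {R : realType} (p P : {poly R}) :
  dominated p P -> dominated p^`() P^`().
Proof. by move=> pP r; rewrite !coef_deriv normrMn lerMn2r pP orbT. Qed.

Lemma dominated_sum {R : realType} (I : Type) (s : seq I) (A : pred I)
    (p P : I -> {poly R}) :
  (forall i, A i -> dominated (p i) (P i)) ->
  dominated (\sum_(i <- s | A i) p i) (\sum_(i <- s | A i) P i).
Proof.
move=> pP; elim/big_rec2: _ => [|i x y Ai]; first exact: dominated0.
exact/dominatedD/pP.
Qed.

Lemma dominated_prod {R : realType} (I : Type) (s : seq I) (A : pred I)
    (p P : I -> {poly R}) :
  (forall i, A i -> dominated (p i) (P i)) ->
  dominated (\prod_(i <- s | A i) p i) (\prod_(i <- s | A i) P i).
Proof.
move=> pP; elim/big_rec2: _ => [|i x y Ai]; first exact: dominated1.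
exact/dominatedM/pP.
Qed.

Lemma dominated_XDC {R : realType} (a A : R) :
  `|a| <= A -> dominated ('X + a%:P) ('X + A%:P).
Proof.
move=> aA r; rewrite !coefD !coefX !coefC.
apply: le_trans (ler_normD _ _) _; apply: lerD; first by rewrite normr_nat.
by case: ifP => // _; rewrite normr0.
Qed.

Definition lag {R : realType} (x : nat -> R) (k i : nat) : {poly R} :=
  \prod_(j < k.+1 | j != i :> nat) ((x i - x j)^-1 *: ('X - (x j)%:P)).

Definition interp {R : realType} (x : nat -> R) (k : nat) (y : nat -> R) :
    {poly R} :=
  \sum_(i < k.+1) y i *: lag x k i.

Lemma lag_node {R : realType} (x : nat -> R) (k i l : nat) :
  (forall i j, (i <= k)%N -> (j <= k)%N -> i != j -> x i != x j) ->
  (i <= k)%N -> (l <= k)%N -> (lag x k i).[x l] = (i == l)%:R.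
Proof.
move=> xinj ik lk; rewrite horner_prod; case: eqVneq => [->|il].
  rewrite big1 // => j jl; rewrite hornerZ !hornerE mulVf // subr_eq0.
  by apply: xinj; rewrite 1?eq_sym // -ltnS.
rewrite (bigD1 (Ordinal (lk : (l < k.+1)%N))) /= 1?eq_sym //.
by rewrite !hornerE subrr mulr0 mul0r.
Qed.

Lemma size_lag {R : realType} (x : nat -> R) (k i : nat) :
  (i <= k)%N -> (size (lag x k i) <= k.+1)%N.
Proof.
move=> ik; apply: leq_trans (size_prod_leq _ _) _.
apply: (@leq_trans ((\sum_(j < k.+1 | j != i :> nat) 2).+1 - #|[pred j : 'I_k.+1 | j != i :> nat]|)).
  rewrite leq_sub2r // ltnS; apply: leq_sum => j _.
  by apply: leq_trans (size_scale_leq _ _) _; rewrite size_XsubC.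
rewrite sum_nat_const.
have -> : #|[pred j : 'I_k.+1 | j != i :> nat]| = k; last by lia.
rewrite -[RHS]/(k.+1.-1) -[in RHS](card_ord k.+1).
rewrite -(cardC1 (Ordinal (ik : (i < k.+1)%N))).
by apply: eq_card => j; rewrite !inE.
Qed.

Lemma interp_node {R : realType} (x : nat -> R) (k l : nat) (y : nat -> R) :
  (forall i j, (i <= k)%N -> (j <= k)%N -> i != j -> x i != x j) ->
  (l <= k)%N -> (interp x k y).[x l] = y l.
Proof.
move=> xinj lk; rewrite horner_sum.
rewrite (bigD1 (Ordinal (lk : (l < k.+1)%N))) //= hornerZ lag_node // eqxx mulr1.
rewrite big1 ?addr0 // => i il; rewrite hornerZ lag_node //; last by rewrite -ltnS.
by rewrite (_ : (i : nat) == l = false) ?mulr0 //; apply/negbTE.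
Qed.

Lemma size_interp {R : realType} (x : nat -> R) (k : nat) (y : nat -> R) :
  (size (interp x k y) <= k.+1)%N.
Proof.
apply: (leq_trans (size_sum _ _ _)); apply/bigmax_leqP => i _.
apply: leq_trans (size_scale_leq _ _) _; apply: size_lag; by rewrite -ltnS.
Qed.

Lemma interp_id {R : realType} (x : nat -> R) (k : nat) (p : {poly R}) :
  (forall i j, (i <= k)%N -> (j <= k)%N -> i != j -> x i != x j) ->
  (size p <= k.+1)%N -> interp x k (fun i => p.[x i]) = p.
Proof.
move=> xinj sp; apply/eqP; rewrite -subr_eq0; apply/eqP.
apply: (@roots_geq_poly_eq0 _ _ [seq x i | i <- iota 0 k.+1]).
- apply/allP => z /mapP[i]; rewrite mem_iota add0n => /andP[_ ik] ->.
  by rewrite rootE !hornerE /= interp_node ?subrr.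
- rewrite map_inj_in_uniq ?iota_uniq // => i j; rewrite !mem_iota !add0n.
  move=> /andP[_ ik] /andP[_ jk] xij; apply/eqP/negP => /negP ij.
  by move/eqP: (xinj i j ik jk ij).
- rewrite size_map size_iota; apply: leq_trans (size_polyD _ _) _.
  by rewrite geq_max size_interp size_polyN.
Qed.

Lemma prod_dist (R : realType) (k i : nat) : (i <= k)%N ->
  \prod_(j < k.+1 | j != i :> nat) `|i%:R - j%:R| = (i`! * (k - i)`!)%:R :> R.
Proof.
move=> ik.
rewrite -(big_mkord (fun j => j != i) (fun j => `|i%:R - j%:R| : R)).
rewrite (@big_cat_nat _ _ _ i) //=; last exact: leqW.
rewrite [X in _ * X]big_ltn_cond ?ltnS // eqxx /= natrM; congr (_ * _).
- rewrite big_nat_cond (eq_bigl (fun j => (0 <= j < i)%N)); last by move=> j; lia.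
  rewrite -big_nat fact_prod natr_prod [RHS]big_add1 /= [RHS]big_nat_rev /=.
  apply: eq_big_nat => j /andP[_ ji].
  rewrite -natrB; last by lia.
  by rewrite normr_nat; congr (_%:R); lia.
- rewrite fact_prod natr_prod [RHS]big_add1 /=.
  rewrite -[X in index_iota X k.+1]add0n big_addn subSS.
  rewrite (eq_bigl xpredT); last by move=> j /=; lia.
  apply: eq_big_nat => j _.
  rewrite distrC -natrB; last by lia.
  by rewrite normr_nat; congr (_%:R); lia.
Qed.

(** The gap is imposed on all pairs of indices, so that each denominator in Lagrange's formula is at
    least delta^k i! (k - i)!, its value for equally spaced nodes. *)
Definition gapped {R : realType} (k : nat) (delta : R) (x : nat -> R) : Prop :=
  forall i j, (i <= k)%N -> (j <= k)%N -> `|i%:R - j%:R| * delta <= `|x i - x j|.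

Lemma gapped_inj {R : realType} (k : nat) (delta : R) (x : nat -> R) :
  0 < delta -> gapped k delta x ->
  forall i j, (i <= k)%N -> (j <= k)%N -> i != j -> x i != x j.
Proof.
move=> d0 gx i j ik jk ij; rewrite -subr_eq0 -normr_gt0.
apply: lt_le_trans (gx i j ik jk); rewrite mulr_gt0 // normr_gt0 subr_eq0.
by rewrite eqr_nat.
Qed.

Lemma gapped_sub {R : realType} (k k' : nat) (delta : R) (x : nat -> R) :
  (k' <= k)%N -> gapped k delta x -> gapped k' delta x.
Proof. by move=> kk gx i j ik jk; apply: gx; apply: leq_trans kk. Qed.

(** After recentring at c, each factor X + (c - x_j) is dominated by X + 1; the denominators are
    compared with those of equally spaced nodes, computed in [prod_dist]. *)
Lemma dominated_lag {R : realType} (k i : nat) (delta c : R) (x : nat -> R) :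
  0 < delta -> gapped k delta x -> (i <= k)%N ->
  (forall j, (j <= k)%N -> `|c - x j| <= 1) ->
  dominated (lag x k i \Po ('X + c%:P))
    ((delta ^+ k * (i`! * (k - i)`!)%:R)^-1 *: ('X + 1%:P) ^+ k).
Proof.
move=> d0 gx ik cx.
have xinj := @gapped_inj R k delta x d0 gx.
have card_neq : #|[pred j : 'I_k.+1 | j != i :> nat]| = k.
  rewrite -[RHS]/(k.+1.-1) -[in RHS](card_ord k.+1).
  rewrite -(cardC1 (Ordinal (ik : (i < k.+1)%N))).
  by apply: eq_card => j; rewrite !inE.
rewrite /lag rmorph_prod /=.
have -> : ((delta ^+ k * (i`! * (k - i)`!)%:R)^-1 *: ('X + 1%:P) ^+ k) =
   \prod_(j < k.+1 | j != i :> nat)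
      ((`|i%:R - j%:R| * delta)^-1 *: ('X + 1%:P)) :> {poly R}.
  rewrite scaler_prod prodr_const card_neq; congr (_ *: _).
  rewrite prodfV big_split /= prodr_const card_neq prod_dist //.
  by rewrite mulrC.
apply: dominated_prod => j ji.
rewrite comp_polyZ comp_polyB comp_polyX comp_polyC -addrA -polyCB.
have jk : (j <= k)%N by rewrite -ltnS.
apply: dominatedZ; last exact/dominated_XDC/cx.
rewrite normfV lef_pV2 ?gx //.
- by rewrite posrE normr_gt0 subr_eq0; apply: xinj; rewrite // eq_sym.
- by rewrite posrE mulr_gt0 // normr_gt0 subr_eq0 eqr_nat eq_sym.
Qed.

Lemma sum_inv_fact (R : realType) (k : nat) :
  \sum_(i < k.+1) (i`! * (k - i)`!)%:R^-1 = 2 ^+ k / k`!%:R :> R.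
Proof.
rewrite -[2]/(1 + 1) exprD1n mulr_suml; apply: eq_bigr => i _.
rewrite expr1n -(@bin_fact k i); last by rewrite -ltnS.
rewrite [in RHS]natrM invfM mulrA mulfV ?mul1r // pnatr_eq0 -lt0n bin_gt0.
by rewrite -ltnS.
Qed.

Lemma coef_XD1_exp (R : realType) (k r : nat) :
  (('X + 1%:P) ^+ k : {poly R})`_r = 'C(k, r)%:R.
Proof.
rewrite polyC1 exprD1n coef_sum.
under eq_bigr => i _ do rewrite coefMn coefXn.
have [rk|kr] := leqP r k.
  rewrite (bigD1 (Ordinal (rk : (r < k.+1)%N))) //= eqxx big1 ?addr0 // => i ir.
  by rewrite [r == i]eq_sym (_ : (i : nat) == r = false) ?mul0rn //; apply/negbTE.
rewrite bin_small // big1 // => i _.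
by rewrite gtn_eqF ?mul0rn //; apply: leq_trans kr.
Qed.

(** Summing [dominated_lag] over the basis produces 2^k/k!. All Taylor coefficients at c are
    bounded, because derivatives of an interpolating polynomial at unknown Rolle points have to be
    estimated later. *)
Lemma interpolation_bound {R : realType} (k : nat) (delta c eps : R)
    (x : nat -> R) (p : {poly R}) :
  0 < delta -> gapped k delta x -> (size p <= k.+1)%N ->
  (forall j, (j <= k)%N -> `|c - x j| <= 1) ->
  (forall j, (j <= k)%N -> `|p.[x j]| <= eps) ->
  forall r, `|(p \Po ('X + c%:P))`_r| <=
    eps * 'C(k, r)%:R * (2 / delta) ^+ k / k`!%:R.
Proof.
move=> d0 gx sp cx px r.
rewrite -(@interp_id R x k p (gapped_inj _ _ _ d0 gx) sp) /interp.
rewrite raddf_sum /= coef_sum.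
apply: le_trans (ler_norm_sum _ _ _) _.
apply: (@le_trans _ _ (\sum_(i < k.+1)
   eps * ((delta ^+ k * (i`! * (k - i)`!)%:R)^-1 * 'C(k, r)%:R))).
  apply: ler_sum => i _; have ik : (i <= k)%N by rewrite -ltnS.
  rewrite comp_polyZ coefZ normrM ler_pM ?px //.
  apply: le_trans (dominated_lag _ _ _ _ _ d0 gx ik cx r) _.
  by rewrite coefZ coef_XD1_exp.
rewrite -mulr_sumr -mulr_suml.
under eq_bigr => i _ do rewrite invfM.
rewrite -mulr_sumr sum_inv_fact exprMn exprVn.
rewrite le_eqVlt; apply/orP; left; apply/eqP; ring.
Qed.

(** * Smooth functions of one variable *)

(** The derivatives are a given sequence, so that the explicit expansion along a curve can be
    supplied. They are two-sided even at 0 and 1: a curve in L continues inside the open set on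
    which f is smooth. *)
Definition deriv_chain {R : realType} (n : nat) (g : nat -> R -> R) : Prop :=
  forall j (s : R), (j < n)%N -> 0 <= s <= 1 -> is_derive s 1 (g j) (g j.+1 s).

Lemma deriv_chain_shift {R : realType} (n : nat) (g : nat -> R -> R) :
  deriv_chain n.+1 g -> deriv_chain n (fun j => g j.+1).
Proof. by move=> gc j s jn; apply: gc. Qed.

Lemma is_derive_continuous_itv {R : realType} (f df : R -> R) (a b : R) :
  (forall x : R, a <= x <= b -> is_derive x 1 f (df x)) ->
  {within `[a, b], continuous f}.
Proof.
move=> fd; apply: derivable_within_continuous => x; rewrite in_itv /= => xab.
by have := fd x xab; case.
Qed.

Lemma rolle_nodes {R : realType} (k : nat) (f df : R -> R) (z : nat -> R) :
  (forall s : R, 0 <= s <= 1 -> is_derive s 1 f (df s)) ->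
  (forall i, (i <= k.+1)%N -> 0 <= z i <= 1) ->
  (forall i, (i <= k)%N -> z i < z i.+1) ->
  (forall i, (i <= k.+1)%N -> f (z i) = 0) ->
  exists z' : nat -> R,
    forall i, (i <= k)%N -> z i < z' i < z i.+1 /\ df (z' i) = 0.
Proof.
move=> fd z01 zinc fz.
suff H i : exists c, (i <= k)%N -> z i < c < z i.+1 /\ df c = 0.
  by have [z' z'P] := choice H; exists z'.
have [ik|ki] := leqP i k; last by exists 0.
have inab x : z i <= x <= z i.+1 -> 0 <= x <= 1.
  move=> /andP[zx xz]; have /andP[z0 _] := z01 i (leqW ik).
  have /andP[_ z1] := z01 i.+1 ik.
  by rewrite (le_trans z0 zx) (le_trans xz z1).
have [|||c] := @Rolle R f (z i) (z i.+1) (zinc i ik).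
- move=> x; rewrite in_itv /= => /andP[/ltW ax /ltW xb].
  by have := fd x (inab x _); rewrite ax xb => /(_ isT); case.
- apply: (is_derive_continuous_itv _ df) => x /inab; exact: fd.
- by rewrite !fz // leqW.
rewrite in_itv /= => cab fc0; exists c => _; split => //.
have c01 : 0 <= c <= 1 by apply: inab; move: cab => /andP[/ltW -> /ltW ->].
have [_ <-] := fd c c01; by have [_ ->] := fc0.
Qed.

(** The first zero is kept as xi_0 and the construction is repeated on the Rolle points, the first
    of which lies to its right. Hence xi_j is nondecreasing in j, as Bang's argument requires. The
    conjunct [z 0%N <= xi 0%N] links one step of the induction to the next. *)
Lemma rolle_chain {R : realType} (k : nat) (g : nat -> R -> R) (z : nat -> R) :
  deriv_chain k g ->
  (forall i, (i <= k)%N -> 0 <= z i <= 1) ->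
  (forall i, (i < k)%N -> z i < z i.+1) ->
  (forall i, (i <= k)%N -> g 0%N (z i) = 0) ->
  exists xi : nat -> R,
    [/\ forall j, (j <= k)%N -> g j (xi j) = 0,
        forall j, (j < k)%N -> xi j <= xi j.+1,
        z 0%N <= xi 0%N & forall j, (j <= k)%N -> z 0%N <= xi j <= z k].
Proof.
elim: k g z => [|k IHk] g z gc z01 zinc gz.
  exists z; split => // [j|j]; rewrite leqn0 => /eqP ->; first exact: gz.
  by rewrite lexx.
have [|z' z'P] := rolle_nodes k (g 0%N) (g 1%N) z _ z01 zinc gz.
  by move=> s; apply: gc.
have z'01 i : (i <= k)%N -> 0 <= z' i <= 1.
  move=> ik; have [/andP[a b] _] := z'P i ik.
  have /andP[z0 _] := z01 i (leqW ik); have /andP[_ z1] := z01 i.+1 ik.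
  by rewrite (le_trans z0 (ltW a)) (le_trans (ltW b) z1).
have [||||xi [gxi xiinc z'xi xiz']] := IHk (fun j => g j.+1) z'.
- exact: deriv_chain_shift.
- exact: z'01.
- move=> i ik; have [/andP[_ b] _] := z'P i (ltnW ik).
  have [/andP[a _] _] := z'P i.+1 ik; exact: lt_trans b a.
- by move=> i /z'P[].
have [/andP[z0z' _] _] := z'P 0%N isT.
have [/andP[_ z'z] _] := z'P k (leqnn k).
exists (fun j => if j is j'.+1 then xi j' else z 0%N); split.
- by case=> [|j] jk; [exact: gz|exact: gxi].
- case=> [|j] jk; last exact: xiinc.
  exact: le_trans (ltW z0z') z'xi.
- exact: lexx.
- have xiz j : (j <= k)%N -> z 0%N <= xi j <= z k.+1.
    move=> /xiz' /andP[a b].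
    by rewrite (le_trans (ltW z0z') a) (le_trans b (ltW z'z)).
  case=> [|j] jk; last exact: xiz.
  rewrite lexx /=; have /andP[a b] := xiz 0%N isT; exact: le_trans a b.
Qed.

(** Both v + u and v - u are nonincreasing, so their nonnegativity passes from the right end to the
    left end. *)
Lemma derive_dominated {R : realType} (u du v dv : R -> R) (x y : R) :
  x <= y ->
  (forall s : R, x <= s <= y -> is_derive s 1 u (du s)) ->
  (forall s : R, x <= s <= y -> is_derive s 1 v (dv s)) ->
  (forall s : R, x <= s <= y -> `|du s| <= - dv s) ->
  `|u y| <= v y -> `|u x| <= v x.
Proof.
move=> xy ud vd duv uvy.
have key (w dw : R -> R) : (forall s : R, x <= s <= y -> is_derive s 1 w (dw s)) ->
    (forall s : R, x <= s <= y -> dw s <= - dv s) -> - w y <= v y -> - w x <= v x.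
  move=> wd dwv wvy.
  have [||c] := @MVT_segment R (w \+ v) (fun s => dw s + dv s) x y xy.
  - move=> s; rewrite in_itv /= => /andP[/ltW xs /ltW sy].
    have sxy : x <= s <= y by rewrite xs sy.
    by apply: is_deriveD; [exact: wd|exact: vd].
  - apply: (is_derive_continuous_itv _ (fun s => dw s + dv s)) => s sxy.
    by apply: is_deriveD; [exact: wd|exact: vd].
  - rewrite in_itv /= => cxy eqwv.
    have : (w \+ v) y - (w \+ v) x <= 0.
      rewrite eqwv mulr_le0_ge0 ?subr_ge0 //.
      by have := dwv c cxy; lra.
    by move=> /=; lra.
rewrite ler_norml; apply/andP; split.
  rewrite lerNl; apply: (key u du) => //.
    by move=> s /duv; apply: le_trans; exact: ler_norm.
  by rewrite lerNl; move: uvy; rewrite ler_norml => /andP[].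
rewrite -[u x]opprK; apply: (key (- u) (fun s => - du s)).
- by move=> s sxy; apply: is_deriveN; exact: ud.
- by move=> s /duv; apply: le_trans; rewrite -normrN ler_norm.
- by rewrite /= opprK; move: uvy; rewrite ler_norml => /andP[].
Qed.

Lemma deriv_chain_subpoly {R : realType} (n : nat) (g : nat -> R -> R)
    (p : {poly R}) :
  deriv_chain n g -> deriv_chain n (fun j s => g j s - p^`(j).[s]).
Proof.
move=> gc j s jn s01; by apply: is_deriveB; exact: gc.
Qed.

(** Lagrange's remainder at 0. The multiple of the nodal polynomial w that creates a further zero at
    0 is subtracted as well, and Rolle's theorem gives a point where the derivative of order n + 1
    is c (n + 1)!. As the nodes lie in (0, 1], |w(0)| <= 1. *)
Lemma interpolation_error {R : realType} (n : nat) (g : nat -> R -> R)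
    (x : nat -> R) (C : R) :
  deriv_chain n.+1 g ->
  (forall s : R, 0 <= s <= 1 -> `|g n.+1 s| <= C) ->
  (forall i, (i <= n)%N -> 0 < x i <= 1) ->
  (forall i, (i < n)%N -> x i < x i.+1) ->
  `|g 0%N 0 - (interp x n (fun i => g 0%N (x i))).[0]| <= C / (n.+1)`!%:R.
Proof.
move=> gc gC x01 xinc.
set P := interp _ _ _.
have xmono i j : (i < j)%N -> (j <= n)%N -> x i < x j.
  elim: j => // j IH; rewrite ltnS leq_eqVlt => /predU1P[->|ij] jn; first exact: xinc.
  by apply: lt_trans (xinc j jn); apply: IH => //; apply: ltnW.
have xinj i j : (i <= n)%N -> (j <= n)%N -> i != j -> x i != x j.
  move=> iN jN; rewrite neq_ltn => /orP[] ij; first by rewrite lt_eqF // xmono.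
  by rewrite gt_eqF // xmono.
pose w : {poly R} := \prod_(i < n.+1) ('X - (x i)%:P).
have w0 : 0 < `|w.[0]| <= 1.
  rewrite horner_prod normr_prod; apply/andP; split.
    apply: prodr_gt0 => i _; rewrite !hornerE normr_gt0 oppr_eq0 gt_eqF //.
    by have /andP[] := x01 i (ltn_ord i).
  apply: prodr_ile1 => i _; rewrite !hornerE normrN normr_ge0 /=.
  have /andP[a b] := x01 i (ltn_ord i).
  by rewrite ger0_norm // ltW.
have w0N : w.[0] != 0 by rewrite -normr_gt0; case/andP: w0.
have wx i : (i <= n)%N -> w.[x i] = 0.
  move=> iN; rewrite horner_prod (bigD1 (Ordinal (iN : (i < n.+1)%N))) //=.
  by rewrite !hornerE subrr mul0r.
pose c := (g 0%N 0 - P.[0]) / w.[0].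
pose z i := if i is i'.+1 then x i' else 0.
have [||||xi [gxi _ _ xi01]] :=
    @rolle_chain R n.+1 (fun j s => g j s - (P + c *: w)^`(j).[s]) z.
- exact: deriv_chain_subpoly.
- case=> [|i] iN /=; first by rewrite lexx ler01.
  by have /andP[/ltW -> ->] := x01 i iN.
- case=> [|i] iN /=; first by have /andP[] := x01 0%N isT.
  exact: xinc.
- case=> [|i] iN /=; rewrite hornerD hornerZ.
    by rewrite /c divfK //; ring.
  by rewrite wx // mulr0 addr0 interp_node // subrr.
have xi1 : 0 <= xi n.+1 <= 1.
  have /andP[a b] := xi01 n.+1 (leqnn _); rewrite a (le_trans b) //=.
  by have /andP[] := x01 n (leqnn _).
have : g n.+1 (xi n.+1) = c * (n.+1)`!%:R.
  have /eqP := gxi n.+1 (leqnn _); rewrite subr_eq0 => /eqP ->.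
  have wm : w \is monic by apply: monic_prod_XsubC.
  have ws : size w = n.+2 by rewrite size_prod_XsubC [index_enum _]unlock -enumT size_enum_ord.
  rewrite derivnD derivnZ (derivn_poly0 (size_interp _ _ _)) add0r hornerZ.
  congr (_ * _).
  have -> : w^`(n.+1) = ((n.+1)`!%:R)%:P.
    apply/polyP => -[|i]; rewrite coef_derivn coefC /=.
      have : w`_n.+1 = 1 by move/monicP: wm; rewrite lead_coefE ws.
      by rewrite addn0 ffactnn => ->.
    by rewrite nth_default ?mul0rn // ws; lia.
  by rewrite hornerC.
move=> gE.
have -> : g 0%N 0 - P.[0] = c * w.[0] by rewrite /c divfK.
rewrite normrM; apply: (@le_trans _ _ `|c|).
  by rewrite ler_piMr // ?normr_ge0 //; case/andP: w0.
rewrite ler_pdivlMr ?ltr0n ?fact_gt0 //.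
have := gC _ xi1; by rewrite gE normrM normr_nat.
Qed.

(** * Bang's argument *)

Lemma is_derive_scaled_expR {R : realType} (c a y s : R) :
  is_derive s 1 (fun s => c * expR (a * (y - s)))
    (- a * (c * expR (a * (y - s)))).
Proof.
have h : is_derive s 1 (fun s : R => a * (y - s)) (- a).
  rewrite (_ : (fun _ => _) = horner (a *: (y%:P - 'X))); last first.
    by apply/funext => t; rewrite !hornerE.
  by apply: trigger_derive; rewrite derivZ derivB derivC derivX !hornerE; ring.
have h2 : is_derive s 1 (expR \o (fun s : R => a * (y - s)))
    (expR (a * (y - s)) * - a) by apply: is_derive1_comp.
apply: (@trigger_derive _ _ _ _ _ (is_deriveZ c h2)).
by rewrite /GRing.scale /=; ring.
Qed.

(** Say that order j has level psi at a point if |g_j| <= e^j A_j psi there. To the left of y the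
    level grows at rate at most e mu_J. Orders j >= J satisfy this at once because e^j psi >= 1.
    Lower orders follow by descending induction, each derivative limiting the growth of the order
    below: e^(j+1) A_(j+1) = e mu_(j+1) e^j A_j, and mu_(j+1) <= mu_J. *)
Lemma bang_step {R : realType} (k J : nat) (A mu : nat -> R)
    (g : nat -> R -> R) (xi : nat -> R) (y psi : R) :
  (forall j, 0 < A j) -> (forall j, A j.+1 = A j * mu j.+1) ->
  (forall j, (1 <= j)%N -> 0 < mu j) ->
  (forall i j, (1 <= i <= j)%N -> mu i <= mu j) ->
  deriv_chain k.+1 g ->
  (forall j (s : R), (j <= k.+1)%N -> 0 <= s <= 1 -> `|g j s| <= A j) ->
  (forall j, (j < k)%N -> xi j <= xi j.+1) ->
  (forall j, (j <= k)%N -> 0 <= xi j <= 1) ->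
  (forall j, (j <= k)%N ->
     `|g j (xi j)| <= expR 1 ^+ j * A j * expR (- k.+1%:R)) ->
  (1 <= J <= k.+1)%N -> expR (- J%:R) <= psi -> 0 <= y <= 1 ->
  (forall j, (j <= k)%N -> y <= xi j -> `|g j y| <= expR 1 ^+ j * A j * psi) ->
  forall x j, 0 <= x <= y -> (j <= k.+1)%N -> ((j <= k)%N -> x <= xi j) ->
    `|g j x| <= expR 1 ^+ j * A j * psi * expR (expR 1 * mu J * (y - x)).
Proof.
move=> A0 AS mu0 muinc gc gA xiinc xi01 gxi /andP[J1 Jk] Jpsi /andP[y0 y1] gy.
have e0 : 0 < expR 1 :> R := expR_gt0 1.
have psi0 : 0 < psi by apply: lt_le_trans Jpsi; exact: expR_gt0.
have EA0 j : 0 < expR 1 ^+ j * A j by rewrite mulr_gt0 ?exprn_gt0.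
suff H r : forall j x, (J <= j + r)%N -> 0 <= x <= y -> (j <= k.+1)%N ->
    ((j <= k)%N -> x <= xi j) ->
    `|g j x| <= expR 1 ^+ j * A j * psi * expR (expR 1 * mu J * (y - x)).
  by move=> x j; apply: (H J); rewrite leq_addl.
elim: r => [|r IHr] j x Jjr xy jk xxi.
  rewrite addn0 in Jjr; case/andP: xy => x0 xy.
  have x01 : 0 <= x <= 1 by rewrite x0 (le_trans xy y1).
  apply: le_trans (gA j x jk x01) _.
  set t := expR (expR 1 * _ * _).
  have t1 : 1 <= t by rewrite -[leLHS]expR0 ler_expR !mulr_ge0 ?subr_ge0 ?(ltW e0) ?(ltW (mu0 _ J1)).
  have p1 : 1 <= expR 1 ^+ j * psi.
    apply: le_trans (_ : expR 1 ^+ j * expR (- J%:R) <= _); last first.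
      by rewrite ler_wpM2l // ltW // exprn_gt0.
    by rewrite -expRM_natl mulr1 -expRD -[leLHS]expR0 ler_expR subr_ge0 ler_nat.
  have -> : expR 1 ^+ j * A j * psi * t = A j * (expR 1 ^+ j * psi * t) by ring.
  by rewrite ler_peMr ?(ltW (A0 j)) // mulr_ege1.
have [Jj|jJ] := leqP J j.
  by apply: IHr => //; apply: leq_trans Jj (leq_addr _ _).
have jk' : (j <= k)%N by rewrite -ltnS; apply: leq_trans jJ Jk.
case/andP: xy => x0 xy.
(* Order j is compared on [x, min(y, xi_j)]. At the right end it is small by [gy] if y <= xi_j, and
   by [gxi] otherwise. *)
pose y' := Num.min y (xi j).
have xy' : x <= y' by rewrite le_min xy xxi.
have y'y : y' <= y by rewrite ge_min lexx.
have y'xi : y' <= xi j by rewrite ge_min lexx orbT.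
pose v s := expR 1 ^+ j * A j * psi * expR (expR 1 * mu J * (y - s)).
pose dv s := - (expR 1 * mu J) * v s.
apply: (@derive_dominated R (g j) (g j.+1) v dv x y' xy').
- move=> s /andP[xs sy']; apply: gc => //.
  by rewrite (le_trans x0 xs) (le_trans (le_trans sy' y'y) y1).
- by move=> s _; apply: is_derive_scaled_expR.
- move=> s /andP[xs sy'].
  have xiS : (j.+1 <= k)%N -> s <= xi j.+1.
    by move=> jk1; apply: le_trans (le_trans sy' y'xi) (xiinc j jk1).
  have sy : 0 <= s <= y by rewrite (le_trans x0 xs) (le_trans sy' y'y).
  apply: le_trans (IHr j.+1 s _ sy _ xiS) _ => //; first by rewrite addSnnS.
  rewrite /dv /v -mulNr opprK exprS AS.
  set t := expR (expR 1 * _ * _).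
  rewrite (_ : expR 1 * expR 1 ^+ j * (A j * mu j.+1) * psi * t =
    expR 1 * mu j.+1 * (expR 1 ^+ j * A j * psi * t)); last by ring.
  rewrite ler_wpM2r //; last by rewrite ler_wpM2l ?(ltW e0) // muinc.
  by rewrite mulr_ge0 ?expR_ge0 // mulr_ge0 ?(ltW (EA0 j)) ?(ltW psi0).
rewrite /v; have v1 : 1 <= expR (expR 1 * mu J * (y - y')).
  by rewrite -[leLHS]expR0 ler_expR !mulr_ge0 ?subr_ge0 ?(ltW e0) ?(ltW (mu0 _ J1)).
apply: le_trans (_ : expR 1 ^+ j * A j * psi <= _); last first.
  by rewrite ler_peMr // mulr_ge0 ?(ltW (EA0 j)) ?(ltW psi0).
have [yxi|/ltW xiy] := leP y (xi j); first by rewrite /y' (min_l yxi) gy.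
rewrite /y' (min_r xiy); apply: le_trans (gxi j jk') _.
rewrite ler_wpM2l ?(ltW (EA0 j)) //; apply: le_trans Jpsi.
by rewrite ler_expR lerN2 ler_nat.
Qed.

(** The length of a walk to the left that raises the level from e^(-n) to e^(-J), one factor e for
    each piece of length 1/(e mu_i). *)
Definition bang_time {R : realType} (n : nat) (mu : nat -> R) (J : nat) : R :=
  \sum_(J.+1 <= i < n.+1) (expR 1 * mu i)^-1.

(** The walk starts at xi_k with level e^(-(k+1)), and a step of length 1/(e mu_J) raises the level
    from e^(-J) to e^(-(J-1)). Since xi_k < 1 and the walk to level e^(-j0) has length at least 1,
    the origin is met before that level is exceeded. *)
Lemma bang_walk {R : realType} (k j0 : nat) (A mu : nat -> R)
    (g : nat -> R -> R) (xi : nat -> R) :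
  (forall j, 0 < A j) -> (forall j, A j.+1 = A j * mu j.+1) ->
  (forall j, (1 <= j)%N -> 0 < mu j) ->
  (forall i j, (1 <= i <= j)%N -> mu i <= mu j) ->
  deriv_chain k.+1 g ->
  (forall j (s : R), (j <= k.+1)%N -> 0 <= s <= 1 -> `|g j s| <= A j) ->
  (forall j, (j < k)%N -> xi j <= xi j.+1) ->
  (forall j, (j <= k)%N -> 0 < xi j < 1) ->
  (forall j, (j <= k)%N ->
     `|g j (xi j)| <= expR 1 ^+ j * A j * expR (- k.+1%:R)) ->
  (j0 <= k)%N -> 1 <= bang_time k.+1 mu j0 ->
  `|g 0%N 0| < A 0%N * expR (- j0%:R).
Proof.
move=> A0 AS mu0 muinc gc gA xiinc xi01 gxi j0k T1.
rewrite ltNge; apply/negP => large.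
have e0 : 0 < expR 1 :> R := expR_gt0 1.
set T := bang_time k.+1 mu in T1.
have xi01' j : (j <= k)%N -> 0 <= xi j <= 1.
  by move=> /xi01 /andP[a b]; rewrite !ltW.
have ximono i j : (i <= j)%N -> (j <= k)%N -> xi i <= xi j.
  elim: j => [|j IH]; first by rewrite leqn0 => /eqP ->.
  rewrite leq_eqVlt => /predU1P[-> //|ij] jk.
  by apply: le_trans (xiinc j jk); apply: IH => //; apply: ltnW.
have /andP[xik0 xik1] := xi01 k (leqnn k).
have step := @bang_step R k _ A mu g xi _ _ A0 AS mu0 muinc gc gA xiinc xi01' gxi.
have TS J : (J <= k)%N -> T J = (expR 1 * mu J.+1)^-1 + T J.+1.
  by move=> Jk; rewrite /T /bang_time big_ltn ?ltnS.
(* Invariant after r steps: the walk is still to the right of 0 and its level is e^(-(k+1-r)). At r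
   = k + 1 - j0 this would require T(j0) < xi_k < 1. *)
suff H r : (r <= k.+1 - j0)%N -> T (k.+1 - r)%N < xi k /\
    forall j, (j <= k)%N -> xi k - T (k.+1 - r)%N <= xi j ->
    `|g j (xi k - T (k.+1 - r)%N)| <=
      expR 1 ^+ j * A j * expR (- (k.+1 - r)%:R).
  have [] := H (k.+1 - j0)%N (leqnn _).
  by rewrite subKn; [lra|exact: leqW].
elim: r => [|r IHr] rk.
  rewrite subn0 /T /bang_time big_geq //; split=> // j jk; rewrite subr0 => xkj.
  (* By monotonicity, the only orders concerned at the start are those with xi_j = xi_k. *)
  have -> : xi k = xi j by apply: le_anti; rewrite xkj ximono.
  exact: gxi.
have [Tlt lev] := IHr (ltnW rk).
set J := (k.+1 - r)%N in Tlt lev.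
have JE : (k.+1 - r.+1)%N = J.-1 by rewrite /J; move: rk j0k; clear; lia.
have J1 : (1 <= J <= k.+1)%N by rewrite /J; move: rk j0k; clear; lia.
have J0 : (0 < J)%N by case/andP: J1.
rewrite JE; set J' := J.-1.
have JJ' : J = J'.+1 by rewrite /J' prednK.
have eJ : 0 < expR 1 * mu J by rewrite mulr_gt0 ?mu0.
have TJ : T J' = (expR 1 * mu J)^-1 + T J by rewrite JJ' TS // -ltnS -JJ'; case/andP: J1.
pose y := xi k - T J.
have T0 : 0 <= T J.
  rewrite /T /bang_time big_nat_cond sumr_ge0 // => i /andP[/andP[Ji _] _].
  by rewrite invr_ge0 mulr_ge0 ?(ltW e0) // ltW // mu0 // (leq_trans _ Ji).
have y01 : 0 <= y <= 1 by rewrite /y; apply/andP; split; lra.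
have {}step := step J y (expR (- J%:R)) J1 (lexx _) y01 lev.
have eJJ : expR (- J%:R) * expR 1 = expR (- J'%:R) :> R.
  by rewrite -expRD JJ' -(addn1 J') natrD; congr expR; ring.
have [xiT|Txi] := leP (xi k) (T J').
  have {}H0 : `|g 0%N 0| <= A 0%N * expR (- J%:R) * expR (expR 1 * mu J * y).
    have := step 0 0%N; rewrite lexx expr0 mul1r subr0; apply => //.
      by case/andP: y01.
    by move=> _; case/andP: (xi01' 0%N isT).
  have yle : expR 1 * mu J * y <= 1.
    by rewrite mulrC -ler_pdivlMr // mul1r /y; move: xiT; rewrite TJ; lra.
  have J'j0 : (j0 <= J')%N by rewrite /J' /J; move: rk; clear; lia.
  have : A 0%N * expR (- J%:R) * expR (expR 1 * mu J * y) <
         A 0%N * expR (- j0%:R).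
    rewrite -mulrA ltr_pM2l //.
    have [J'E|J'N] := eqVneq J' j0.
      rewrite -J'E -eJJ ltr_pM2l ?expR_gt0 // ltr_expR.
      rewrite mulrC -ltr_pdivlMr // mul1r /y.
      by move: TJ; rewrite J'E; lra.
    apply: le_lt_trans (_ : expR (- J'%:R) < _).
      by rewrite -eJJ ler_pM2l ?expR_gt0 // ler_expR.
    by rewrite ltr_expR ltrN2 ltr_nat ltn_neqAle eq_sym J'N.
  by move=> h; move: (le_lt_trans H0 h); rewrite ltNge large.
split=> // j jk xj.
have xy : xi k - T J' <= y by rewrite /y TJ; have := eJ; rewrite -invr_gt0; lra.
apply: le_trans (step _ j _ (leqW jk) (fun _ => xj)) _.
  by rewrite xy andbT subr_ge0 ltW.
rewrite (_ : y - _ = (expR 1 * mu J)^-1); last by rewrite /y TJ; ring.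
by rewrite mulfV ?gt_eqF // -mulrA eJJ.
Qed.

(** * The Remez inequality for a chain of derivatives *)

Lemma exp_term_le (R : realType) (k r : nat) :
  k%:R ^+ r / r`!%:R <= expR 1 ^+ k :> R.
Proof.
rewrite -expRM_natl mulr1; case: r => [|r].
  by rewrite expr0 fact0 divr1 -[leLHS]expR0 ler_expR.
have := @expR_ge1Dxn R k%:R r (ler0n _ _); apply: le_trans.
by rewrite lerDr.
Qed.

Lemma derivn_shift {R : realType} (p : {poly R}) (c : R) (j : nat) :
  (p \Po ('X + c%:P))^`(j) = p^`(j) \Po ('X + c%:P).
Proof.
elim: j p => [//|j IH] p.
by rewrite !derivSn deriv_comp derivD derivX derivC addr0 mulr1 IH.
Qed.

Lemma derivn_horner_shift {R : realType} (p : {poly R}) (c : R) (j : nat) :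
  p^`(j).[c] = (p \Po ('X + c%:P))`_j * j`!%:R.
Proof.
transitivity ((p \Po ('X + c%:P))^`(j)).[0].
  by rewrite derivn_shift horner_comp !hornerE.
by rewrite horner_coef0 coef_derivn addn0 ffactnn mulr_natr.
Qed.

Lemma bin_le_exp2 (R : realType) (k j : nat) : 'C(k, j)%:R <= 2 ^+ k :> R.
Proof.
have [jk|kj] := leqP j k; last by rewrite bin_small // exprn_ge0.
rewrite -[2]/(1 + 1) exprD1n (bigD1 (Ordinal (jk : (j < k.+1)%N))) //=.
rewrite expr1n lerDl sumr_ge0 // => i _; by rewrite expr1n.
Qed.

(** Put b = |g_0(0)|. If A_n/n! <= b/2 for some n, interpolation at n nodes determines g_0(0) up to
    b/2. Otherwise A_j >= (b/2) j! for all j <= k. Let P interpolate at all k + 1 nodes, so that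
    g_j(xi_j) = P^(j)(xi_j). By Bang's walk and the lower bound on b, these values cannot all have
    level e^(-(k+1)); so some |P^(j)(xi_j)| exceeds (b/2) j! e^(-(k+1)), while Lagrange's formula
    bounds it by a multiple of eps. The factor 2e (4 e^2/tau)^k collects 2 e^(k+1) from this lower
    bound, 2^k from the binomial coefficients and (2e/tau)^k from the spacing. *)
Theorem remez_chain (R : realType) (k j0 : nat) (A mu : nat -> R)
    (g : nat -> R -> R) (x : nat -> R) (tau eps : R) :
  (1 <= k)%N -> (forall j, 0 < A j) -> (forall j, A j.+1 = A j * mu j.+1) ->
  (forall j, (1 <= j)%N -> 0 < mu j) ->
  (forall i j, (1 <= i <= j)%N -> mu i <= mu j) ->
  deriv_chain k.+1 g ->
  (forall j (s : R), (j <= k.+1)%N -> 0 <= s <= 1 -> `|g j s| <= A j) ->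
  (j0 <= k)%N -> 1 <= bang_time k.+1 mu j0 ->
  A 0%N * expR (- j0%:R) <= `|g 0%N 0| ->
  0 < tau <= 1 -> gapped k (tau / k%:R) x ->
  (forall i, (i < k)%N -> x i < x i.+1) ->
  (forall i, (i <= k)%N -> 0 < x i < 1) ->
  (forall i, (i <= k)%N -> `|g 0%N (x i)| <= eps) ->
  `|g 0%N 0| <= 2 * expR 1 * (4 * expR 1 ^+ 2 / tau) ^+ k * eps.
Proof.
move=> k0 A0 AS mu0 muinc gc gA j0k T1 gbig /andP[tau0 tau1] gx xinc x01 geps.
have e0 : 0 < expR 1 :> R := expR_gt0 1.
have e1 : 1 <= expR 1 :> R by rewrite -[leLHS]expR0 ler_expR.
have eps0 : 0 <= eps by apply: le_trans (geps 0%N isT).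
have kR : 0 < k%:R :> R by rewrite ltr0n.
set b := `|g 0%N 0| in gbig *.
have b0 : 0 < b by apply: lt_le_trans gbig; rewrite mulr_gt0 ?expR_gt0.
have bA : b <= A 0%N by apply: gA => //; rewrite lexx ler01.
pose delta := tau / k%:R; have d0 : 0 < delta by rewrite divr_gt0.
have xinj := @gapped_inj R k delta x d0 gx.
have x01' i : (i <= k)%N -> 0 < x i <= 1 by move=> /x01 /andP[-> /ltW].
have dE (r : nat) : (2 / delta) ^+ r / r`!%:R <= (2 / tau) ^+ r * expR 1 ^+ k.
  have -> : 2 / delta = 2 / tau * k%:R.
    by rewrite /delta; field; rewrite !gt_eqF.
  rewrite exprMn -mulrA ler_wpM2l ?exp_term_le // exprn_ge0 // divr_ge0 //.
  exact: ltW.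
have tau2 : 1 <= 2 / tau by rewrite ler_pdivlMr // mul1r; lra.
have tau20 : 0 <= 2 / tau := le_trans ler01 tau2.
have [[n nk nA]|notA] := pselect (exists2 n, (1 <= n <= k)%N & A n / n`!%:R <= b / 2).
  (* The order of the remainder is from here on n + 1, and the nodes used are x_0, ..., x_n. *)
  case: n nk nA => // n nk nA.
  have nk' : (n <= k)%N by apply: ltnW; case/andP: nk.
  have nk1 : (n < k.+1)%N by apply: ltnW.
  set P := interp x n (fun i => g 0%N (x i)).
  have err : `|g 0%N 0 - P.[0]| <= A n.+1 / (n.+1)`!%:R.
    apply: interpolation_error.
    - by move=> j s jn; apply: gc; apply: leq_trans nk1.
    - by move=> s; apply: gA; apply: ltnW.
    - by move=> i ij; apply: x01'; apply: leq_trans nk'.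
    - by move=> i ij; apply: xinc; apply: leq_trans nk'.
  have xinjn : forall i j, (i <= n)%N -> (j <= n)%N -> i != j -> x i != x j.
    by move=> i j iN jN; apply: xinj; apply: leq_trans nk'.
  have P0 : `|P.[0]| <= eps * ((2 / tau) ^+ n * expR 1 ^+ k).
    have := @interpolation_bound R n delta 0 eps x P d0
      (gapped_sub _ _ _ _ nk' gx) (size_interp _ _ _) _ _ 0%N.
    rewrite -[X in `|X|]mulr1 -[X in _ * X]/(0`!%:R) -derivn_horner_shift.
    rewrite derivn0 bin0 mulr1 -mulrA => H.
    apply: le_trans (H _ _) _; last by rewrite ler_wpM2l.
    - move=> j jn; rewrite sub0r normrN ger0_norm.
        by have /andP[_] := x01' j (leq_trans jn nk').
      by have /andP[/ltW] := x01' j (leq_trans jn nk').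
    - move=> j jn; rewrite interp_node //; apply: geps; exact: leq_trans nk'.
  have b2 : b <= 2 * `|P.[0]|.
    have := le_trans err nA; have := ler_normB (g 0%N 0 - P.[0]) (- P.[0]).
    by rewrite opprK subrK normrN -/b; lra.
  have key : (2 / tau) ^+ n * expR 1 ^+ k <=
      expR 1 * (4 * expR 1 ^+ 2 / tau) ^+ k :> R.
    have -> : (4 * expR 1 ^+ 2 / tau) ^+ k =
        (2 / tau) ^+ k * expR 1 ^+ k * (2 * expR 1) ^+ k :> R.
      by rewrite -!exprMn; congr (_ ^+ _); ring.
    rewrite mulrCA -[leLHS]mulr1 ler_pM //.
    - by apply: mulr_ge0; apply: exprn_ge0 => //; apply: ltW.
    - by rewrite ler_wpM2r ?exprn_ge0 ?(ltW e0) // ler_weXn2l.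
    - by rewrite mulr_ege1 // exprn_ege1 // mulr_ege1 // ler1n.
  apply: le_trans b2 _; apply: le_trans (ler_wpM2l _ P0) _; first by [].
  set Q := (4 * expR 1 ^+ 2 / tau) ^+ k in key *.
  rewrite (_ : 2 * expR 1 * Q * eps = 2 * (eps * (expR 1 * Q))); last by ring.
  by rewrite ler_wpM2l // ler_wpM2l.
pose P := interp x k (fun i => g 0%N (x i)).
have [|||| xi [gxi xiinc _ xi01]] := @rolle_chain R k (fun j s => g j s - P^`(j).[s]) x.
- by apply: deriv_chain_subpoly => j s jk; apply: gc; apply: leqW.
- by move=> i /x01 /andP[/ltW -> /ltW ->].
- exact: xinc.
- by move=> i ik; rewrite derivn0 interp_node // subrr.
have xi01s j : (j <= k)%N -> 0 < xi j < 1.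
  move=> /xi01 /andP[a b'].
  have /andP[p _] := x01 0%N isT; have /andP[_ q] := x01 k (leqnn k).
  by rewrite (lt_le_trans p a) (le_lt_trans b' q).
have [small|] := pselect (forall j, (j <= k)%N ->
    `|g j (xi j)| <= expR 1 ^+ j * A j * expR (- k.+1%:R)).
  have := @bang_walk R k j0 A mu g xi A0 AS mu0 muinc gc gA xiinc xi01s small j0k T1.
  by rewrite ltNge gbig.
move=> /existsNP[j /not_implyP[jk /negP]]; rewrite -ltNge.
have /eqP := gxi j jk; rewrite subr_eq0 => /eqP ->; rewrite derivn_horner_shift.
have Pj := @interpolation_bound R k delta (xi j) eps x P d0 gx (size_interp _ _ _) _ _ j.
have Aj : b / 2 * j`!%:R <= A j.
  have fj : 0 < j`!%:R :> R by rewrite ltr0n fact_gt0.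
  case: j jk {Pj} fj => [|j] jk fj; first by rewrite fact0 mulr1; lra.
  rewrite -ler_pdivlMr // leNgt; apply/negP => /ltW h; apply: notA.
  by exists j.+1.
set q := (P \Po _)`_j in Pj *.
have fj : 0 < j`!%:R :> R by rewrite ltr0n fact_gt0.
rewrite normrM normr_nat => lower.
have {}Pj : `|q| <= eps * (2 ^+ k * ((2 / tau) ^+ k * expR 1 ^+ k)).
  apply: le_trans (Pj _ _) _.
  - move=> i ik; have /andP[a1 a2] := xi01s j jk; have /andP[c1 c2] := x01 i ik.
    by rewrite ler_norml; apply/andP; split; lra.
  - by move=> i ik; rewrite interp_node //; apply: geps.
  rewrite -!mulrA ler_wpM2l // ler_pM ?bin_le_exp2 //.
  by rewrite divr_ge0 // exprn_ge0 // divr_ge0 // ltW.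
have : b / 2 * expR (- k.+1%:R) <= `|q|.
  rewrite -(ler_pM2r fj); apply: le_trans (ltW lower).
  rewrite mulrAC ler_wpM2r ?expR_ge0 //; apply: le_trans Aj _.
  by rewrite ler_peMl ?(ltW (A0 j)) // exprn_ege1.
move=> /le_trans/(_ Pj); rewrite expRN.
rewrite ler_pdivrMr ?expR_gt0 // => h.
have -> : 2 * expR 1 * (4 * expR 1 ^+ 2 / tau) ^+ k * eps =
  2 * (eps * (2 ^+ k * ((2 / tau) ^+ k * expR 1 ^+ k)) * expR k.+1%:R).
  have -> : (4 * expR 1 ^+ 2 / tau) ^+ k =
      2 ^+ k * (2 / tau) ^+ k * expR 1 ^+ k * expR 1 ^+ k :> R.
    by rewrite -!exprMn; congr (_ ^+ _); ring.
  have -> : expR k.+1%:R = expR 1 * expR 1 ^+ k :> R.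
    by rewrite -exprS -expRM_natl mulr1.
  by ring.
by move: h; lra.
Qed.

(** * Partial derivatives *)

Lemma nbhs_box {R : realType} (n : nat) (x : 'rV[R]_n) (A : set 'rV[R]_n) :
  nbhs x A <-> exists2 d : R, 0 < d &
    forall y : 'rV[R]_n, (forall i, `|y 0 i - x 0 i| < d) -> A y.
Proof.
split=> [/nbhs_ballP|]; first move=> [d d0 dA].
  exists d => // y xy; apply: dA.
  by split=> // i j; rewrite ord1 -ball_normE /= distrC.
move=> [d d0 dA]; apply/nbhs_ballP; exists d => // y xy; apply: dA.
by move=> i; have := xy.2 0 i; rewrite -ball_normE /= distrC.
Qed.

Lemma open_box {R : realType} (n : nat) (U : set 'rV[R]_n) (x : 'rV[R]_n) :
  open U -> U x -> exists2 d : R, 0 < d &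
    forall y : 'rV[R]_n, (forall i, `|y 0 i - x 0 i| < d) -> U y.
Proof. by move=> Uo Ux; apply/nbhs_box; apply: open_nbhs_nbhs. Qed.

Lemma continuous_box {R : realType} (n : nat) (g : 'rV[R]_n -> R)
    (x : 'rV[R]_n) :
  {for x, continuous g} <-> forall e : R, 0 < e -> exists2 d : R, 0 < d &
    forall y : 'rV[R]_n, (forall i, `|y 0 i - x 0 i| < d) -> `|g y - g x| <= e.
Proof.
split=> [gx e e0|H].
  apply/nbhs_box.
  have /cvgrPdist_le/(_ e e0) := gx.
  by apply: filterS => y; rewrite distrC.
apply/(@cvgrPdist_le _ _ _ (nbhs x) (nbhs_filter x) g (g x)) => e e0.
apply/nbhs_box.
by have [d d0 dP] := H e e0; exists d => // y /dP; rewrite distrC.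
Qed.

Lemma is_derive_line {R : realType} (n : nat) (g : 'rV[R]_n -> R)
    (x v : 'rV[R]_n) (s : R) :
  derivable g (x + s *: v) v ->
  is_derive s 1 (fun t : R => g (x + t *: v)) ('D_v g (x + s *: v)).
Proof.
have E : (fun h : R => h^-1 *: (((fun t : R => g (x + t *: v)) \o shift s) (h *: 1) -
    g (x + s *: v))) =
  (fun h : R => h^-1 *: ((g \o shift (x + s *: v)) (h *: v) - g (x + s *: v))).
  apply/funext => h /=; congr (_ *: (g _ - _)).
  by rewrite [h%:A]mulr1 scalerDl addrCA.
move=> gv; apply: DeriveDef; first by rewrite /derivable E.
by rewrite /derive E.
Qed.

Lemma partial_mvt {R : realType} (n : nat) (g : 'rV[R]_n -> R) (i : 'I_n)
    (x : 'rV[R]_n) (t : R) :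
  (forall s : R, `|s| <= `|t| -> derivable g (x + s *: delta_mx 0 i) (delta_mx 0 i)) ->
  exists2 s : R, `|s| <= `|t| &
    g (x + t *: delta_mx 0 i) - g x = t * partial i g (x + s *: delta_mx 0 i).
Proof.
move=> gd.
pose v : 'rV[R]_n := delta_mx 0 i.
pose h s := g (x + s *: v); pose dh s := partial i g (x + s *: v).
have hd (s : R) : `|s| <= `|t| -> is_derive s 1 h (dh s).
  by move=> /gd; apply: is_derive_line.
have h0 : h 0 = g x by rewrite /h scale0r addr0.
have [t0|t0] := leP 0 t.
  have st (s : R) : 0 <= s <= t -> `|s| <= `|t|.
    by move=> /andP[s0 st]; rewrite !ger0_norm.
  have [||s] := @MVT_segment R h dh 0 t t0.
  - by move=> s; rewrite in_itv /= => /andP[/ltW a /ltW b]; apply/hd/st/andP.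
  - by apply: (@is_derive_continuous_itv R h dh) => s /st; apply: hd.
  rewrite in_itv /= => /st sP; rewrite h0 subr0 => E; exists s => //.
  by rewrite -/v -/(h t) E mulrC.
have st (s : R) : t <= s <= 0 -> `|s| <= `|t|.
  by move=> /andP[s0 st]; rewrite (ler0_norm st) (ltr0_norm t0) lerN2.
have [||s] := @MVT_segment R h dh t 0 (ltW t0).
- by move=> s; rewrite in_itv /= => /andP[/ltW a /ltW b]; apply/hd/st/andP.
- by apply: (@is_derive_continuous_itv R h dh) => s /st; apply: hd.
rewrite in_itv /= => /st sP; rewrite h0 sub0r => E; exists s => //.
by rewrite -/v -/(h t) -opprB E mulrN opprK mulrC.
Qed.

(* The telescoping of [f y - f x] along the coordinates gives the Caratheodory
   form of differentiability. *)
Definition mix {R : realType} (n : nat) (x y : 'rV[R]_n) (k : nat) : 'rV[R]_n :=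
  \row_j (if (j < k)%N then y 0 j else x 0 j).

Definition slope {R : realType} (n : nat) (f : 'rV[R]_n -> R) (x : 'rV[R]_n)
    (i : 'I_n) (y : 'rV[R]_n) : R :=
  if y 0 i == x 0 i then partial i f x
  else (f (mix n x y i.+1) - f (mix n x y i)) / (y 0 i - x 0 i).

Lemma mixS {R : realType} (n : nat) (x y : 'rV[R]_n) (i : 'I_n) :
  mix n x y i.+1 = mix n x y i + (y 0 i - x 0 i) *: delta_mx 0 i.
Proof.
apply/rowP => j; rewrite !mxE eqxx /= ltnS leq_eqVlt.
have [->|ji] := eqVneq j i; first by rewrite eqxx ltnn /= mulr1 addrC subrK.
by rewrite (_ : (j : nat) == i = false) ?mulr0 ?addr0 //; apply/negbTE.
Qed.

Lemma slopeP {R : realType} (n : nat) (f : 'rV[R]_n -> R) (x y : 'rV[R]_n) :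
  f y - f x = \sum_(i < n) slope n f x i y * (y 0 i - x 0 i).
Proof.
transitivity (\sum_(i < n) (f (mix n x y i.+1) - f (mix n x y i))).
  rewrite -(big_mkord xpredT (fun i => f (mix n x y i.+1) - f (mix n x y i))).
  rewrite telescope_sumr //; congr (f _ - f _); apply/rowP => j; rewrite mxE //.
  by rewrite ltn_ord.
apply: eq_bigr => i _; rewrite /slope; case: eqP => [yx|/eqP yx].
  by rewrite mixS yx subrr scale0r addr0 subrr mulr0.
by rewrite divfK // subr_eq0.
Qed.

(** By the mean value theorem in coordinate i, the quotient is a value of the i-th partial
    derivative at a point no farther from x than y in any coordinate. *)
Lemma slope_continuous {R : realType} (n : nat) (U : set 'rV[R]_n)
    (f : 'rV[R]_n -> R) (x : 'rV[R]_n) (i : 'I_n) :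
  open U -> U x -> Ck_on 1 U f -> {for x, continuous (slope n f x i)}.
Proof.
move=> Uo Ux [_ /(_ i) [fd [fc _]]].
have [d1 d10 d1U] := open_box n U x Uo Ux.
apply/continuous_box => e e0.
have /continuous_box/(_ e e0)[d2 d20 d2P] : {for x, continuous (partial i f)}.
  by apply: fc; rewrite inE.
exists (Num.min d1 d2); first by rewrite lt_min d10.
move=> y xy.
have -> : slope n f x i x = partial i f x by rewrite /slope eqxx.
rewrite {1}/slope; case: eqP => [_|/eqP yx]; first by rewrite subrr normr0 ltW.
have near s : `|s| <= `|y 0 i - x 0 i| -> forall j,
   `|(mix n x y i + s *: delta_mx 0 i) 0 j - x 0 j| < Num.min d1 d2.
  move=> sy j; rewrite !mxE eqxx /=; have [->|ji] := eqVneq j i.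
    rewrite ltnn mulr1 addrAC subrr add0r; exact: le_lt_trans (xy i).
  rewrite mulr0 addr0; case: ifP => _; first exact: xy.
  by rewrite subrr normr0 lt_min d10.
have [|s sy E] := @partial_mvt R n f i (mix n x y i) (y 0 i - x 0 i).
  move=> s sy; apply: fd; apply: d1U => j.
  by apply: lt_le_trans (near s sy j) _; rewrite ge_min lexx.
rewrite mixS E mulrC mulKf ?subr_eq0 //.
apply: d2P => j; apply: lt_le_trans (near s sy j) _; by rewrite ge_min lexx orbT.
Qed.

(** [Ck_on] speaks of partial derivatives only. The chain rule is therefore obtained from
    Caratheodory's criterion, by multiplying the slopes of f with those of the coordinates of c. *)
Lemma is_derive_comp_curve {R : realType} (n : nat) (U : set 'rV[R]_n)
    (f : 'rV[R]_n -> R) (c : R -> 'rV[R]_n) (dc : 'I_n -> R) (s : R) :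
  open U -> U (c s) -> Ck_on 1 U f ->
  (forall i, is_derive s 1 (fun t => c t 0 i) (dc i)) ->
  is_derive s 1 (fun t => f (c t)) (\sum_(i < n) partial i f (c s) * dc i).
Proof.
move=> Uo Us fC cd; apply/is_derive1_caratheodory.
have H i : exists g, [/\ forall z, c z 0 i - c s 0 i = g z * (z - s),
    {for s, continuous g} & g s = dc i].
  by have /is_derive1_caratheodory := cd i.
have [h hP] := choice H.
exists (fun z => \sum_(i < n) slope n f (c s) i (c z) * h i z); split.
- move=> z; rewrite slopeP mulr_suml; apply: eq_bigr => i _.
  by have [-> _ _] := hP i; rewrite mulrA.
- apply: cvg_big => [|i _]; first exact: add_continuous.
  have [_ hc _] := hP i; apply: cvgM; last exact: hc.
  have /continuous_box sc := slope_continuous n U f (c s) i Uo Us fC.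
  apply/cvgrPdist_le => e /sc[d d0 dP].
  have : \forall t \near s, forall j, `|c s 0 j - c t 0 j| < d.
    apply: (@filter_forall R 'I_n (fun j t => `|c s 0 j - c t 0 j| < d) (nbhs s)) => j.
    have cj : {for s, continuous (fun t => c t 0 j)}.
      by apply/differentiable_continuous/derivable1_diffP; have [] := cd j.
    by have /cvgrPdist_lt/(_ d d0) := cj.
  apply: filterS => t cst; rewrite distrC; apply: dP => j.
  by rewrite distrC.
- apply: eq_bigr => i _; have [_ _ ->] := hP i; by rewrite /slope eqxx.
Qed.

(** The mean value theorem in direction i, then in direction j, expresses the second difference as
    t^2 times a value of the mixed derivative near x. *)
Lemma double_difference {R : realType} (n : nat) (U : set 'rV[R]_n)
    (f : 'rV[R]_n -> R) (x : 'rV[R]_n) (i j : 'I_n) (e : R) :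
  open U -> U x -> Ck_on 2 U f -> 0 < e -> exists2 d : R, 0 < d &
    forall t : R, `|t| < d ->
      `|f (x + t *: delta_mx 0 i + t *: delta_mx 0 j) - f (x + t *: delta_mx 0 i)
        - (f (x + t *: delta_mx 0 j) - f x)
        - t * (t * partial j (partial i f) x)| <= `|t| * (`|t| * e).
Proof.
move=> Uo Ux [_ fC] e0.
have [fd [_ /(_ j) [fdd [fddc _]]]] := fC i.
have [d1 d10 d1U] := open_box n U x Uo Ux.
have /continuous_box/(_ e e0)[d2 d20 d2P] :
    {for x, continuous (partial j (partial i f))} by apply: fddc; rewrite inE.
pose ei : 'rV[R]_n := delta_mx 0 i; pose ej : 'rV[R]_n := delta_mx 0 j.
have d120 : 0 < Num.min d1 d2 by rewrite lt_min d10.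
exists (Num.min d1 d2 / 2); first by rewrite divr_gt0.
move=> t td.
have near (s s' : R) : `|s| <= `|t| -> `|s'| <= `|t| -> forall k,
    `|(x + s *: ei + s' *: ej) 0 k - x 0 k| < Num.min d1 d2.
  move=> st s't k; rewrite !mxE eqxx /=.
  have -> : x 0 k + s * (k == i)%:R + s' * (k == j)%:R - x 0 k =
    s * (k == i)%:R + s' * (k == j)%:R by ring.
  apply: le_lt_trans (ler_normD _ _) _; rewrite !normrM !normr_nat.
  have b1 : `|s| * (k == i)%:R <= `|s| by rewrite ler_piMr // lern1 leq_b1.
  have b2 : `|s'| * (k == j)%:R <= `|s'| by rewrite ler_piMr // lern1 leq_b1.
  by lra.
have nearU (s s' : R) : `|s| <= `|t| -> `|s'| <= `|t| -> U (x + s *: ei + s' *: ej).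
  move=> st s't; apply: d1U => k; apply: lt_le_trans (near s s' st s't k) _.
  by rewrite ge_min lexx.
have t00 : `|0 : R| <= `|t| by rewrite normr0.
pose dg s := partial i f (x + t *: ej + s *: ei) - partial i f (x + s *: ei).
pose g s := f (x + t *: ej + s *: ei) - f (x + s *: ei).
have gd (s : R) : `|s| <= `|t| -> is_derive s 1 g (dg s).
  move=> st; apply: is_deriveB; apply: is_derive_line; apply: fd.
    by rewrite addrAC; apply: nearU.
  by have := nearU s 0 st t00; rewrite scale0r addr0.
have [s st E] : exists2 s : R, `|s| <= `|t| & g t - g 0 = t * dg s.
  have [t0|t0] := leP 0 t.
    have st (s : R) : 0 <= s <= t -> `|s| <= `|t|.
      by move=> /andP[s0 st]; rewrite !ger0_norm.
    have [||s] := @MVT_segment R g dg 0 t t0.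
    - by move=> s; rewrite in_itv /= => /andP[/ltW a /ltW b]; apply/gd/st/andP.
    - by apply: (@is_derive_continuous_itv R g dg) => s /st; apply: gd.
    rewrite in_itv /= => /st sP; rewrite subr0 => E; exists s => //.
    by rewrite E mulrC.
  have st (s : R) : t <= s <= 0 -> `|s| <= `|t|.
    by move=> /andP[s0 st]; rewrite (ler0_norm st) (ltr0_norm t0) lerN2.
  have [||s] := @MVT_segment R g dg t 0 (ltW t0).
  - by move=> s; rewrite in_itv /= => /andP[/ltW a /ltW b]; apply/gd/st/andP.
  - by apply: (@is_derive_continuous_itv R g dg) => s /st; apply: gd.
  rewrite in_itv /= => /st sP; rewrite sub0r => E; exists s => //.
  by rewrite -opprB E mulrN opprK mulrC.
have [|s' s't E'] := @partial_mvt R n (partial i f) j (x + s *: ei) t.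
  by move=> s' s't; apply: fdd; apply: nearU.
have -> : f (x + t *: delta_mx 0 i + t *: delta_mx 0 j) - f (x + t *: delta_mx 0 i)
        - (f (x + t *: delta_mx 0 j) - f x) = g t - g 0.
  by rewrite /g !scale0r !addr0 -/ei -/ej [x + t *: ej + t *: ei]addrAC.
rewrite E {1}/dg [x + t *: ej + s *: ei]addrAC E' -!mulrBr !normrM.
rewrite !ler_wpM2l //; apply: d2P => k.
by apply: lt_le_trans (near s s' st s't k) _; rewrite ge_min lexx orbT.
Qed.

(** The second difference is symmetric in i and j and approximates t^2 times either mixed
    derivative. *)
Lemma partialC {R : realType} (n : nat) (U : set 'rV[R]_n)
    (f : 'rV[R]_n -> R) (x : 'rV[R]_n) (i j : 'I_n) :
  open U -> U x -> Ck_on 2 U f ->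
  partial i (partial j f) x = partial j (partial i f) x.
Proof.
move=> Uo Ux fC.
apply/eqP; rewrite -subr_eq0 -normr_le0; apply/ler_addgt0Pl => e e0.
rewrite addr0.
have e20 : 0 < e / 2 by rewrite divr_gt0.
have [d1 d10 d1P] := double_difference n U f x i j _ Uo Ux fC e20.
have [d2 d20 d2P] := double_difference n U f x j i _ Uo Ux fC e20.
have d120 : 0 < Num.min d1 d2 by rewrite lt_min d10.
pose t := Num.min d1 d2 / 2; have t0 : 0 < t by rewrite divr_gt0.
have tlt : t < Num.min d1 d2 by rewrite /t; lra.
have := d1P t; have := d2P t; rewrite gtr0_norm //.
rewrite (lt_le_trans tlt) ?ge_min ?lexx ?orbT //.
rewrite (lt_le_trans tlt) ?ge_min ?lexx //.
move=> /(_ isT) H2 /(_ isT) H1.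
rewrite [x + _ + _]addrAC in H2.
set a := partial i _ x in H2 *; set b := partial j _ x in H1 *.
have tt0 : 0 < t * t by rewrite mulr_gt0.
rewrite -(ler_pM2l tt0) -[X in X * `|_|]gtr0_norm // -normrM.
set u := f (x + _ + _) in H1 H2.
set u1 := f (x + _) in H1 H2; set u2 := f (x + _) in H1 H2.
have -> : t * t * (a - b) = (u - u1 - (u2 - f x) - t * (t * b)) -
    (u - u2 - (u1 - f x) - t * (t * a)) by ring.
rewrite (_ : t * t * e = t * (t * (e / 2)) + t * (t * (e / 2))); last by field.
exact: le_trans (ler_normB _ _) (lerD H1 H2).
Qed.

(** * Iterated partial derivatives along words of indices *)

Definition dseq {R : realType} (n : nat) (t : seq 'I_n) (f : 'rV[R]_n -> R) :
    'rV[R]_n -> R :=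
  foldr (fun i g => partial i g) f t.

Lemma Ck_onW {R : realType} (n k : nat) (U : set 'rV[R]_n) (f : 'rV[R]_n -> R) :
  Ck_on k.+1 U f -> Ck_on k U f.
Proof.
elim: k f => [|k IHk] f; first by case.
by move=> [fc fC]; split=> // i; have [fd fC'] := fC i; split=> //; apply: IHk.
Qed.

Lemma Ck_on_le {R : realType} (n k l : nat) (U : set 'rV[R]_n) (f : 'rV[R]_n -> R) :
  (l <= k)%N -> Ck_on k U f -> Ck_on l U f.
Proof.
move=> /subnK <-; elim: (k - l)%N => [//|m IH]; rewrite addSn => /Ck_onW; exact: IH.
Qed.

Lemma near_open {R : realType} (n : nat) (U : set 'rV[R]_n)
    (f g : 'rV[R]_n -> R) (x : 'rV[R]_n) :
  open U -> U x -> (forall y, U y -> f y = g y) -> \near x, f x = g x.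
Proof.
move=> Uo Ux fg; have := open_nbhs_nbhs (conj Uo Ux).
by apply: filterS => y /fg.
Qed.

Lemma partial_eq_on {R : realType} (n : nat) (U : set 'rV[R]_n)
    (f g : 'rV[R]_n -> R) (i : 'I_n) :
  open U -> (forall y, U y -> f y = g y) ->
  forall y, U y -> partial i f y = partial i g y.
Proof.
move=> Uo fg y Uy; apply: near_eq_derive; exact: (near_open n U).
Qed.

Lemma dseq_Ck {R : realType} (n k : nat) (U : set 'rV[R]_n) (t : seq 'I_n)
    (f : 'rV[R]_n -> R) :
  Ck_on (size t + k) U f -> Ck_on k U (dseq n t f).
Proof.
elim: t k => [//|i t IH] k /= fC.
have /IH[_ /(_ i)[]] : Ck_on (size t + k.+1) U f by rewrite addnS.
by [].
Qed.

Lemma dseq_catCA {R : realType} (n : nat) (U : set 'rV[R]_n)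
    (t1 t2 : seq 'I_n) (i : 'I_n) (f : 'rV[R]_n -> R) :
  open U -> Ck_on (size t1 + size t2).+1 U f ->
  forall x, U x -> dseq n (t1 ++ i :: t2) f x = dseq n (i :: t1 ++ t2) f x.
Proof.
move=> Uo; elim: t1 => [//|j t1 IH] fC x Ux.
have fC1 : Ck_on (size t1 + size t2).+1 U f by exact: Ck_onW fC.
have /= -> := partial_eq_on n U _ _ j Uo (IH fC1) x Ux.
apply: (partialC n U) => //; apply: dseq_Ck.
by rewrite size_cat addn2.
Qed.

Lemma dseq_perm {R : realType} (n : nat) (U : set 'rV[R]_n)
    (t t' : seq 'I_n) (f : 'rV[R]_n -> R) :
  open U -> Ck_on (size t) U f -> perm_eq t t' ->
  forall x, U x -> dseq n t f x = dseq n t' f x.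
Proof.
move=> Uo; elim: t t' => [|i t IH] t' fC.
  by move=> /perm_size /esym /size0nil ->.
move=> tt'.
have it' : i \in t' by rewrite -(perm_mem tt') inE eqxx.
case/splitPr: it' tt' => t1 t2 tt'.
have tt2 : perm_eq t (t1 ++ t2).
  by rewrite -(perm_cons i); apply: perm_trans tt' _; rewrite -[i :: t2]cat1s perm_catCA.
have st := perm_size tt2; rewrite size_cat in st.
move=> x Ux; rewrite (dseq_catCA n U) // -?st //.
by apply: (partial_eq_on n U) => //; apply: IH => //; apply: Ck_onW fC.
Qed.

Lemma mpartialE {R : realType} (n l : nat) (alpha : {ffun 'I_n -> 'I_l.+1})
    (f : 'rV[R]_n -> R) :
  mpartial alpha f =
  dseq n (flatten [seq nseq (alpha i) i | i <- enum 'I_n]) f.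
Proof.
rewrite /mpartial; elim: (enum 'I_n) => //= i s ->.
rewrite /dseq foldr_cat; elim: (nat_of_ord _) => //= k ->.
by [].
Qed.

(** Differentiation along a curve puts one more letter in front of a word. A recursion on the first
    letter matches this, and multinomial coefficients appear only in the final comparison with
    multi-indices. *)
Fixpoint wsum (R : realType) (n l : nat) (F : seq 'I_n -> R) : R :=
  if l is l'.+1 then \sum_(i < n) wsum R n l' (fun t => F (i :: t)) else F [::].

Lemma eq_wsum {R : realType} (n l : nat) (F G : seq 'I_n -> R) :
  (forall t, size t = l -> F t = G t) -> wsum R n l F = wsum R n l G.
Proof.
elim: l F G => [|l IH] F G FG /=; first exact: FG.
by apply: eq_bigr => i _; apply: IH => t st; apply: FG; rewrite /= st.
Qed.

Lemma ler_wsum {R : realType} (n l : nat) (F G : seq 'I_n -> R) :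
  (forall t, size t = l -> F t <= G t) -> wsum R n l F <= wsum R n l G.
Proof.
elim: l F G => [|l IH] F G FG /=; first exact: FG.
by apply: ler_sum => i _; apply: IH => t st; apply: FG; rewrite /= st.
Qed.

Lemma wsumD {R : realType} (n l : nat) (F G : seq 'I_n -> R) :
  wsum R n l (fun t => F t + G t) = wsum R n l F + wsum R n l G.
Proof.
elim: l F G => [//|l IH] F G /=; rewrite -big_split /=.
by apply: eq_bigr => i _; rewrite IH.
Qed.

Lemma wsumMr {R : realType} (n l : nat) (F : seq 'I_n -> R) (c : R) :
  wsum R n l (fun t => F t * c) = wsum R n l F * c.
Proof.
elim: l F => [//|l IH] F /=; rewrite mulr_suml.
by apply: eq_bigr => i _; rewrite IH.
Qed.

Lemma wsum_sum {R : realType} (n l : nat) (I : finType) (A : pred I)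
    (F : I -> seq 'I_n -> R) :
  wsum R n l (fun t => \sum_(a | A a) F a t) = \sum_(a | A a) wsum R n l (F a).
Proof.
elim: l F => [//|l IH] F /=.
rewrite exchange_big /=; apply: eq_bigr => i _; exact: IH.
Qed.

Lemma ler_norm_wsum {R : realType} (n l : nat) (F : seq 'I_n -> R) :
  `|wsum R n l F| <= wsum R n l (fun t => `|F t|).
Proof.
elim: l F => [//|l IH] F /=; apply: le_trans (ler_norm_sum _ _ _) _.
by apply: ler_sum => i _; apply: IH.
Qed.

Lemma wsum0 {R : realType} (n l : nat) (F : seq 'I_n -> R) :
  (forall t, size t = l -> F t = 0) -> wsum R n l F = 0.
Proof.
elim: l F => [|l IH] F F0 /=; first exact: F0.
by rewrite big1 // => i _; apply: IH => t st; apply: F0; rewrite /= st.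
Qed.

Lemma is_derive_wsum {R : realType} (n l : nat) (F : seq 'I_n -> R -> R)
    (dF : seq 'I_n -> R) (s : R) :
  (forall t, size t = l -> is_derive s 1 (F t) (dF t)) ->
  is_derive s 1 (fun z => wsum R n l (fun t => F t z)) (wsum R n l dF).
Proof.
elim: l F dF => [|l IH] F dF FdF /=; first exact: FdF.
rewrite (_ : (fun _ => _) =
    \sum_(i < n) (fun z => wsum R n l (fun t => F (i :: t) z))); last first.
  by apply/funext => z; rewrite fct_sumE.
by apply: is_derive_sum => i; apply: IH => t st; apply: FdF; rewrite /= st.
Qed.

(** The multinomial coefficient, by induction through removal of the first letter: the counts c with
    c_i lowered by one contribute c_i times a bound for l - 1 letters. *)
Lemma word_count (R : realType) (n l : nat) (c : 'I_n -> nat) :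
  (\sum_(i < n) c i = l)%N ->
  wsum R n l (fun t => [forall i, count_mem i t == c i]%:R) *
    (\prod_(i < n) (c i)`!)%:R <= l`!%:R.
Proof.
elim: l c => [|l IH] c cl.
  have c0 i : c i = 0%N.
    by apply/eqP; rewrite -leqn0 -cl (bigD1 i) //= leq_addr.
  rewrite big1 ?mulr1 /=; last by move=> i _; rewrite c0.
  by rewrite fact0 lern1 leq_b1.
rewrite /= mulr_suml factS mulnC natrM -[in leRHS]cl natr_sum mulr_sumr.
apply: ler_sum => i _.
have [ci0|ci0] := posnP (c i).
  rewrite wsum0 ?mul0r ?mulr_ge0 // => t _.
  case: forallP => // /(_ i); by rewrite ci0 /= eqxx.
pose c' j := (c j - (j == i))%N.
have c'E j : c j = (c' j + (j == i))%N.
  by rewrite /c' subnK //; case: eqP => [->|].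
have c'l : (\sum_(j < n) c' j = l)%N.
  move: cl; under eq_bigr do rewrite c'E.
  rewrite big_split /= (bigD1 i) //= [X in (_ + X)%N](bigD1 i) //= eqxx.
  rewrite [X in (_ + (1 + X))%N]big1 => [|j /negbTE -> //].
  by rewrite addn0 addn1 => -[].
have -> : (\prod_(j < n) (c j)`! = c i * \prod_(j < n) (c' j)`!)%N.
  rewrite (bigD1 i) //= [in RHS](bigD1 i) //= mulnA; congr (_ * _)%N.
    by rewrite {1 2}c'E eqxx addn1 factS.
  by apply: eq_bigr => j /negbTE ji; rewrite c'E ji addn0.
rewrite natrM mulrCA mulrC ler_wpM2r //.
apply: le_trans (IH c' c'l); rewrite ler_wpM2r //; apply: ler_wsum => t _.
rewrite ler_nat.
case: (boolP [forall k, count_mem k (i :: t) == c k]) => [/forallP H|_] //.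
rewrite (_ : [forall k, _] = true) //.
apply/forallP => j; have := H j; rewrite /= c'E addnC [i == j]eq_sym.
by rewrite eqn_add2r.
Qed.

(** Partial derivatives commute on U, so every word can be sorted into its multi-index; [word_count]
    bounds the number of words that yield the same one. *)
Lemma wsum_dseq_le {R : realType} (n l : nat) (U : set 'rV[R]_n)
    (f : 'rV[R]_n -> R) (x : 'rV[R]_n) :
  open U -> U x -> Ck_on l U f ->
  wsum R n l (fun t => `|dseq n t f x|) <=
  \sum_(alpha : {ffun 'I_n -> 'I_l.+1} | (\sum_(k < n) alpha k == l)%N)
    (l`!)%:R / (\prod_(k < n) (alpha k)`!)%:R * `|mpartial alpha f x|.
Proof.
move=> Uo Ux fC.
pose ct (alpha : {ffun 'I_n -> 'I_l.+1}) t :=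
  [forall i, count_mem i t == alpha i].
apply: (@le_trans _ _ (wsum R n l (fun t =>
    \sum_(alpha : {ffun 'I_n -> 'I_l.+1} | (\sum_(k < n) alpha k == l)%N)
      (ct alpha t)%:R * `|mpartial alpha f x|))).
  apply: ler_wsum => t st.
  have ctl i : (count_mem i t < l.+1)%N by rewrite ltnS -st count_size.
  pose alpha : {ffun 'I_n -> 'I_l.+1} := [ffun i => Ordinal (ctl i)].
  have al : (\sum_(k < n) alpha k == l)%N.
    apply/eqP; transitivity (\sum_(k < n) count_mem k t)%N.
      by apply: eq_bigr => k _; rewrite ffunE.
    rewrite -[RHS]st; elim: {st ctl alpha} t => [|j t IH]; first by rewrite big1.
    rewrite /= big_split /= IH (bigD1 j) //= eqxx big1 ?addn0 //.
    by move=> k /negbTE; rewrite eq_sym => ->.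
  rewrite (bigD1 alpha) //= (_ : ct alpha t = true); last first.
    by apply/forallP => i; rewrite ffunE.
  rewrite mul1r (_ : mpartial alpha f x = dseq n t f x); last first.
    rewrite mpartialE; apply/esym/(dseq_perm n U) => //; first by rewrite st.
    apply/allP => i _ /=; rewrite count_flatten -map_comp.
    rewrite sumnE big_map big_enum /=.
    rewrite (bigD1 i) //= count_nseq /= eqxx mul1n big1 ?addn0 ?ffunE //.
    by move=> j ji; rewrite count_nseq /= (negbTE ji).
  by rewrite lerDl sumr_ge0 // => beta _; rewrite mulr_ge0.
rewrite wsum_sum; apply: ler_sum => alpha /eqP al.
rewrite wsumMr ler_wpM2r // ler_pdivlMr; last first.
  by rewrite ltr0n prodn_gt0 // => i; rewrite fact_gt0.
exact: word_count.
Qed.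

(** * Composition with polynomial curves *)

(* The coefficient of [dseq t f] in the [j]-th derivative of [f] along the
   curve [c]. *)
Fixpoint faa {R : realType} (n : nat) (c : 'I_n -> {poly R}) (j : nat)
    (t : seq 'I_n) : {poly R} :=
  if j is j'.+1 then
    (faa n c j' t)^`() +
    (if t is i :: t' then (c i)^`() * faa n c j' t' else 0)
  else (if t is [::] then 1 else 0).

(** The recursion of [faa] with a single majorant G for all components of the curve; it sees a word
    only through its length. *)
Fixpoint faa_bound {R : realType} (G : {poly R}) (j l : nat) : {poly R} :=
  if j is j'.+1 then
    (faa_bound G j' l)^`() +
    (if l is l'.+1 then G^`() * faa_bound G j' l' else 0)
  else (if l is 0 then 1 else 0).

Definition curve {R : realType} (n : nat) (c : 'I_n -> {poly R}) (s : R) :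
    'rV[R]_n := \row_i (c i).[s].

Definition curve_deriv {R : realType} (n : nat) (f : 'rV[R]_n -> R)
    (c : 'I_n -> {poly R}) (j : nat) (s : R) : R :=
  \sum_(l < j.+1)
    wsum R n l (fun t => dseq n t f (curve n c s) * (faa n c j t).[s]).

Lemma faa_eq0 {R : realType} (n : nat) (c : 'I_n -> {poly R}) (j : nat)
    (t : seq 'I_n) : (j < size t)%N -> faa n c j t = 0.
Proof.
elim: j t => [|j IH] [|i t] //= jt.
by rewrite !IH ?deriv0 ?mulr0 ?addr0 // ltnW.
Qed.

Lemma curve_deriv0 {R : realType} (n : nat) (f : 'rV[R]_n -> R)
    (c : 'I_n -> {poly R}) (s : R) :
  curve_deriv n f c 0 s = f (curve n c s).
Proof. by rewrite /curve_deriv big_ord1 /= hornerC mulr1. Qed.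

(** In the derivative of D_t f(c) times [faa], the terms D_(i :: t) f(c) c_i' lengthen the word by
    one letter. They are what the second summand in the recursion of [faa] collects. *)
Lemma deriv_chain_curve {R : realType} (n k : nat) (U : set 'rV[R]_n)
    (f : 'rV[R]_n -> R) (c : 'I_n -> {poly R}) :
  open U -> Ck_on k U f -> (forall s : R, 0 <= s <= 1 -> U (curve n c s)) ->
  deriv_chain k (curve_deriv n f c).
Proof.
move=> Uo fC cU j s jk s01; have Us := cU s s01.
pose g t := dseq n t f (curve n c s).
have main : is_derive s 1 (curve_deriv n f c j) (\sum_(l < j.+1) wsum R n l (fun t =>
    (\sum_(i < n) g (i :: t) * (c i)^`().[s]) * (faa n c j t).[s] +
    g t * (faa n c j t)^`().[s])).
  rewrite (_ : curve_deriv n f c j = \sum_(l < j.+1) (fun z => wsum R n l (fun t =>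
      dseq n t f (curve n c z) * (faa n c j t).[z]))); last first.
    by apply/funext => z; rewrite fct_sumE.
  apply: is_derive_sum => l; apply: is_derive_wsum => t st.
  have gd : is_derive s 1 (fun z => dseq n t f (curve n c z))
      (\sum_(i < n) g (i :: t) * (c i)^`().[s]).
    apply: (is_derive_comp_curve n U) => //.
      apply: dseq_Ck; rewrite st addn1; apply: Ck_on_le fC.
      exact: leq_trans (ltn_ord l) jk.
    move=> i; rewrite (_ : (fun z => curve n c z 0 i) = horner (c i)).
      exact: is_derive_poly.
    by apply/funext => z; rewrite mxE.
  have h := is_deriveM gd (is_derive_poly (faa n c j t) s).
  apply: (trigger_derive h).
  by rewrite addrC; congr (_ + _); rewrite mulrC.
apply: (trigger_derive main).
under eq_bigr => l _ do rewrite wsumD.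
rewrite big_split /= addrC /curve_deriv /=.
under [RHS]eq_bigr => l _.
  rewrite (eq_wsum n l _ (fun t => g t * (faa n c j t)^`().[s] +
    g t * (if t is i :: t' then (c i)^`() * faa n c j t' else 0).[s])); last first.
    by move=> t _; rewrite hornerD mulrDr.
  rewrite wsumD; over.
rewrite big_split /=; congr (_ + _).
  rewrite [RHS]big_ord_recr [X in _ = _ + X]wsum0 ?addr0 // => t st.
  by rewrite faa_eq0 ?deriv0 ?horner0 ?mulr0 // st.
rewrite [RHS]big_ord_recl /= horner0 mulr0 add0r; apply: eq_bigr => l _.
rewrite -wsum_sum; apply: eq_wsum => t _.
rewrite mulr_suml; apply: eq_bigr => i _.
by rewrite hornerM mulrA.
Qed.

(** The recursion consists of sums, products and derivatives, all of which preserve domination. *)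
Lemma dominated_faa {R : realType} (n : nat) (c : 'I_n -> {poly R}) (s : R)
    (G : {poly R}) :
  (forall i, dominated ((c i)^`() \Po ('X + s%:P)) G^`()) ->
  forall j t, dominated (faa n c j t \Po ('X + s%:P)) (faa_bound G j (size t)).
Proof.
move=> cG; elim=> [|j IH] [|i t] /=.
- by rewrite comp_polyC; apply: dominated1.
- by rewrite comp_poly0; apply: dominated0.
- rewrite !addr0; have := dominated_deriv _ _ (IH [::]).
  by rewrite deriv_comp derivD derivX derivC addr0 mulr1.
- rewrite comp_polyD comp_polyM; apply: dominatedD.
    have := dominated_deriv _ _ (IH (i :: t)).
    by rewrite deriv_comp derivD derivX derivC addr0 mulr1.
  exact: dominatedM.
Qed.

Lemma faa_bound_eq0 {R : realType} (G : {poly R}) (j l : nat) :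
  (j < l)%N -> faa_bound G j l = 0.
Proof.
elim: j l => [|j IH] [|l] //= jl.
by rewrite !IH ?deriv0 ?mulr0 ?addr0 // ltnW.
Qed.

(** Faa di Bruno's formula for two univariate polynomials; it identifies [faa_bound] as a partial
    Bell polynomial without an explicit expression. *)
Lemma faa_boundP {R : realType} (G H : {poly R}) (j : nat) :
  (H \Po G)^`(j) = \sum_(l < j.+1) (H^`(l) \Po G) * faa_bound G j l.
Proof.
elim: j => [|j IH]; first by rewrite big_ord1 /= mulr1.
rewrite derivnS IH linear_sum /=.
under eq_bigr => l _ do rewrite derivM deriv_comp -derivnS.
rewrite big_split /= addrC.
under [RHS]eq_bigr => l _ do rewrite mulrDr.
rewrite big_split /=; congr (_ + _).
  by rewrite [RHS]big_ord_recr /= faa_bound_eq0 // deriv0 mulr0 addr0.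
rewrite [RHS]big_ord_recl /= mulr0 add0r; apply: eq_bigr => l _.
by rewrite mulrA.
Qed.

(** The formula is tested on H = X^l. As G(0) = 0 and the i-th derivative of X^l vanishes at 0
    unless i = l, one term survives at the origin. *)
Lemma faa_bound0 {R : realType} (G : {poly R}) (j l : nat) :
  G.[0] = 0 -> (l <= j)%N ->
  (faa_bound G j l).[0] = (j`!)%:R / (l`!)%:R * (G ^+ l)`_j.
Proof.
move=> G0 lj.
have l0 : l`!%:R != 0 :> R by rewrite pnatr_eq0 -lt0n fact_gt0.
have := faa_boundP G 'X^l j; rewrite comp_Xn_poly.
move/(congr1 (horner^~ 0)); rewrite horner_coef0 coef_derivn addn0 ffactnn.
rewrite horner_sum (bigD1 (Ordinal (lj : (l < j.+1)%N))) //= big1 => [|i il].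
  rewrite hornerM horner_comp G0 derivnXn ffactnn subnn expr0 hornerMn hornerC.
  rewrite addr0 -[X in X = _]mulr_natr => E.
  by rewrite mulrAC [X in X / _]mulrC E mulrAC mulfV ?mul1r.
rewrite hornerM horner_comp G0 derivnXn hornerMn hornerXn.
have {}il : (i : nat) != l by [].
have [li|il'] := ltnP l i; first by rewrite ffact_small // mulr0n mul0r.
have -> : (l - i = (l - i).-1.+1)%N by rewrite prednK // subn_gt0 ltn_neqAle il il'.
by rewrite exprS mul0r mul0rn mul0r.
Qed.

Lemma faa_bound_ge0 {R : realType} (G : {poly R}) (j l : nat) :
  (forall r, 0 <= G^`()`_r) -> forall r, 0 <= (faa_bound G j l)`_r.
Proof.
move=> G0 r.
have domG : dominated G^`() G^`() by move=> i; rewrite ger0_norm.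
suff : dominated (faa_bound G j l) (faa_bound G j l).
  exact: dominated_ge0.
elim: j l {r} => [|j IH] [|l] /=.
- exact: dominated1.
- exact: dominated0.
- by rewrite !addr0; apply: dominated_deriv.
- by apply: dominatedD; [exact: dominated_deriv|exact: dominatedM].
Qed.

(** At the parameter s only the constant coefficient of each recentred [faa] matters; it is
    dominated by the value of [faa_bound] at 0, which depends on the length of the word alone. *)
Lemma curve_deriv_bound {R : realType} (n k : nat) (U : set 'rV[R]_n)
    (f : 'rV[R]_n -> R) (c : 'I_n -> {poly R}) (s : R) (G : {poly R})
    (M : nat -> R) (j : nat) :
  open U -> Ck_on k U f -> U (curve n c s) -> (j <= k)%N -> G.[0] = 0 ->
  (forall i, dominated ((c i)^`() \Po ('X + s%:P)) G^`()) ->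
  (forall r, 0 <= G^`()`_r) ->
  (forall l, (l <= j)%N ->
     \sum_(alpha : {ffun 'I_n -> 'I_l.+1} | (\sum_(k < n) alpha k == l)%N)
       (l`!)%:R / (\prod_(k < n) (alpha k)`!)%:R *
       `|mpartial alpha f (curve n c s)| <= M l) ->
  `|curve_deriv n f c j s| <=
    \sum_(l < j.+1) (j`!)%:R / (l`!)%:R * (G ^+ l)`_j * M l.
Proof.
move=> Uo fC Us jk G0 cG Gp fM.
apply: le_trans (ler_norm_sum _ _ _) _; apply: ler_sum => l _.
have lj : (l <= j)%N by rewrite -ltnS.
rewrite -(faa_bound0 G j l G0 lj).
have B0 : 0 <= (faa_bound G j l).[0].
  by rewrite horner_coef0; apply: faa_bound_ge0.
apply: le_trans (ler_norm_wsum _ _ _) _.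
apply: (@le_trans _ _ (wsum R n l (fun t => `|dseq n t f (curve n c s)| *
    (faa_bound G j l).[0]))).
  apply: ler_wsum => t st; rewrite normrM ler_wpM2l //.
  have := dominated_faa n c s G cG j t 0; rewrite st.
  by rewrite -!horner_coef0 horner_comp !hornerE.
rewrite wsumMr mulrC ler_wpM2l //; apply: le_trans (fM l lj).
by apply: (wsum_dseq_le n l U) => //; apply: Ck_on_le fC; exact: leq_trans jk.
Qed.

(** * Taylor coefficients of bounded polynomials *)

(* Lagrange interpolation at the nodes [j ^ 2 h]: a Markov type bound for the
   Taylor coefficients at the end point of an interval of length [d ^ 2 h]. *)
Definition square_node {R : realType} (h : R) (j : nat) : R := (j ^ 2)%:R * h.

Definition markov_term {R : realType} (d : nat) (h : R) (k : nat) : {poly R} :=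
  \prod_(j < d.+1 | j != k :> nat)
    (`|square_node h k - square_node h j|^-1 *: ('X + (square_node h j)%:P)).

(** The basis polynomial of the node 0 is left out since it is applied to p - p(0). Every remaining
    term contains the factor X, so the majorant vanishes at 0. *)
Definition markov_poly {R : realType} (d : nat) (h : R) : {poly R} :=
  \sum_(k < d) markov_term d h k.+1.

Lemma square_node_dist {R : realType} (h : R) (i j : nat) : 0 < h ->
  `|square_node h i - square_node h j| = `|i%:R - j%:R| * (i + j)%:R * h.
Proof.
move=> h0; rewrite /square_node -mulrBl normrM (gtr0_norm h0); congr (_ * _).
by rewrite !natrX subr_sqr normrM -natrD normr_nat.
Qed.

Lemma square_node_inj {R : realType} (h : R) (i j : nat) : 0 < h ->
  i != j -> square_node h i != square_node h j.
Proof.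
move=> h0 ij; rewrite -subr_eq0 -normr_gt0 square_node_dist //.
rewrite !mulr_gt0 // ?normr_gt0 ?subr_eq0 ?eqr_nat // ltr0n; lia.
Qed.

Lemma dominated_markov {R : realType} (d : nat) (h D : R) (p : {poly R}) :
  0 < h -> (size p <= d.+1)%N ->
  (forall k, (k <= d)%N -> `|p.[square_node h k] - p.[0]| <= D) ->
  dominated (p - (p.[0])%:P) (D *: markov_poly d h).
Proof.
move=> h0 sp pD.
have x0 : square_node h 0 = 0 by rewrite /square_node mul0r.
have sq : (size (p - (p.[0])%:P)%R <= d.+1)%N.
  apply: leq_trans (size_polyD _ _) _; rewrite geq_max sp size_polyN.
  by apply: leq_trans (size_polyC_leq1 _) _.
rewrite -[X in dominated X](@interp_id R (square_node h) d _ _ sq); last first.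
  by move=> i j _ _; apply: square_node_inj.
rewrite /interp /markov_poly big_ord_recl scaler_sumr.
rewrite x0 !hornerE subrr scale0r add0r.
apply: dominated_sum => k _; apply: dominatedZ.
  by rewrite !hornerE; apply: pD; exact: ltn_ord.
apply: dominated_prod => j jk; apply: dominatedZ; first by rewrite normfV.
rewrite -polyCN; apply: dominated_XDC; rewrite normrN ger0_norm //.
by rewrite mulr_ge0 // ltW.
Qed.

Lemma prod_sum_fact (k d : nat) :
  (\prod_(j < d.+1) (k.+1 + j) * k`! = (k.+1 + d)`!)%N.
Proof.
elim: d => [|d IH]; first by rewrite big_ord1 addn0 factS.
by rewrite big_ord_recr /= mulnAC IH addnS factS mulnC.
Qed.

(** The distance |i^2 - j^2| splits into |i - j| and i + j. The product of the sums omits the factor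
    2(k + 1) at j = k + 1, whence the division by 2. *)
Lemma prod_square_node_dist {R : realType} (d k : nat) (h : R) :
  0 < h -> (k < d)%N ->
  \prod_(j < d.+1 | j != k.+1 :> nat) `|square_node h k.+1 - square_node h j| =
  h ^+ d * ((d - k.+1)`! * (d + k.+1)`!)%:R / 2.
Proof.
move=> h0 kd.
under eq_bigr => j _ do rewrite square_node_dist //.
have kd1 : (k.+1 < d.+1)%N by [].
have card_neq : #|[pred j : 'I_d.+1 | j != k.+1 :> nat]| = d.
  rewrite -[RHS]/(d.+1.-1) -[in RHS](card_ord d.+1) -(cardC1 (Ordinal kd1)).
  by apply: eq_card => j; rewrite !inE.
rewrite !big_split /= prod_dist // prodr_const card_neq -natr_prod.
have E : (\prod_(j < d.+1 | j != k.+1 :> nat) (k.+1 + j) * (2 * k.+1`!))%N =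
    (d + k.+1)`!.
  rewrite [in RHS]addnC -prod_sum_fact.
  rewrite [in RHS](bigD1 (Ordinal kd1)) //= factS.
  by ring.
by rewrite -E !natrM; field.
Qed.

Lemma fact_split_le (d k : nat) : (k <= d)%N ->
  (d`! * d`! <= (d - k)`! * (d + k)`!)%N.
Proof.
elim: k => [|k IH] kd; first by rewrite subn0 addn0.
apply: leq_trans (IH (ltnW kd)) _.
rewrite addnS factS -(subnSK kd) factS subnSK //.
move: (d - k.+1)`! (d + k)`! (leq_subr k d) => X Y; move: (d - k)%N => e.
by clear; nia.
Qed.

Lemma sum_inv_sqr (R : realType) (m : nat) :
  \sum_(j < m) (j.+1%:R ^+ 2)^-1 <= 2 :> R.
Proof.
case: m => [|m]; first by rewrite big_ord0.
suff : \sum_(j < m.+1) (j.+1%:R ^+ 2)^-1 <= 2 - m.+1%:R^-1 :> R.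
  by move=> /le_trans; apply; rewrite gerBl.
elim: m => [|m IH]; first by rewrite big_ord1 expr1n invr1; lra.
rewrite big_ord_recr /=; apply: le_trans (lerD IH (lexx _)) _.
have m1 : 0 < m.+1%:R :> R by rewrite ltr0n.
have -> : m.+2%:R = m.+1%:R + 1 :> R by rewrite -natr1.
move: (m.+1%:R : R) m1 => x x0; rewrite -subr_ge0.
have -> : 2 - (x + 1)^-1 - (2 - x^-1 + ((x + 1) ^+ 2)^-1) = (x * (x + 1) ^+ 2)^-1.
  by field; rewrite !gt_eqF // addr_gt0.
by rewrite invr_ge0 mulr_ge0 ?exprn_ge0 // ltW // addr_gt0.
Qed.

(** By induction the product times 1 - u sum 1/j^2 stays at most 1, and u sum 1/j^2 <= 1/5. *)
Lemma prod_inv_sqr {R : realType} (m : nat) (u : R) : 0 <= u <= 10^-1 ->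
  \prod_(j < m) (1 + u / j.+1%:R ^+ 2) <= 5 / 4 :> R.
Proof.
move=> /andP[u0 u1].
pose sg k : R := \sum_(j < k) (j.+1%:R ^+ 2)^-1.
have sg0 k : 0 <= sg k by rewrite sumr_ge0 // => i _; rewrite invr_ge0 exprn_ge0.
have H : \prod_(j < m) (1 + u / j.+1%:R ^+ 2) * (1 - u * sg m) <= 1 :> R.
  elim: m => [|m IH]; first by rewrite /sg !big_ord0; lra.
  have t0 : 0 <= u / m.+1%:R ^+ 2 by rewrite divr_ge0 ?exprn_ge0.
  have P0 : 0 <= \prod_(j < m) (1 + u / j.+1%:R ^+ 2).
    by apply: prodr_ge0 => j _; rewrite addr_ge0 // divr_ge0 ?exprn_ge0.
  rewrite big_ord_recr /= /sg big_ord_recr /= -/(sg m).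
  set P := \prod_(j < m) _ in IH P0 *; set t := u / _ in t0 *.
  have -> : u * (sg m + (m.+1%:R ^+ 2)^-1) = u * sg m + t by rewrite mulrDr.
  apply: le_trans IH; rewrite -mulrA ler_wpM2l //.
  have us0 : 0 <= u * sg m by rewrite mulr_ge0.
  move: (u * sg m) us0 => v v0; rewrite -subr_ge0.
  have -> : 1 - v - (1 + t) * (1 - (v + t)) = t * v + t * t by ring.
  by rewrite addr_ge0 // mulr_ge0.
have P0 : 0 <= \prod_(j < m) (1 + u / j.+1%:R ^+ 2).
  by apply: prodr_ge0 => j _; rewrite addr_ge0 // divr_ge0 ?exprn_ge0.
have us : u * sg m <= 5^-1.
  have := ler_pM u0 (sg0 m) u1 (sum_inv_sqr R m); rewrite -/(sg m) => h.
  by apply: le_trans h _; lra.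
set P := \prod_(j < m) _ in H P0 *.
have : P * (4 / 5) <= 1.
  by apply: le_trans H; rewrite ler_wpM2l //; lra.
lra.
Qed.

(** The numerator of the k-th term times its node k^2 h is at most z prod_j (z + j^2 h) <= (5/4) z
    h^d (d!)^2, and the denominator is at least h^d (d!)^2/2. So the k-th term is at most (5/2)
    (z/h)/k^2: the quadratic nodes make the sum converge independently of d. *)
Lemma markov_poly_horner {R : realType} (d : nat) (h z : R) :
  0 < h -> 0 <= z -> z <= h / 10 -> (markov_poly d h).[z] <= 5 * (z / h).
Proof.
move=> h0 z0 zh; rewrite horner_sum.
have u0 : 0 <= z / h by rewrite divr_ge0 // ltW.
apply: (@le_trans _ _ (\sum_(k < d) 5 / 2 * (z / h) * (k.+1%:R ^+ 2)^-1)).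
  apply: ler_sum => k _.
  rewrite horner_prod.
  under eq_bigr => j _ do rewrite hornerZ !hornerE.
  rewrite big_split /= prodfV prod_square_node_dist //.
  set F := (_ * _)%:R.
  have F0 : 0 < F by rewrite ltr0n muln_gt0 !fact_gt0.
  have dF : (d`! * d`!)%:R <= F by rewrite ler_nat fact_split_le.
  have hd : 0 < h ^+ d by rewrite exprn_gt0.
  have kh : 0 < square_node h k.+1 by rewrite mulr_gt0 // ltr0n.
  have kd1 : (k.+1 < d.+1)%N by rewrite ltnS.
  set P := \prod_(j < d.+1 | _) _.
  have P0 : 0 <= P by apply: prodr_ge0 => j _; rewrite addr_ge0 // mulr_ge0 // ltW.
  have PE : P * square_node h k.+1 <= z * (h ^+ d * (d`! * d`!)%:R) * (5 / 4).
    apply: (@le_trans _ _ (P * (z + square_node h k.+1))).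
      by rewrite ler_wpM2l // lerDr.
    have -> : P * (z + square_node h k.+1) = \prod_(j < d.+1) (z + square_node h j).
      by rewrite [RHS](bigD1 (Ordinal kd1)) //= mulrC.
    rewrite big_ord_recl /= {1}/square_node mul0r addr0 -[leRHS]mulrA ler_wpM2l //.
    have -> : \prod_(i < d) (z + square_node h (bump 0 i)) =
        h ^+ d * (d`! * d`!)%:R * \prod_(j < d) (1 + z / h / j.+1%:R ^+ 2).
      elim: (d) => [|m IH]; first by rewrite !big_ord0 expr0 fact0 !mulr1.
      rewrite !big_ord_recr /= IH /square_node /bump /= add1n natrX factS [h ^+ m.+1]exprS !natrM.
      by field; rewrite !gt_eqF // ltr0n.
    have hdd : 0 <= h ^+ d * (d`! * d`!)%:R by rewrite mulr_ge0 // ltW.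
    by rewrite ler_wpM2l // prod_inv_sqr // u0 /= ler_pdivrMr // mulrC.
  have K0 : 0 < k.+1%:R ^+ 2 :> R by rewrite exprn_gt0 // ltr0n.
  have {}PE : P * (k.+1%:R ^+ 2 * h) <= z * (h ^+ d * F) * (5 / 4).
    apply: le_trans (_ : z * (h ^+ d * (d`! * d`!)%:R) * (5 / 4) <= _).
      by move: PE; rewrite /square_node natrX.
    by rewrite ler_wpM2r // ler_wpM2l // ler_wpM2l // ltW.
  rewrite -(ler_pM2r (mulr_gt0 K0 h0)) -(ler_pM2l (mulr_gt0 hd F0)).
  rewrite -subr_ge0.
  have -> : h ^+ d * F * (5 / 2 * (z / h) / k.+1%:R ^+ 2 * (k.+1%:R ^+ 2 * h)) -
      h ^+ d * F * ((h ^+ d * F / 2)^-1 * P * (k.+1%:R ^+ 2 * h)) =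
      2 * (z * (h ^+ d * F) * (5 / 4) - P * (k.+1%:R ^+ 2 * h)).
    by field; rewrite !gt_eqF // ltr0n.
  by rewrite mulr_ge0 // subr_ge0.
rewrite -mulr_sumr.
have := sum_inv_sqr R d; set s := \sum_(j < d) _ => s2.
have : 5 / 2 * (z / h) * s <= 5 / 2 * (z / h) * 2.
  by rewrite ler_wpM2l // mulr_ge0.
lra.
Qed.

Lemma markov_poly_ge0 {R : realType} (d : nat) (h D : R) :
  0 < h -> 0 <= D -> forall r, 0 <= (D *: markov_poly d h)`_r.
Proof.
move=> h0 D0 r; rewrite coefZ mulr_ge0 //.
suff : dominated (markov_poly d h) (markov_poly d h) by exact: dominated_ge0.
apply: dominated_sum => k _; apply: dominated_prod => j _; apply: dominatedZ.
  by rewrite normfV normr_id.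
by apply: dominated_XDC; rewrite ger0_norm // mulr_ge0 // ltW.
Qed.

Lemma norm_coef_reflect {R : realType} (q : {poly R}) (r : nat) :
  `|(q \Po - 'X)`_r| = `|q`_r|.
Proof.
rewrite comp_polyE coef_sum; have [rq|qr] := ltnP r (size q).
  rewrite (bigD1 (Ordinal rq)) //= big1 ?addr0 => [|i ir].
    rewrite coefZ exprNn -signr_odd; case: odd; rewrite ?mulN1r ?mul1r ?coefN;
      by rewrite coefXn eqxx ?mulrN ?normrN mulr1.
  rewrite coefZ exprNn -signr_odd.
  have ri : (r == i)%N = false by rewrite eq_sym; apply/negbTE.
  by case: odd; rewrite ?mulN1r ?mul1r ?coefN coefXn ri ?oppr0 mulr0.
rewrite (nth_default 0 qr) big1 // => i _.
rewrite coefZ exprNn -signr_odd.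
have ri : (r == i)%N = false by rewrite gtn_eqF //; apply: leq_trans qr.
by case: odd; rewrite ?mulN1r ?mul1r ?coefN coefXn ri ?oppr0 mulr0.
Qed.

(** For h = 1/(2 d^2) the nodes span half of the unit interval. They fit to the right of s if s <=
    1/2 and to the left otherwise; the reflection changes only signs of coefficients. *)
Lemma dominated_taylor {R : realType} (d : nat) (D s : R) (p : {poly R}) :
  (1 <= d)%N -> (size p <= d.+1)%N -> 0 <= s <= 1 ->
  (forall t : R, 0 <= t <= 1 -> `|p.[t] - p.[s]| <= D) ->
  dominated (p^`() \Po ('X + s%:P))
    (D *: markov_poly d (2 * d%:R ^+ 2)^-1)^`().
Proof.
move=> d1 sp /andP[s0 s1] pD.
have dR : 0 < d%:R :> R by rewrite ltr0n.
pose h : R := (2 * d%:R ^+ 2)^-1.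
have h0 : 0 < h by rewrite invr_gt0 mulr_gt0 // exprn_gt0.
have nodeP k : (k <= d)%N -> 0 <= square_node h k <= 2^-1.
  move=> kd; rewrite /square_node natrX; apply/andP; split.
    by rewrite mulr_ge0 ?exprn_ge0 // ltW.
  have -> : 2^-1 = d%:R ^+ 2 * h :> R by rewrite /h; field; rewrite gt_eqF.
  by rewrite ler_wpM2r ?(ltW h0) // lerXn2r ?nnegrE // ler_nat.
have shift_deriv (q : {poly R}) : (q \Po ('X + s%:P))^`() = q^`() \Po ('X + s%:P).
  by rewrite deriv_comp derivD derivX derivC addr0 mulr1.
have [s2|s2] := leP s 2^-1.
  pose q := p \Po ('X + s%:P).
  have q0 t : q.[t] = p.[t + s] by rewrite horner_comp !hornerE.
  have := @dominated_markov R d h D q h0.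
  rewrite size_comp_poly2 ?size_XaddC // => /(_ sp) H.
  have := dominated_deriv _ _ (H _); rewrite derivB derivC subr0 -shift_deriv.
  apply => k kd; have /andP[n0 n1] := nodeP k kd.
  by rewrite !q0 add0r; apply: pD; apply/andP; split; lra.
pose q := p \Po (s%:P - 'X).
have q0 t : q.[t] = p.[s - t] by rewrite horner_comp !hornerE.
have sX : size (s%:P - 'X : {poly R}) = 2%N.
  by rewrite -opprB size_polyN size_XsubC.
have := @dominated_markov R d h D q h0.
rewrite size_comp_poly2 ?sX // => /(_ sp) H.
have {}H := dominated_deriv _ _ (H _).
have qE : (p \Po ('X + s%:P)) = q \Po (- 'X).
  by rewrite -comp_polyA comp_polyB comp_polyC comp_polyX opprK addrC.
have : dominated (q^`()) ((D *: markov_poly d h)^`()).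
  have := H; rewrite derivB derivC subr0; apply => k kd.
  have /andP[n0 n1] := nodeP k kd.
  by rewrite !q0 subr0; apply: pD; apply/andP; split; lra.
move=> Hq r; rewrite -shift_deriv qE deriv_comp poly.derivN derivX.
by rewrite mulrN1 coefN normrN norm_coef_reflect; apply: Hq.
Qed.

(** Consecutive quotients are mu_j/j, at least 1 by the growth condition on the weight. *)
Lemma weight_bound_fact {R : realType} (mu : nat -> R) (M0 : R) (l j : nat) :
  0 < M0 -> (forall i, (1 <= i)%N -> i%:R <= mu i) -> (l <= j)%N ->
  weight_bound mu M0 l / l`!%:R <= weight_bound mu M0 j / j`!%:R.
Proof.
move=> M00 muj; elim: j => [|j IH]; first by rewrite leqn0 => /eqP ->.
rewrite leq_eqVlt => /predU1P[-> //|lj]; apply: le_trans (IH lj) _.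
have mu0 : 0 < mu j.+1 by apply: lt_le_trans (muj j.+1 isT); rewrite ltr0n.
have fj : 0 < j`!%:R :> R by rewrite ltr0n fact_gt0.
have jj : 0 < j.+1%:R :> R by rewrite ltr0n.
rewrite /weight_bound [in leRHS]big_nat_recr //= factS natrM.
set P := \prod_(1 <= i < j.+1) _.
have P0 : 0 <= P.
  rewrite /P big_nat_cond prodr_ge0 // => i /andP[/andP[i1 _] _].
  by apply: le_trans (muj i i1); rewrite ler0n.
have -> : M0 * (P * mu j.+1) / (j.+1%:R * j`!%:R) = M0 * P / j`!%:R * (mu j.+1 / j.+1%:R).
  by field; rewrite !gt_eqF.
rewrite ler_peMr // ?ler_pdivlMr ?mul1r ?muj //.
by rewrite mul0r mulr_ge0 // ltW.
Qed.

Lemma majorant_term {R : realType} (P : {poly R}) (z : R) (j : nat) :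
  (forall r, 0 <= P`_r) -> 0 <= z -> P`_j * z ^+ j <= P.[z].
Proof.
move=> P0 z0; have [jP|Pj] := ltnP j (size P).
  rewrite horner_coef (bigD1 (Ordinal jP)) //= lerDl sumr_ge0 // => i _.
  by rewrite mulr_ge0 // exprn_ge0.
rewrite nth_default // mul0r horner_coef sumr_ge0 // => i _.
by rewrite mulr_ge0 // exprn_ge0.
Qed.

Lemma sum_half_pow (R : realType) (j : nat) :
  \sum_(l < j) (2^-1) ^+ l.+1 <= 1 :> R.
Proof.
suff -> : \sum_(l < j) (2^-1) ^+ l.+1 = 1 - (2^-1) ^+ j :> R.
  by rewrite gerBl exprn_ge0 // invr_ge0.
elim: j => [|j IH]; first by rewrite big_ord0 subrr.
by rewrite big_ord_recr /= IH exprS; field.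
Qed.

(** As M_l/l! <= M_j/j!, the sum is at most M_j times the sum over l of the j-th coefficients of
    G^l. Cauchy's estimate at radius 1/a bounds these by a^j 2^(-l), and l = 0 contributes nothing
    when j >= 1. *)
Lemma poly_majorant_bound {R : realType} (mu : nat -> R) (M0 a : R)
    (G : {poly R}) (j : nat) :
  0 < M0 -> (forall i, (1 <= i)%N -> i%:R <= mu i) -> 0 < a ->
  (forall r, 0 <= G`_r) -> G.[a^-1] <= 2^-1 ->
  \sum_(l < j.+1) (j`!)%:R / (l`!)%:R * (G ^+ l)`_j * weight_bound mu M0 l <=
  a ^+ j * weight_bound mu M0 j.
Proof.
move=> M00 muj a0 G0 Ga.
have Gl0 l r : 0 <= (G ^+ l)`_r.
  suff : dominated (G ^+ l) (G ^+ l) by exact: dominated_ge0.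
  elim: l => [|l IH]; first by rewrite expr0; apply: dominated1.
  by rewrite exprS; apply: dominatedM => // i; rewrite ger0_norm.
have a1 : 0 <= a^-1 by rewrite invr_ge0 ltW.
have M_ge0 l : 0 <= weight_bound mu M0 l.
  rewrite mulr_ge0 ?(ltW M00) // big_nat_cond prodr_ge0 // => i /andP[/andP[i1 _] _].
  by apply: le_trans (muj i i1); rewrite ler0n.
have Gl l : (G ^+ l)`_j <= a ^+ j * (2^-1) ^+ l.
  have := majorant_term (G ^+ l) a^-1 j (Gl0 l) a1.
  rewrite [a^-1 ^+ j]exprVn ler_pdivrMr ?exprn_gt0 // horner_exp => /le_trans; apply.
  rewrite mulrC ler_wpM2l ?exprn_ge0 ?(ltW a0) // lerXn2r ?nnegrE ?invr_ge0 //.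
  by rewrite horner_coef sumr_ge0 // => i _; rewrite mulr_ge0 // exprn_ge0.
case: j Gl => [|j] Gl.
  by rewrite big_ord1 !expr0 coef1 mulr1 fact0 divr1 !mul1r.
rewrite big_ord_recl /= expr0 coef1 /= mulr0 mul0r add0r.
apply: (@le_trans _ _ (\sum_(l < j.+1) (a ^+ j.+1 * weight_bound mu M0 j.+1) *
    (2^-1) ^+ l.+1)); last first.
  rewrite -mulr_sumr ler_piMr ?sum_half_pow // mulr_ge0 ?exprn_ge0 ?(ltW a0) //.
apply: ler_sum => l _; rewrite /bump /= add1n.
have fl : 0 < l.+1`!%:R :> R by rewrite ltr0n fact_gt0.
have fj : 0 < j.+1`!%:R :> R by rewrite ltr0n fact_gt0.
have lj : (l.+1 <= j.+1)%N by [].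
have := weight_bound_fact mu M0 _ _ M00 muj lj.
rewrite [X in _ <= X -> _]mulrC -ler_pdivrMl ?invr_gt0 // invrK => H.
have -> : j.+1`!%:R / l.+1`!%:R * (G ^+ l.+1)`_j.+1 * weight_bound mu M0 l.+1 =
   (G ^+ l.+1)`_j.+1 * (j.+1`!%:R * (weight_bound mu M0 l.+1 / l.+1`!%:R)) by ring.
rewrite [leRHS]mulrAC; apply: ler_pM; [exact: Gl0| |exact: Gl|exact: H].
by rewrite mulr_ge0 // divr_ge0.
Qed.

(** On a segment only l = j contributes, without loss; accordingly a_K is the bare diameter when d =
    1. *)
Lemma line_majorant {R : realType} (M : nat -> R) (D : R) (j : nat) :
  \sum_(l < j.+1) (j`!)%:R / (l`!)%:R * ((D *: 'X) ^+ l)`_j * M l = D ^+ j * M j.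
Proof.
rewrite big_ord_recr /= big1 ?add0r => [|l _].
  have fj : j`!%:R != 0 :> R by rewrite pnatr_eq0 -lt0n fact_gt0.
  by rewrite exprZn coefZ coefXn eqxx mulr1 divff // mul1r.
by rewrite exprZn coefZ coefXn gtn_eqF ?mulr0 ?mul0r.
Qed.

(** Equivalent to 20 d^2 <= 4 (d+1)^(d+1)/(d-1)^(d-1), which compares what the square nodes require
    with the constant in a_K. With e = d - 1 it follows from the first three terms of the binomial
    expansion of (1 + 2/e)^(e+1). *)
Lemma markov_constant (d : nat) : (2 <= d)%N ->
  (5 * d ^ 2 * d.-1 ^ d.-1 <= d.+1 ^ d.+1)%N.
Proof.
case: d => [//|e]; rewrite ltnS /= => e0.
have H m : (e ^ m * (e ^ 2 + 2 * m * e + 2 * m * m.-1) <= e ^ 2 * (e + 2) ^ m)%N.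
  elim: m => [|m IH]; first by rewrite !expn0 !muln0 mul1n muln1; lia.
  rewrite [((e + 2) ^ m.+1)%N]expnSr mulnA; apply: leq_trans (leq_mul IH (leqnn _)).
  rewrite expnSr -!mulnA leq_mul2l; apply/orP; right; clear.
  case: m => [|m] /=; nia.
have := H e.+1; rewrite /= expnSr.
rewrite (_ : (e + 2)%N = e.+2); last by rewrite addn2.
have e20 : (0 < e ^ 2)%N by rewrite expn_gt0 e0.
move=> {}H; rewrite -(leq_pmul2l e20) [(e.+2 ^ e.+2)%N]expnSr [leqRHS]mulnA.
apply: leq_trans (leq_mul H (leqnn _)).
move: (e ^ e)%N e20 e0 => X _ _; clear; nia.
Qed.

(** * Lebesgue outer measure *)

Lemma box_volume_ge0 {R : realType} (n : nat) (p : 'rV[R]_n * 'rV[R]_n) :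
  0 <= box_volume p.
Proof. by apply: prodr_ge0 => i _; rewrite le_max lexx. Qed.

Lemma lebesgue_n_ge0 {R : realType} (n : nat) (A : set 'rV[R]_n) :
  (0 <= lebesgue_n A)%E.
Proof.
apply: le_ereal_inf_tmp => _ [B _ <-]; apply: nneseries_ge0 => k _ _.
by rewrite lee_fin box_volume_ge0.
Qed.

Lemma lebesgue_n_le {R : realType} (n : nat) (A B : set 'rV[R]_n) :
  A `<=` B -> (lebesgue_n A <= lebesgue_n B)%E.
Proof.
move=> AB; apply: ereal_inf_le_tmp => _ [C BC <-]; exists C => //.
exact: subset_trans BC.
Qed.

(** The definition allows covers indexed by nat, so the double sequence is renumbered through a
    bijection between nat and its square. *)
Lemma lebesgue_n_le_double_cover {R : realType} (n : nat) (A : set 'rV[R]_n)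
    (G : nat -> nat -> 'rV[R]_n * 'rV[R]_n) :
  A `<=` \bigcup_i \bigcup_k box (G i k) ->
  (lebesgue_n A <=
   \sum_(0 <= i <oo) \sum_(0 <= k <oo) (box_volume (G i k))%:E)%E.
Proof.
move=> AG.
have G0 i k : (0 <= (box_volume (G i k))%:E)%E by rewrite lee_fin box_volume_ge0.
have /card_esym/ppcard_eqP[f] := card_nat2.
apply: (@le_trans _ _ (\sum_(0 <= j <oo) (box_volume (G (f j).1 (f j).2))%:E)%E).
  apply: ereal_inf_lbound; exists (fun j => G (f j).1 (f j).2) => //= x /AG.
  move=> [i _ [k _ xik]]; exists (f^-1%FUN (i, k)) => //=.
  by rewrite invK ?inE.
rewrite nneseries_esumT // -(@reindex_esum _ _ _ setT setT f
  (fun p => (box_volume (G p.1 p.2))%:E)); last exact: bij.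
rewrite nneseries_esumT => [|i]; last by apply: nneseries_ge0.
rewrite (eq_esum (b := fun i => \esum_(k in setT) (box_volume (G i k))%:E)%E);
  last by move=> i _; rewrite nneseries_esumT.
rewrite esum_esum // le_eqVlt; apply/orP; left; apply/eqP; congr esum.
by apply/seteqP; split=> -[].
Qed.

Lemma lebesgue_n_sigma_subadditive (R : realType) (n : nat) :
  sigma_subadditive (@lebesgue_n R n).
Proof.
move=> A.
have [[i ioo]|/forallNP Afin] := pselect (exists i, lebesgue_n (A i) = +oo%E).
  rewrite (eseries_pinfty _ _ ioo) ?leey// => k _.
  by rewrite -ltNye (lt_le_trans _ (lebesgue_n_ge0 _ _)).
apply/lee_addgt0Pr => e e0.
apply: le_trans (epsilon_trick _ (fun i => lebesgue_n_ge0 _ (A i)) (ltW e0)).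
have H i : exists B : nat -> 'rV[R]_n * 'rV[R]_n, A i `<=` \bigcup_k box (B k) /\
    (\sum_(0 <= k <oo) (box_volume (B k))%:E <=
     lebesgue_n (A i) + (e / (2 ^ i.+1)%:R)%:E)%E.
  have ei : 0 < e / (2 ^ i.+1)%:R by rewrite divr_gt0 // ltr0n expn_gt0.
  have fi : lebesgue_n (A i) \is a fin_num.
    by rewrite ge0_fin_numE ?lebesgue_n_ge0 // ltey; apply/eqP/Afin.
  have [_ [B AB <-] Bi] := lb_ereal_inf_adherent ei fi.
  by exists B; split=> //; apply: ltW.
have [G GP] := choice H.
apply: (@le_trans _ _ (\sum_(0 <= i <oo) \sum_(0 <= k <oo) (box_volume (G i k))%:E)%E).
  apply: lebesgue_n_le_double_cover => x [i _ /(GP i).1 Gx]; by exists i.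
apply: lee_nneseries => [i _ _|i _]; last exact: (GP i).2.
by apply: nneseries_ge0 => k _ _; rewrite lee_fin box_volume_ge0.
Qed.

Lemma lebesgue_n_box {R : realType} (n : nat) (p : 'rV[R]_n * 'rV[R]_n) :
  (1 <= n)%N -> (lebesgue_n (box p) <= (box_volume p)%:E)%E.
Proof.
(* The cover is padded with degenerate boxes; their volume is 0 because there is at least one
   coordinate. *)
move=> n1; pose B k : 'rV[R]_n * 'rV[R]_n := if k is 0 then p else (0, 0).
have B0 k : (0 < k)%N -> box_volume (B k) = 0.
  case: k => // k _; rewrite /box_volume /=.
  by rewrite (bigD1 (Ordinal n1)) //= !mxE subrr maxxx mul0r.
apply: ereal_inf_lbound; exists B => [x px|]; first by exists 0%N.
rewrite nneseries_recl // => [|k _]; last by rewrite lee_fin box_volume_ge0.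
by rewrite eseries0 ?adde0 // => k k0 _; rewrite B0.
Qed.

Lemma lebesgue_n_set0 (R : realType) (n : nat) : (1 <= n)%N ->
  lebesgue_n (set0 : set 'rV[R]_n) = 0%E.
Proof.
move=> n1; apply/eqP; rewrite eq_le lebesgue_n_ge0 andbT.
have := @lebesgue_n_box R n (0, 0) n1; rewrite /box_volume.
rewrite (bigD1 (Ordinal n1)) //= !mxE subrr maxxx mul0r; apply: le_trans.
by apply: lebesgue_n_le.
Qed.

HB.instance Definition _ (R : realType) (n : nat) :=
  isOuterMeasure.Build R 'rV[R]_n.+1 (@lebesgue_n R n.+1)
    (lebesgue_n_set0 R n.+1 isT) (@lebesgue_n_ge0 R n.+1)
    (@lebesgue_n_le R n.+1) (@lebesgue_n_sigma_subadditive R n.+1).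

(** Reduces volume estimates to boxes, for affine preimages as well as for Lipschitz images. *)
Lemma lebesgue_n_transfer {R : realType} (n n' : nat)
    (T : set 'rV[R]_n -> set 'rV[R]_n') (c : R) (A : set 'rV[R]_n) :
  0 < c -> (forall F : nat -> set 'rV[R]_n, A `<=` \bigcup_k F k ->
    T A `<=` \bigcup_k T (F k)) ->
  (forall p, (lebesgue_n (T (box p)) <= (c * box_volume p)%:E)%E) ->
  (lebesgue_n (T A) <= c%:E * lebesgue_n A)%E.
Proof.
move=> c0 TU Tbox.
rewrite -lee_pdivrMl //.
apply: le_ereal_inf_tmp => _ [B AB <-].
rewrite lee_pdivrMl // -nneseriesZl; last by move=> k _; rewrite lee_fin box_volume_ge0.
apply: (@le_trans _ _ (lebesgue_n (\bigcup_k T (box (B k))))).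
  apply: le_trans (lebesgue_n_le n' _ _ (TU _ AB)) _; exact: lexx.
apply: le_trans (lebesgue_n_sigma_subadditive R n' _) _.
apply: lee_nneseries => k _; first by rewrite lebesgue_n_ge0.
by rewrite -EFinM.
Qed.

Lemma box_volumeD1 {R : realType} (n : nat) (p : 'rV[R]_n * 'rV[R]_n) (i : 'I_n) :
  box_volume p = Num.max 0 (p.2 0 i - p.1 0 i) *
    \prod_(j < n | j != i) Num.max 0 (p.2 0 j - p.1 0 j).
Proof. by rewrite /box_volume (bigD1 i). Qed.

Lemma max_split {R : realType} (a b t : R) :
  Num.max 0 (b - a) = Num.max 0 (Num.min b t - a) + Num.max 0 (b - Num.max a t).
Proof.
have [?|?] := leP b t; have [?|?] := leP a t; have [?|?] := leP 0 (b - a);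
  have [?|?] := leP 0 (b - t); have [?|?] := leP 0 (t - a); lra.
Qed.

Definition halfspace {R : realType} (n : nat) (i : 'I_n) (t : R) : set 'rV[R]_n :=
  [set x | x 0 i <= t].

(** The hyperplane cuts each box of a cover into two boxes whose volumes add up. One of them may be
    empty, which the truncation at 0 in [box_volume] takes into account. *)
Lemma halfspace_measurable {R : realType} (n : nat) (i : 'I_n.+1) (t : R) :
  lebesgue_measurable (halfspace n.+1 i t).
Proof.
apply: le_caratheodory_measurable => X /=.
apply: le_ereal_inf_tmp => _ [B XB <-].
pose lo (p : 'rV[R]_n.+1 * 'rV[R]_n.+1) := (p.1, set_coord p.2 i (Num.min (p.2 0 i) t)).
pose hi (p : 'rV[R]_n.+1 * 'rV[R]_n.+1) := (set_coord p.1 i (Num.max (p.1 0 i) t), p.2).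
have vol p : box_volume p = box_volume (lo p) + box_volume (hi p).
  rewrite (box_volumeD1 n.+1 p i) (box_volumeD1 n.+1 (lo p) i).
  rewrite (box_volumeD1 n.+1 (hi p) i) /= !mxE eqxx.
  have -> : \prod_(j < n.+1 | j != i) Num.max 0 (set_coord p.2 i (Num.min (p.2 0 i) t) 0 j - p.1 0 j) =
      \prod_(j < n.+1 | j != i) Num.max 0 (p.2 0 j - p.1 0 j).
    by apply: eq_bigr => j /negbTE ji; rewrite mxE ji.
  have -> : \prod_(j < n.+1 | j != i) Num.max 0 (p.2 0 j - set_coord p.1 i (Num.max (p.1 0 i) t) 0 j) =
      \prod_(j < n.+1 | j != i) Num.max 0 (p.2 0 j - p.1 0 j).
    by apply: eq_bigr => j /negbTE ji; rewrite mxE ji.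
  rewrite -mulrDl; congr (_ * _).
  exact: max_split.
apply: (@le_trans _ _ (\sum_(0 <= k <oo) (box_volume (lo (B k)))%:E +
    \sum_(0 <= k <oo) (box_volume (hi (B k)))%:E)%E).
  apply: leeD.
    apply: ereal_inf_lbound; exists (fun k => lo (B k)) => // x [/XB[k _ Bx] xt].
    exists k => // j; have /andP[xa xb] := Bx j; rewrite /= mxE xa /=.
    by case: (eqVneq j i) xb => // -> xb; rewrite le_min xb.
  apply: ereal_inf_lbound; exists (fun k => hi (B k)) => // x [/XB[k _ Bx] xt].
  exists k => // j; have /andP[xa xb] := Bx j; rewrite /= mxE xb andbT.
  case: (eqVneq j i) xa => // -> xa; rewrite ge_max xa /= ltW // ltNge.
  exact/negP.
rewrite -nneseriesD; try by move=> k _ _; rewrite lee_fin box_volume_ge0.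
rewrite le_eqVlt; apply/orP; left; apply/eqP; apply: eq_eseriesr => k _.
by rewrite -EFinD -vol.
Qed.

Lemma halfspace_ge_measurable {R : realType} (n : nat) (i : 'I_n.+1) (t : R) :
  lebesgue_measurable [set x : 'rV[R]_n.+1 | t <= x 0 i].
Proof.
rewrite (_ : [set x | _] = \bigcap_k (~` halfspace n.+1 i (t - k.+1%:R^-1))).
  rewrite -[X in lebesgue_measurable X]setCK.
  apply: caratheodory_measurable_setC; rewrite setC_bigcap.
  apply: caratheodory_measurable_bigcup => k; rewrite setCK.
  exact: halfspace_measurable.
apply/seteqP; split=> x /=.
  move=> tx k _ /=; apply/negP; rewrite -ltNge; apply: lt_le_trans tx.
  by rewrite gtrBl invr_gt0.
move=> H; apply/ler_addgt0Pr => e e0.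
pose k := Num.truncn e^-1.
have ke : k.+1%:R^-1 < e.
  by rewrite invf_plt ?posrE ?ltr0n // truncnS_gt.
have /negP := H k I; rewrite -ltNge => h.
rewrite -lerBlDr; apply: le_trans (ltW h); rewrite lerB //; exact: ltW ke.
Qed.

Lemma box_measurable {R : realType} (n : nat) (p : 'rV[R]_n.+1 * 'rV[R]_n.+1) :
  lebesgue_measurable (box p).
Proof.
pose F i : set 'rV[R]_n.+1 := [set x : 'rV[R]_n.+1 | p.1 0 i <= x 0 i] `&` halfspace n.+1 i (p.2 0 i).
have FM i : lebesgue_measurable (F i).
  apply: caratheodory_measurable_setI; first exact: halfspace_ge_measurable.
  exact: halfspace_measurable.
rewrite (_ : box p = \big[setI/setT]_(i < n.+1) F i).
  apply: (big_ind (@lebesgue_measurable R n.+1)) => [|A B|i _]; last exact: FM.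
    rewrite -setC0; apply: caratheodory_measurable_setC.
    exact: caratheodory_measurable_set0.
  exact: caratheodory_measurable_setI.
rewrite -bigcap_seq; apply/seteqP; split=> x xp.
  by move=> i _; split; have /andP[] := xp i.
by move=> i; have [|/= -> ->] := xp i; first by rewrite /= mem_index_enum.
Qed.

Lemma lebesgue_n_fin_bigcup {R : realType} (n : nat) (I : finType)
    (F : I -> set 'rV[R]_n.+1) :
  (lebesgue_n (\bigcup_i F i) <= \sum_i lebesgue_n (F i))%E.
Proof.
have -> : \bigcup_i F i = \big[setU/set0]_i F i.
  by apply/seteqP; split=> x; rewrite -bigcup_seq => -[i _ Fx]; exists i => //=;
    rewrite mem_index_enum.
elim/big_rec2: _ => [|i x A _ IH]; first by rewrite outer_measure0.
apply: le_trans (outer_measureU2 _ _ _) _; exact: leeD2l.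
Qed.

(** * Dilations, volumes and the counting of overlaps *)

Definition dilate {R : realType} (n : nat) (a : 'rV[R]_n) (s : R)
    (A : set 'rV[R]_n) : set 'rV[R]_n :=
  [set x | A (a + s *: x)].

Lemma lebesgue_n_dilate_le {R : realType} (n : nat) (a : 'rV[R]_n.+1) (s : R)
    (A : set 'rV[R]_n.+1) : 0 < s ->
  (lebesgue_n (dilate n.+1 a s A) <= (s ^- n.+1)%:E * lebesgue_n A)%E.
Proof.
move=> s0; apply: (lebesgue_n_transfer n.+1 n.+1 (dilate n.+1 a s)).
- by rewrite invr_gt0 exprn_gt0.
- by move=> F AF x /AF[k _ Fx]; exists k.
move=> p; pose q : 'rV[R]_n.+1 * 'rV[R]_n.+1 :=
  (s^-1 *: (p.1 - a), s^-1 *: (p.2 - a)).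
apply: (@le_trans _ _ (lebesgue_n (box q))).
  apply: lebesgue_n_le => x xp i; have := xp i; rewrite !mxE.
  by rewrite ler_pdivrMl // ler_pdivlMl // lerBlDl lerBrDl.
apply: le_trans (lebesgue_n_box n.+1 q isT) _.
rewrite lee_fin /box_volume -[X in s ^- X]card_ord -prodr_const -prodfV -big_split /=.
rewrite le_eqVlt; apply/orP; left; apply/eqP; apply: eq_bigr => i _.
rewrite !mxE -mulrBr opprB addrA subrK.
by rewrite -[in LHS](mulr0 s^-1) maxr_pMr // invr_ge0 ltW.
Qed.

(** The reverse inequality is the previous one for the inverse affine map. *)
Lemma lebesgue_n_dilate {R : realType} (n : nat) (a : 'rV[R]_n.+1) (s : R)
    (A : set 'rV[R]_n.+1) : 0 < s ->
  lebesgue_n (dilate n.+1 a s A) = ((s ^- n.+1)%:E * lebesgue_n A)%E.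
Proof.
move=> s0; apply/eqP; rewrite eq_le lebesgue_n_dilate_le //=.
have si0 : 0 < s^-1 by rewrite invr_gt0.
have := lebesgue_n_dilate_le n (- s^-1 *: a) s^-1 (dilate n.+1 a s A) si0.
have -> : dilate n.+1 (- s^-1 *: a) s^-1 (dilate n.+1 a s A) = A.
  apply/funext => x; rewrite /dilate /=; congr (A _).
  by rewrite scalerDr !scalerA mulrN mulfV ?gt_eqF // scaleN1r scale1r addrA subrr add0r.
rewrite exprVn invrK => H.
by rewrite lee_pdivrMl // exprn_gt0.
Qed.

Lemma dilate_measurable {R : realType} (n : nat) (a : 'rV[R]_n.+1) (s : R)
    (A : set 'rV[R]_n.+1) : 0 < s ->
  lebesgue_measurable A -> lebesgue_measurable (dilate n.+1 a s A).
Proof.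
move=> s0 AM X.
have si0 : 0 < s^-1 by rewrite invr_gt0.
have [Y ->] : exists Y, X = dilate n.+1 a s Y.
  exists (dilate n.+1 (- s^-1 *: a) s^-1 X).
  apply/funext => x; rewrite /dilate /=; congr (X _).
  by rewrite scalerDr !scalerA mulVf ?gt_eqF // scale1r addrA scaleNr addNr add0r.
have -> : dilate n.+1 a s Y `&` dilate n.+1 a s A = dilate n.+1 a s (Y `&` A) by [].
have -> : dilate n.+1 a s Y `&` ~` dilate n.+1 a s A =
  dilate n.+1 a s (Y `&` ~` A) by [].
rewrite !lebesgue_n_dilate // [in LHS](AM Y) ge0_muleDr ?lebesgue_n_ge0 //.
Qed.

Lemma volume_fin {R : realType} (n : nat) (A : set 'rV[R]_n) :
  (lebesgue_n A < +oo)%E -> lebesgue_n A = (volume A)%:E.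
Proof.
by move=> Afin; rewrite /volume fineK // ge0_fin_numE ?lebesgue_n_ge0.
Qed.

Lemma volume_ge0 {R : realType} (n : nat) (A : set 'rV[R]_n) : 0 <= volume A.
Proof. by rewrite /volume fine_ge0 // lebesgue_n_ge0. Qed.

Lemma volume_le {R : realType} (n : nat) (A B : set 'rV[R]_n) :
  (lebesgue_n B < +oo)%E -> A `<=` B -> volume A <= volume B.
Proof.
move=> Bfin AB; rewrite -lee_fin -!volume_fin ?lebesgue_n_le //.
exact: le_lt_trans (lebesgue_n_le n _ _ AB) Bfin.
Qed.

Lemma volume_split {R : realType} (n : nat) (X A : set 'rV[R]_n) :
  (lebesgue_n X < +oo)%E -> lebesgue_measurable A ->
  volume X = volume (X `&` A) + volume (X `&` ~` A).
Proof.
move=> Xfin AM.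
have sub (Y : set 'rV[R]_n) : Y `<=` X -> (lebesgue_n Y < +oo)%E.
  by move=> YX; apply: le_lt_trans Xfin; apply: lebesgue_n_le.
apply: EFin_inj; rewrite EFinD -(volume_fin n X Xfin).
rewrite -(volume_fin n (X `&` A)); last by apply: sub => x [].
rewrite -(volume_fin n (X `&` ~` A)); last by apply: sub => x [].
exact: AM.
Qed.

Lemma volume0 (R : realType) (n : nat) : volume (set0 : set 'rV[R]_n.+1) = 0.
Proof. by rewrite /volume lebesgue_n_set0. Qed.

Definition multiplicity {R : realType} (n : nat) (B : nat -> set 'rV[R]_n) (M : nat)
    (x : 'rV[R]_n) : nat := (\sum_(i < M) (x \in B i))%N.

Lemma sum_volume_split {R : realType} (n : nat) (B : nat -> set 'rV[R]_n)
    (M : nat) (X : set 'rV[R]_n) (A : set 'rV[R]_n) :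
  lebesgue_measurable A -> (lebesgue_n X < +oo)%E ->
  \sum_(i < M) volume (X `&` B i) =
  \sum_(i < M) volume (X `&` A `&` B i) + \sum_(i < M) volume (X `&` ~` A `&` B i).
Proof.
move=> AM Xfin; rewrite -big_split /=; apply: eq_bigr => i _.
rewrite (volume_split n _ A) //.
  by rewrite setIAC [X in _ + volume X]setIAC.
by apply: le_lt_trans Xfin; apply: lebesgue_n_le; apply: subIsetl.
Qed.

(** With [multiplicity_le], this replaces integration of the counting function, for a set X that
    need not be measurable: X is split along the last set [B M], and inside it one membership is
    used up. *)
Lemma multiplicity_ge {R : realType} (n : nat) (B : nat -> set 'rV[R]_n.+1)
    (M k : nat) (X : set 'rV[R]_n.+1) :
  (forall i, lebesgue_measurable (B i)) -> (lebesgue_n X < +oo)%E ->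
  (forall x, X x -> (k <= multiplicity n.+1 B M x)%N) ->
  k%:R * volume X <= \sum_(i < M) volume (X `&` B i).
Proof.
move=> BM; elim: M k X => [|M IH] k X Xfin kX.
  rewrite big_ord0.
  have [k0|k0] := posnP k; first by rewrite k0 mul0r.
  have -> : X = set0.
    rewrite -subset0 => x /kX; rewrite /multiplicity big_ord0 leqn0 => /eqP k0'.
    by rewrite k0' in k0.
  by rewrite volume0 mulr0.
have sub (Y : set 'rV[R]_n.+1) : Y `<=` X -> (lebesgue_n Y < +oo)%E.
  by move=> YX; apply: le_lt_trans Xfin; apply: lebesgue_n_le.
rewrite big_ord_recr /= (sum_volume_split n.+1 B M X (B M)) //.
have := IH k.-1 (X `&` B M) (sub _ (@subIsetl _ _ _)).
have := IH k (X `&` ~` B M) (sub _ (@subIsetl _ _ _)).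
rewrite (volume_split n.+1 X (B M)) //.
set v1 := volume (X `&` B M); set v0 := volume (X `&` ~` B M).
set s1 := \sum_(_ < _) _; set s0 := \sum_(_ < _) _ => H0 H1.
have v10 : 0 <= v1 := volume_ge0 _ _.
have kk : k%:R <= k.-1%:R + 1 :> R by rewrite natr1 ler_nat; case: (k).
have {}H0 : k%:R * v0 <= s1.
  apply: H0 => x [Xx xB]; have := kX x Xx.
  by rewrite /multiplicity big_ord_recr /= memNset // addn0.
have {}H1 : k.-1%:R * v1 <= s0.
  apply: H1 => x [Xx xB]; have := kX x Xx.
  by rewrite /multiplicity big_ord_recr /= mem_set // addn1 -ltnS; case: (k).
have := ler_wpM2r v10 kk; rewrite mulrDl mul1r mulrDr.
move: H0 H1; move: (k%:R * v1) (k%:R * v0) (k.-1%:R * v1) => x1 x2 x3; lra.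
Qed.

Lemma multiplicity_le {R : realType} (n : nat) (B : nat -> set 'rV[R]_n.+1)
    (M k : nat) (X : set 'rV[R]_n.+1) :
  (forall i, lebesgue_measurable (B i)) -> (lebesgue_n X < +oo)%E ->
  (forall x, X x -> (multiplicity n.+1 B M x <= k)%N) ->
  \sum_(i < M) volume (X `&` B i) <= k%:R * volume X.
Proof.
move=> BM; elim: M k X => [|M IH] k X Xfin kX.
  by rewrite big_ord0 mulr_ge0 // volume_ge0.
have sub (Y : set 'rV[R]_n.+1) : Y `<=` X -> (lebesgue_n Y < +oo)%E.
  by move=> YX; apply: le_lt_trans Xfin; apply: lebesgue_n_le.
rewrite big_ord_recr /= (sum_volume_split n.+1 B M X (B M)) //.
have := IH k.-1 (X `&` B M) (sub _ (@subIsetl _ _ _)).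
have := IH k (X `&` ~` B M) (sub _ (@subIsetl _ _ _)).
rewrite (volume_split n.+1 X (B M)) //.
set v1 := volume (X `&` B M); set v0 := volume (X `&` ~` B M).
set s1 := \sum_(_ < _) _; set s0 := \sum_(_ < _) _ => H0 H1.
have v10 : 0 <= v1 := volume_ge0 _ _.
have kk : (k.-1%:R + 1) * v1 <= k%:R * v1.
  case: (posnP k) => [k0|k0]; last by rewrite natr1 prednK.
  suff X0 : X `&` B M = set0 by rewrite /v1 X0 volume0 !mulr0.
  rewrite -subset0 => x [Xx xB]; have := kX x Xx.
  by rewrite k0 /multiplicity big_ord_recr /= mem_set // addn1.
have {}H0 : s1 <= k%:R * v0.
  apply: H0 => x [Xx xB]; have := kX x Xx.
  by rewrite /multiplicity big_ord_recr /= memNset // addn0.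
have {}H1 : s0 <= k.-1%:R * v1.
  apply: H1 => x [Xx xB]; have := kX x Xx.
  by rewrite /multiplicity big_ord_recr /= mem_set // addn1 -ltnS; case: (k).
move: kk; rewrite mulrDl mul1r mulrDr.
move: H0 H1; move: (k%:R * v1) (k%:R * v0) (k.-1%:R * v1) => x1 x2 x3; lra.
Qed.

(** A nearly optimal cover by boxes; it makes overlap counting applicable to arbitrary sets. *)
Lemma measurable_hull {R : realType} (n : nat) (A : set 'rV[R]_n.+1) (e : R) :
  (lebesgue_n A < +oo)%E -> 0 < e -> exists H : set 'rV[R]_n.+1,
    [/\ lebesgue_measurable H, A `<=` H, (lebesgue_n H < +oo)%E &
        volume H <= volume A + e].
Proof.
move=> Afin e0.
have Af : lebesgue_n A \is a fin_num by rewrite ge0_fin_numE ?lebesgue_n_ge0.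
have [_ [B AB <-] Be] := lb_ereal_inf_adherent e0 Af.
have HB : (lebesgue_n (\bigcup_k box (B k)) <= (volume A + e)%:E)%E.
  rewrite EFinD -volume_fin //; apply: le_trans (ltW Be).
  apply: le_trans (lebesgue_n_sigma_subadditive R n.+1 _) _.
  apply: lee_nneseries => k _; first by rewrite lebesgue_n_ge0.
  exact: lebesgue_n_box.
have Hfin := le_lt_trans HB (ltry _).
exists (\bigcup_k box (B k)); split => //.
  by apply: caratheodory_measurable_bigcup => k; apply: box_measurable.
by rewrite -lee_fin -volume_fin.
Qed.

(** * Outer measure of Lipschitz images *)

Lemma horner_ge_right {R : realType} (p : {poly R}) (x : R) :
  (forall t : R, 0 < t -> x <= p.[t]) -> x <= p.[0].
Proof.
move=> px; rewrite leNgt; apply/negP => lt0.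
have d0 : 0 < x - p.[0] by rewrite subr_gt0.
have cp : {for 0, continuous (horner p)} by apply: continuous_horner.
have /cvgrPdist_lt/(_ _ d0)/nbhs_ballP[r r0 rP] := cp.
have r20 : 0 < r / 2 by rewrite divr_gt0.
have := rP (r / 2); rewrite -ball_normE /= sub0r normrN gtr0_norm //.
rewrite ltr_pdivrMr // ltr_pMr // ltr1n => /(_ isT).
have := px _ r20; move: (p.[r / 2]) (p.[0]) => a b h.
by rewrite distrC => /(le_lt_trans (ler_norm _)); lra.
Qed.

Lemma truncn_bounds {R : realType} (t : R) : 0 <= t ->
  (Num.truncn t)%:R <= t < (Num.truncn t).+1%:R.
Proof. by move=> t0; rewrite truncn_itv. Qed.

(* Cover the box by cubes of side [t], and let [t] tend to [0]. *)
Lemma lipschitz_box {R : realType} (n : nat) (S : set 'rV[R]_n.+1)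
    (phi : 'rV[R]_n.+1 -> 'rV[R]_n.+1) (L : R) (p : 'rV[R]_n.+1 * 'rV[R]_n.+1) :
  0 < L ->
  (forall x y, S x -> S y -> forall D : R, (forall i, `|x 0 i - y 0 i| <= D) ->
     forall i, `|phi x 0 i - phi y 0 i| <= L * D) ->
  (lebesgue_n (phi @` (S `&` box p)) <= ((2 * L) ^+ n.+1 * box_volume p)%:E)%E.
Proof.
move=> L0 phiL.
have [pos|/existsNP[i /negP]] := pselect (forall i, p.1 0 i <= p.2 0 i); last first.
  rewrite -ltNge => pi.
  have -> : S `&` box p = set0.
    by rewrite -subset0 => x [_ /(_ i) /andP[a b]]; have := le_trans a b; rewrite leNgt pi.
  by rewrite image_set0 lebesgue_n_set0 // lee_fin mulr_ge0 ?box_volume_ge0 ?exprn_ge0 // mulr_ge0 // ltW.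
pose l i := p.2 0 i - p.1 0 i.
have l0 i : 0 <= l i by rewrite subr_ge0.
(* At most l_i/t + 1 cubes are needed in direction i, and the image of each lies in a cube of side 2
   L t. The total volume is thus at most q(t). *)
pose q : {poly R} := \prod_(i < n.+1) ((2 * L) *: ('X + (l i)%:P)).
have q0 : q.[0] = (2 * L) ^+ n.+1 * box_volume p.
  rewrite horner_prod /box_volume -[X in _ ^+ X]card_ord -prodr_const -big_split /=.
  by apply: eq_bigr => i _; rewrite hornerZ hornerD hornerX hornerC add0r max_r ?l0.
have key (t : R) : 0 < t -> (lebesgue_n (phi @` (S `&` box p)) <= q.[t]%:E)%E.
  move=> t0.
  pose m i := (Num.truncn (l i / t)).+1.
  pose N := \max_i m i.
  have mN i : (m i <= N)%N by apply: leq_bigmax.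
  pose Q (z : {ffun 'I_n.+1 -> 'I_N}) : set 'rV[R]_n.+1 :=
    [set x | forall i, (z i < m i)%N /\
       p.1 0 i + (z i)%:R * t <= x 0 i <= p.1 0 i + (z i).+1%:R * t].
  (* All coordinates share the index range N. Indices from m_i on receive volume 0, so that the sum
     over z factors into a product of sums. *)
  pose c (z : {ffun 'I_n.+1 -> 'I_N}) : R := \prod_(i < n.+1) ((z i < m i)%:R * (2 * L * t)).
  have cover : phi @` (S `&` box p) `<=` \bigcup_(z : {ffun 'I_n.+1 -> 'I_N}) phi @` (S `&` Q z).
    move=> _ [x [Sx px] <-].
    have xl i : 0 <= (x 0 i - p.1 0 i) / t <= l i / t.
      have /andP[a b] := px i.
      by rewrite divr_ge0 ?subr_ge0 ?(ltW t0) //= ler_pM2r ?invr_gt0 // lerB.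
    have zm i : (Num.truncn ((x 0 i - p.1 0 i) / t)%R < m i)%N.
      by rewrite /m ltnS; apply: le_truncn; have /andP[] := xl i.
    exists [ffun i => Ordinal (leq_trans (zm i) (mN i))] => //; exists x => //.
    split=> // i; rewrite ffunE /=; split; first exact: zm.
    have /andP[a b] := xl i; have /andP[u v] := truncn_bounds _ a.
    apply/andP; split; first by rewrite -lerBrDl -ler_pdivlMr.
    by rewrite -lerBlDl -ler_pdivrMr // ltW.
  apply: le_trans (lebesgue_n_le n.+1 _ _ cover) _.
  apply: le_trans (lebesgue_n_fin_bigcup n _ _) _.
  have Qc z : (lebesgue_n (phi @` (S `&` Q z)) <= (c z)%:E)%E.
    have [[x0 [Sx0 Qx0]]|/forallNP empty] := pselect (exists x : 'rV[R]_n.+1, (S `&` Q z) x); last first.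
      have -> : S `&` Q z = set0 by rewrite -subset0 => x /empty.
      rewrite image_set0 lebesgue_n_set0 // lee_fin prodr_ge0 // => i _.
      by rewrite mulr_ge0 // !mulr_ge0 // ltW.
    pose b : 'rV[R]_n.+1 * 'rV[R]_n.+1 :=
      (phi x0 - const_mx (L * t), phi x0 + const_mx (L * t)).
    apply: (@le_trans _ _ (lebesgue_n (box b))).
      apply: lebesgue_n_le => _ [x [Sx Qx] <-] i; rewrite !mxE.
      have : `|phi x 0 i - phi x0 0 i| <= L * t.
        apply: phiL => // j; have [_ /andP[a1 a2]] := Qx j; have [_ /andP[b1 b2]] := Qx0 j.
        rewrite ler_norml -natr1 in a2 b2 *; apply/andP; split; lra.
      by rewrite ler_distl.
    apply: le_trans (lebesgue_n_box n.+1 b isT) _; rewrite lee_fin /box_volume /c.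
    rewrite le_eqVlt; apply/orP; left; apply/eqP; apply: eq_bigr => i _.
    have [-> _] := Qx0 i; rewrite !mxE mul1r max_r.
      by ring.
    by rewrite subr_ge0 lerD2l -subr_ge0 opprK addr_ge0 // mulr_ge0 // ltW.
  apply: (@le_trans _ _ (\sum_z (c z)%:E)%E); first exact: lee_sum.
  rewrite sumEFin lee_fin /c -(bigA_distr_bigA (fun i (j : 'I_N) => (j < m i)%:R * (2 * L * t))).
  rewrite horner_prod; apply: ler_prod => i _; apply/andP; split.
    by apply: sumr_ge0 => j _; rewrite mulr_ge0 // !mulr_ge0 // ltW.
  rewrite -mulr_suml hornerZ hornerD hornerX hornerC.
  have -> : \sum_(j < N) (j < m i)%:R = (m i)%:R :> R.
    rewrite -natr_sum -[in RHS](card_ord (m i)) -sum1_card.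
    congr (_%:R); rewrite (big_ord_widen _ (fun=> 1%N) (mN i)) [RHS]big_mkcond /=.
    by apply: eq_bigr => j _; case: ltnP.
  rewrite (_ : (m i)%:R * (2 * L * t) = 2 * L * ((m i)%:R * t)); last by ring.
  rewrite ler_wpM2l ?mulr_ge0 ?(ltW L0) //.
  have lt0 : 0 <= l i / t by rewrite divr_ge0 // ltW.
  have /andP[h _] := truncn_bounds _ lt0.
  rewrite /m -natr1 mulrDl mul1r addrC lerD2l.
  by rewrite -ler_pdivlMr.
have fin : (lebesgue_n (phi @` (S `&` box p)) < +oo)%E.
  exact: le_lt_trans (key 1 ltr01) (ltry _).
rewrite -q0 (volume_fin n.+1 _ fin) lee_fin; apply: horner_ge_right => t t0.
by rewrite -lee_fin -volume_fin //; apply: key.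
Qed.

(** The 2 arises because the image of a small cube is enclosed in a cube centred at one of its own
    points. *)
Lemma lipschitz_image {R : realType} (n : nat) (S : set 'rV[R]_n.+1)
    (phi : 'rV[R]_n.+1 -> 'rV[R]_n.+1) (L : R) :
  0 < L ->
  (forall x y, S x -> S y -> forall D : R, (forall i, `|x 0 i - y 0 i| <= D) ->
     forall i, `|phi x 0 i - phi y 0 i| <= L * D) ->
  (lebesgue_n (phi @` S) <= ((2 * L) ^+ n.+1)%:E * lebesgue_n S)%E.
Proof.
move=> L0 phiL.
have := @lebesgue_n_transfer R n.+1 n.+1 (fun X => phi @` (S `&` X)) ((2 * L) ^+ n.+1) S.
rewrite setIid; apply.
- by rewrite exprn_gt0 // mulr_gt0.
- by move=> F SF _ [x Sx <-]; have [k _ Fx] := SF x Sx; exists k => //; exists x.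
- by move=> p; apply: lipschitz_box.
Qed.

(** * The unit cube and its grids *)

Definition ucube (R : realType) (n : nat) : set 'rV[R]_n :=
  [set x | forall i, 0 <= x 0 i <= 1].

Lemma lebesgue_n_ucube (R : realType) (n : nat) :
  (lebesgue_n (ucube R n.+1) <= 1%:E)%E.
Proof.
pose p : 'rV[R]_n.+1 * 'rV[R]_n.+1 := (0, const_mx 1).
apply: (@le_trans _ _ (lebesgue_n (box p))).
  by apply: lebesgue_n_le => x xu i; rewrite !mxE.
apply: le_trans (lebesgue_n_box n.+1 p isT) _; rewrite lee_fin /box_volume.
by rewrite big1 // => i _; rewrite !mxE subr0 max_r.
Qed.

Lemma sub_ucube_fin {R : realType} (n : nat) (A : set 'rV[R]_n.+1) :
  A `<=` ucube R n.+1 -> (lebesgue_n A < +oo)%E.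
Proof.
move=> /lebesgue_n_le h; apply: le_lt_trans h _.
exact: le_lt_trans (lebesgue_n_ucube R n) (ltry _).
Qed.

Lemma volume_ucube (R : realType) (n : nat) : volume (ucube R n.+1) <= 1.
Proof. by rewrite -lee_fin -volume_fin ?lebesgue_n_ucube // sub_ucube_fin. Qed.

Definition grid_box (R : realType) (n M : nat) (z : {ffun 'I_n -> 'I_M}) :
    'rV[R]_n * 'rV[R]_n :=
  (\row_i ((z i)%:R / M%:R), \row_i ((z i).+1%:R / M%:R)).

Lemma ucube_grid {R : realType} (n M : nat) (x : 'rV[R]_n) :
  (1 <= M)%N -> ucube R n x -> exists z : {ffun 'I_n -> 'I_M}, box (grid_box R n M z) x.
Proof.
case: M => // M _ xu.
pose k i := minn (Num.truncn (x 0 i * M.+1%:R)) M.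
have kM i : (k i < M.+1)%N by rewrite ltnS geq_minr.
exists [ffun i => Ordinal (kM i)] => i; rewrite !mxE !ffunE /=.
have M0 : 0 < M.+1%:R :> R by rewrite ltr0n.
have /andP[x0 x1] := xu i.
have /andP[a b] := truncn_bounds _ (mulr_ge0 x0 (ltW M0)).
rewrite ler_pdivrMr // ler_pdivlMr //; apply/andP; split.
  by apply: le_trans a; rewrite ler_nat geq_minl.
rewrite /k /minn; case: ltnP => _; first exact: ltW.
by rewrite -[leRHS]mul1r ler_wpM2r // ltW.
Qed.

Lemma grid_pigeonhole {R : realType} (n M : nat) (A : set 'rV[R]_n.+1) (c : R) :
  (1 <= M)%N -> A `<=` ucube R n.+1 ->
  (forall z : {ffun 'I_n.+1 -> 'I_M}, volume (A `&` box (grid_box R n.+1 M z)) <= c) ->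
  volume A <= (M ^ n.+1)%:R * c.
Proof.
move=> M1 Au Ac.
have fin (B : set 'rV[R]_n.+1) : B `<=` A -> (lebesgue_n B < +oo)%E.
  by move=> BA; apply: sub_ucube_fin; apply: subset_trans Au.
have cover : A `<=` \bigcup_(z : {ffun 'I_n.+1 -> 'I_M}) (A `&` box (grid_box R n.+1 M z)).
  by move=> x Ax; have [z xz] := ucube_grid n.+1 M x M1 (Au x Ax); exists z.
rewrite -lee_fin -volume_fin; last exact: fin.
apply: le_trans (lebesgue_n_le n.+1 _ _ cover) _.
apply: le_trans (lebesgue_n_fin_bigcup n _ _) _.
apply: (@le_trans _ _ (\sum_(z : {ffun 'I_n.+1 -> 'I_M}) c%:E)%E).
  apply: lee_sum => z _; rewrite volume_fin ?lee_fin //.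
  by apply: fin => x [].
by rewrite sumEFin sumr_const card_ffun !card_ord mulr_natl lee_fin.
Qed.

(** * Polynomials in several variables on the unit cube *)

Definition ev {R : realType} (n : nat) (y : 'rV[R]_n) (p : mpoly n R) : R :=
  meval (fun i => y 0 i) p.

(** The three bounds are stated together because they are stable under products, with d additive:
    the second order bound of a product uses the other two. Monomials are then covered with d their
    degree. *)
Definition taylor2 {R : realType} (n : nat) (p : mpoly n R) (d : nat) : Prop :=
  forall (y y' : 'rV[R]_n) (h : R), ucube R n y -> ucube R n y' -> 0 <= h ->
    (forall i, `|y' 0 i - y 0 i| <= h) ->
    [/\ `|ev n y p| <= 1, `|ev n y' p - ev n y p| <= d%:R * h &
        `|ev n y' p - ev n y p -
          \sum_i ev n y (mderiv i p) * (y' 0 i - y 0 i)| <= (d%:R * h) ^+ 2].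

Lemma taylor2_1 (R : realType) (n : nat) : @taylor2 R n 1 0.
Proof.
move=> y y' h yu y'u h0 yh; rewrite /ev !meval1 subrr normr0 normr1 !mul0r.
split=> //; rewrite sub0r normrN big1 ?normr0 ?expr0n // => i _.
by rewrite -mpolyC1 mderivC meval0 mul0r.
Qed.

Lemma taylor2_X (R : realType) (n : nat) (i : 'I_n) :
  taylor2 n (mpolyX R (mnm1 i)) 1.
Proof.
move=> y y' h yu y'u h0 yh; rewrite /ev !mevalXU mul1r.
split; [|exact: yh|].
  by have /andP[a b] := yu i; rewrite ger0_norm.
rewrite (bigD1 i) //= big1 => [|j ji].
  rewrite mderivX mnm1E eqxx mevalZ mul1r addr0 mevalX big1 => [|k _].
    by rewrite mul1r subrr normr0 sqr_ge0.
  by rewrite mnmBE subnn expr0.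
by rewrite mderivX mnm1E eq_sym (negbTE ji) mevalZ !mul0r.
Qed.

Lemma taylor2_M {R : realType} (n : nat) (p q : mpoly n R) (d e : nat) :
  taylor2 n p d -> taylor2 n q e -> taylor2 n (p * q) (d + e).
Proof.
move=> Tp Tq y y' h yu y'u h0 yh.
have [p1 pl pt] := Tp y y' h yu y'u h0 yh; have [q1 ql qt] := Tq y y' h yu y'u h0 yh.
have yy i : `|y' 0 i - y' 0 i| <= h by rewrite subrr normr0.
have [p1' _ _] := Tp y' y' h y'u y'u h0 yy.
have dh0 : 0 <= d%:R * h by apply: le_trans pl.
have eh0 : 0 <= e%:R * h by apply: le_trans ql.
rewrite /ev !mevalM -!/(ev _ _ _).
have dE : \sum_i ev n y (mderiv i (p * q)) * (y' 0 i - y 0 i) =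
    ev n y q * (\sum_i ev n y (mderiv i p) * (y' 0 i - y 0 i)) +
    ev n y p * (\sum_i ev n y (mderiv i q) * (y' 0 i - y 0 i)).
  rewrite !mulr_sumr -big_split /=; apply: eq_bigr => i _.
  by rewrite mderivM /ev mevalD !mevalM; ring.
rewrite dE {dE}.
set P := ev n y p in p1 pl pt *; set P' := ev n y' p in pl pt p1' *.
set Q := ev n y q in q1 ql qt *; set Q' := ev n y' q in ql qt *.
set DP := \sum_i _ in pt *; set DQ := \sum_i _ in qt *.
rewrite natrD mulrDl; set dh := d%:R * h in dh0 pl pt *.
set eh := e%:R * h in eh0 ql qt *.
split.
- by rewrite normrM mulr_ile1.
- have -> : P' * Q' - P * Q = P' * (Q' - Q) + Q * (P' - P) by ring.
  apply: le_trans (ler_normD _ _) _; rewrite !normrM addrC; apply: lerD.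
    by apply: le_trans pl; rewrite ler_piMl.
  by apply: le_trans ql; rewrite ler_piMl.
- have -> : P' * Q' - P * Q - (Q * DP + P * DQ) =
    (P' - P) * (Q' - Q) + P * (Q' - Q - DQ) + Q * (P' - P - DP) by ring.
  have h1 : `|(P' - P) * (Q' - Q)| <= dh * eh by rewrite normrM ler_pM.
  have h2 : `|P * (Q' - Q - DQ)| <= eh ^+ 2.
    by rewrite normrM; apply: le_trans qt; rewrite ler_piMl.
  have h3 : `|Q * (P' - P - DP)| <= dh ^+ 2.
    by rewrite normrM; apply: le_trans pt; rewrite ler_piMl.
  apply: le_trans (ler_normD _ _) _.
  apply: le_trans (lerD (ler_normD _ _) (lexx _)) _.
  have h4 := mulr_ge0 dh0 eh0.
  rewrite sqrrD; move: h1 h2 h3; set a := `|_|; set b := `|_|; set c := `|_|.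
  move: (dh * eh) (dh ^+ 2) (eh ^+ 2) h4 => u v w; lra.
Qed.

Lemma taylor2_le {R : realType} (n : nat) (p : mpoly n R) (d e : nat) :
  (d <= e)%N -> taylor2 n p d -> taylor2 n p e.
Proof.
move=> de Tp y y' h yu y'u h0 yh; have [p1 pl pt] := Tp y y' h yu y'u h0 yh.
have dh : d%:R * h <= e%:R * h by rewrite ler_wpM2r // ler_nat.
split=> //; first exact: le_trans dh.
apply: le_trans pt _; rewrite lerXn2r ?nnegrE ?mulr_ge0 //.
Qed.

Lemma taylor2_mpolyX (R : realType) (n : nat) (m : mpoly.multinom n) :
  taylor2 n (mpolyX R m) (mdeg m).
Proof.
rewrite mpolyXE_id mdegE.
elim/big_rec2: _ => [|i d p _ IH]; first exact: taylor2_1.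
apply: taylor2_M => //; elim: (m i) => [|k IHk].
  by rewrite expr0; exact: taylor2_1.
by rewrite exprS -add1n; apply: taylor2_M => //; apply: taylor2_X.
Qed.

Section Estimates.

Variables (R : realType) (n d : nat) (p : mpoly n R).
Hypothesis dp : (msize p <= d.+1)%N.

Lemma ev_sum (y : 'rV[R]_n) :
  ev n y p = \sum_(m <- msupp p) mcoeff m p * ev n y (mpolyX R m).
Proof.
by rewrite /ev mevalE; apply: eq_bigr => m _; rewrite mevalX.
Qed.

Lemma ev_mderiv_sum (y : 'rV[R]_n) (i : 'I_n) :
  ev n y (mderiv i p) =
  \sum_(m <- msupp p) mcoeff m p * ev n y (mderiv i (mpolyX R m)).
Proof.
rewrite {1}(mpolyE p) linear_sum /ev raddf_sum /=.
by apply: eq_bigr => m _; rewrite mderivZ mevalZ.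
Qed.

Lemma taylor2_term (m : mpoly.multinom n) : m \in msupp p -> taylor2 n (mpolyX R m) d.
Proof.
move=> /msize_mdeg_lt md; apply: taylor2_le (taylor2_mpolyX R n m).
by rewrite -ltnS; apply: leq_trans dp.
Qed.

Lemma norm_coef_sum (F : mpoly.multinom n -> R) (C : R) :
  (forall m, m \in msupp p -> `|F m| <= C) ->
  `|\sum_(m <- msupp p) mcoeff m p * F m| <= coef_norm p * C.
Proof.
move=> FC; apply: le_trans (ler_norm_sum _ _ _) _.
rewrite /coef_norm mulr_suml big_seq [leRHS]big_seq; apply: ler_sum => m mp.
by rewrite normrM ler_wpM2l // FC.
Qed.

Lemma ev_lipschitz (y y' : 'rV[R]_n) (h : R) : ucube R n y -> ucube R n y' ->
  0 <= h -> (forall i, `|y' 0 i - y 0 i| <= h) ->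
  `|ev n y' p - ev n y p| <= coef_norm p * (d%:R * h).
Proof.
move=> yu y'u h0 yh; rewrite !ev_sum -sumrB.
under eq_bigr => m _ do rewrite -mulrBr.
apply: norm_coef_sum => m mp.
by have [] := taylor2_term m mp y y' h yu y'u h0 yh.
Qed.

Lemma ev_taylor2 (y y' : 'rV[R]_n) (h : R) : ucube R n y -> ucube R n y' ->
  0 <= h -> (forall i, `|y' 0 i - y 0 i| <= h) ->
  `|ev n y' p - ev n y p -
     \sum_i ev n y (mderiv i p) * (y' 0 i - y 0 i)| <=
  coef_norm p * (d%:R * h) ^+ 2.
Proof.
move=> yu y'u h0 yh; rewrite !ev_sum -sumrB.
have -> : \sum_i ev n y (mderiv i p) * (y' 0 i - y 0 i) =
    \sum_(m <- msupp p) mcoeff m p *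
      \sum_i ev n y (mderiv i (mpolyX R m)) * (y' 0 i - y 0 i).
  under eq_bigr => i _ do rewrite ev_mderiv_sum mulr_suml.
  rewrite exchange_big /=; apply: eq_bigr => m _; rewrite mulr_sumr.
  by apply: eq_bigr => i _; rewrite mulrA.
rewrite -sumrB.
under eq_bigr => m _ do rewrite -!mulrBr.
apply: norm_coef_sum => m mp.
by have [] := taylor2_term m mp y y' h yu y'u h0 yh.
Qed.

Lemma ev_mderiv_bound (y : 'rV[R]_n) (i : 'I_n) : ucube R n y ->
  `|ev n y (mderiv i p)| <= coef_norm p * d%:R.
Proof.
move=> yu; rewrite ev_mderiv_sum; apply: norm_coef_sum => m mp.
have md : (mdeg m <= d)%N.
  by rewrite -ltnS; apply: leq_trans dp; apply: msize_mdeg_lt.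
rewrite mderivX /ev mevalZ normrM normr_nat.
have mi : (m i <= d)%N.
  by apply: leq_trans md; rewrite mdegE (bigD1 i) //= leq_addr.
rewrite -[leRHS]mulr1 ler_pM // ?ler_nat //.
have yy j : `|y 0 j - y 0 j| <= 0 by rewrite subrr normr0.
by have [] := taylor2_mpolyX R n (mpoly.mnm_sub m (mnm1 i)) y y 0 yu yu (lexx _) yy.
Qed.

End Estimates.

(** * Kronecker substitution and large values on the unit cube *)

Lemma digits_inj (B n : nat) (a b : 'I_n -> nat) :
  (forall i, (a i < B)%N) -> (forall i, (b i < B)%N) ->
  (\sum_i a i * B ^ i = \sum_i b i * B ^ i)%N -> a =1 b.
Proof.
elim: n a b => [|n IH] a b aB bB; first by move=> _ [].
rewrite !big_ord_recl /= !expn0 !muln1.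
have shift (c : 'I_n.+1 -> nat) : (\sum_(i < n) c (lift ord0 i) * B ^ bump 0 i =
    (\sum_(i < n) c (lift ord0 i) * B ^ i) * B)%N.
  rewrite big_distrl /=; apply: eq_bigr => i _.
  by rewrite /bump /= add1n expnSr mulnA.
rewrite !shift => E.
have E0 : a ord0 = b ord0.
  by have := congr1 (modn^~ B) E; rewrite ![(_ + _ * B)%N]addnC !modnMDl !modn_small.
have B0 : (0 < B)%N by apply: leq_trans (aB ord0).
move/eqP: E; rewrite E0 eqn_add2l eqn_pmul2r // => /eqP E.
have H := IH (fun i => a (lift ord0 i)) (fun i => b (lift ord0 i))
  (fun i => aB _) (fun i => bB _) E.
by move=> i; case: (unliftP ord0 i) => [j ->|->] //; apply: H.
Qed.

(* Kronecker substitution [x_i = t ^ (B ^ i)]. *)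
Definition kron (B n : nat) (m : mpoly.multinom n) : nat := (\sum_i m i * B ^ i)%N.

Definition kron_poly {R : realType} (B n : nat) (s : seq (mpoly.multinom n))
    (c : mpoly.multinom n -> R) : {poly R} :=
  \sum_(m <- s) c m *: 'X^(kron B n m).

Lemma kron_inj (B n : nat) (m m' : mpoly.multinom n) :
  (forall i, (m i < B)%N) -> (forall i, (m' i < B)%N) ->
  kron B n m = kron B n m' -> m = m'.
Proof. by move=> mB m'B E; apply/mpoly.mnmP => i; apply: digits_inj E i. Qed.

Lemma kron_poly_coef {R : realType} (B n : nat) (s : seq (mpoly.multinom n))
    (c : mpoly.multinom n -> R) (m : mpoly.multinom n) :
  uniq s -> (forall m', m' \in s -> forall i, (m' i < B)%N) -> m \in s ->
  (kron_poly B n s c)`_(kron B n m) = c m.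
Proof.
move=> su sB ms; rewrite coef_sum (bigD1_seq m) //= coefZ coefXn eqxx mulr1.
rewrite big_seq_cond big1 ?addr0 // => m' /andP[m's m'm].
rewrite coefZ coefXn; case: eqP => [E|_]; last by rewrite mulr0.
by rewrite (kron_inj B n m m' (sB m ms) (sB m' m's) E) eqxx in m'm.
Qed.

Lemma kron_lt (B n : nat) (m : mpoly.multinom n) :
  (forall i, (m i < B)%N) -> (kron B n m < B ^ n)%N.
Proof.
rewrite /kron; move: (fun_of_multinom m) => a {m}.
elim: n a => [|n IH] a aB; first by rewrite big_ord0.
rewrite big_ord_recr /= expnSr.
have h := IH (fun i => a (widen_ord (leqnSn n) i)) (fun i => aB _).
have h2 : (a ord_max * B ^ n <= B.-1 * B ^ n)%N.
  by rewrite leq_mul2r; apply/orP; right; have := aB ord_max; case: (B).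
have B0 : (0 < B)%N by apply: leq_trans (aB ord_max).
rewrite -addSn; apply: leq_trans (leq_add h h2) _.
by rewrite -mulSn prednK // mulnC.
Qed.

Lemma size_kron_poly {R : realType} (B n : nat) (s : seq (mpoly.multinom n))
    (c : mpoly.multinom n -> R) :
  (forall m', m' \in s -> forall i, (m' i < B)%N) ->
  (size (kron_poly B n s c) <= B ^ n)%N.
Proof.
move=> sB; rewrite /kron_poly big_seq; elim/big_ind: _ => [|p q hp hq|m ms].
- by rewrite size_poly0.
- by apply: leq_trans (size_polyD _ _) _; rewrite geq_max hp hq.
- apply: leq_trans (size_scale_leq _ _) _; rewrite size_polyXn.
  exact/kron_lt/sB.
Qed.

Lemma exponent_lt {R : realType} (n d : nat) (p : mpoly n R) :
  (msize p <= d.+1)%N -> forall m, m \in msupp p -> forall i, (m i < d.+1)%N.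
Proof.
move=> dp m mp i; apply: leq_ltn_trans (_ : (mdeg m < _)%N).
  by rewrite mdegE (bigD1 i) //= leq_addr.
by apply: leq_trans dp; apply: msize_mdeg_lt.
Qed.

Lemma coef_norm_ge0 {R : realType} (n : nat) (p : mpoly n R) : 0 <= coef_norm p.
Proof. by apply: sumr_ge0. Qed.

(** Kronecker substitution turns p into a univariate q of size at most N = (d+1)^n with the same
    coefficients, and maps [0, 1] into the unit cube. Interpolating q at the points j/N bounds the
    coefficients by values of p. *)
Lemma large_value (R : realType) (n d : nat) : exists c0 : R, 0 < c0 /\
  forall p : mpoly n R, (msize p <= d.+1)%N ->
    exists2 z : 'rV[R]_n, ucube R n z & c0 * coef_norm p <= `|ev n z p|.
Proof.
pose N := (d.+1 ^ n)%N; have N0 : (0 < N)%N by rewrite expn_gt0.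
pose delta : R := N%:R^-1; have d0 : 0 < delta by rewrite invr_gt0 ltr0n.
(* Lagrange's factor for q; the additional 1 makes the final contradiction strict. *)
pose C1 : R := 1 + (2 / delta) ^+ N.-1 / (N.-1)`!%:R * 2 ^+ N.-1.
have C10 : 0 < C1.
  by rewrite ltr_pwDl // mulr_ge0 ?divr_ge0 ?exprn_ge0 ?divr_ge0 // ltW.
pose C : R := N%:R * C1; have C0 : 0 < C by rewrite mulr_gt0 // ltr0n.
exists C^-1; split; first by rewrite invr_gt0.
move=> p dp; apply: contrapT => /forall2NP small.
have sB := exponent_lt n d p dp.
pose e := C^-1 * coef_norm p.
have e0 : 0 <= e by rewrite mulr_ge0 ?invr_ge0 ?(ltW C0) ?coef_norm_ge0.
pose q := kron_poly d.+1 n (msupp p) (fun m => mcoeff m p).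
have qE (t : R) : q.[t] = ev n (\row_i t ^+ (d.+1 ^ i)) p.
  rewrite horner_sum /ev mevalE; apply: eq_bigr => m _.
  rewrite hornerZ hornerXn /kron -prodrXr; congr (_ * _).
  by apply: eq_bigr => i _; rewrite mxE mulnC exprM.
have qsmall (t : R) : 0 <= t <= 1 -> `|q.[t]| < e.
  move=> /andP[t0 t1]; rewrite qE ltNge; apply/negP => h.
  have [//|/(_ h)//] := small (\row_i t ^+ (d.+1 ^ i)).
  by apply=> i; rewrite mxE exprn_ge0 //= exprn_ile1.
have e1 : 0 < e by apply: le_lt_trans (qsmall 0 _); rewrite ?normr_ge0 // lexx ler01.
pose x (j : nat) : R := j%:R * delta.
have x01 j : (j <= N.-1)%N -> 0 <= x j <= 1.
  move=> jN; rewrite mulr_ge0 ?(ltW d0) //= /x /delta ler_pdivrMr ?ltr0n //.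
  by rewrite mul1r ler_nat; apply: leq_trans jN (leq_pred _).
have gx : gapped N.-1 delta x.
  move=> i j _ _; rewrite /x -mulrBl normrM (gtr0_norm d0); exact: lexx.
have sq : (size q <= N.-1.+1)%N by rewrite prednK //; apply: size_kron_poly.
pose b := e * ((2 / delta) ^+ N.-1 / (N.-1)`!%:R * 2 ^+ N.-1).
have qb r : `|q`_r| <= b.
  have := @interpolation_bound R N.-1 delta 0 e x q d0 gx sq _ _ r.
  rewrite addr0 comp_polyXr => H; apply: le_trans (H _ _) _.
  - move=> j jN; rewrite sub0r normrN; have /andP[a1 a2] := x01 j jN.
    by rewrite ger0_norm.
  - by move=> j jN; apply/ltW/qsmall/x01.
  have -> : e * 'C(N.-1, r)%:R * (2 / delta) ^+ N.-1 / (N.-1)`!%:R =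
    e * ((2 / delta) ^+ N.-1 / (N.-1)`!%:R * 'C(N.-1, r)%:R) by ring.
  rewrite ler_wpM2l // ler_wpM2l ?bin_le_exp2 // divr_ge0 // exprn_ge0 //.
  by rewrite divr_ge0 // ltW.
have b0 : 0 <= b by apply: le_trans (qb 0%N).
have sN : (size (msupp p) <= N)%N.
  rewrite -(size_map (kron d.+1 n)) -(size_iota 0 N); apply: uniq_leq_size.
    rewrite map_inj_in_uniq ?msupp_uniq // => m m' mp m'p.
    by apply: kron_inj; [exact: sB|exact: sB].
  move=> _ /mapP[m mp ->]; rewrite mem_iota add0n /=; exact/kron_lt/sB.
have : coef_norm p <= N%:R * b.
  apply: (@le_trans _ _ (\sum_(m <- msupp p) b)).
    rewrite /coef_norm big_seq [leRHS]big_seq; apply: ler_sum => m mp.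
    by rewrite -(kron_poly_coef d.+1 n (msupp p) (fun m => mcoeff m p) m) ?msupp_uniq.
  by rewrite big_const_seq count_predT iter_addr_0 -[b *+ _]mulr_natl ler_wpM2r // ler_nat.
have -> : coef_norm p = N%:R * (e * C1).
  by rewrite /e /C; field; rewrite !gt_eqF // ltr0n.
rewrite ler_pM2l ?ltr0n // /b ler_pM2l // /C1 leNgt.
by rewrite addrC ltrDl ltr01.
Qed.

(** * Smallness of sublevel sets of polynomials *)

Lemma pick_indices (P : pred nat) (M k : nat) :
  (k < \sum_(i < M) P i)%N -> exists f : nat -> nat,
    (forall i, (i <= k)%N -> (f i < M)%N /\ P (f i)) /\
    (forall i j, (i < j)%N -> (j <= k)%N -> (f i < f j)%N).
Proof.
pose s := [seq j <- iota 0 M | P j].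
have -> : (\sum_(i < M) P i)%N = size s.
  rewrite size_filter -sum1_count [RHS]big_mkcond /= -(big_mkord xpredT (fun i => nat_of_bool (P i))).
  by rewrite /index_iota subn0; apply: eq_bigr => i _; case: (P i).
move=> ks; exists (nth 0%N s); split=> [i ik|i j ij jk].
  have : nth 0%N s i \in s by apply: mem_nth; apply: leq_ltn_trans ks.
  by rewrite mem_filter mem_iota add0n => /andP[Pf /andP[_ fM]].
have ss : sorted ltn s by apply: sorted_filter; [exact: ltn_trans|exact: iota_ltn_sorted].
apply: (sorted_ltn_nth ltn_trans 0%N ss) => //; rewrite inE.
  by apply: ltn_trans ij _; apply: leq_ltn_trans ks.
exact: leq_ltn_trans ks.
Qed.

Lemma gapped_affine {R : realType} (k : nat) (f : nat -> nat) (alpha beta : R) :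
  0 <= beta -> (forall i j, (i < j)%N -> (j <= k)%N -> (f i < f j)%N) ->
  gapped k beta (fun i => alpha + beta * (f i)%:R).
Proof.
move=> b0 finc.
have le i j : (i <= j)%N -> (j <= k)%N -> (f i <= f j)%N.
  by rewrite leq_eqVlt => /predU1P[-> //|ij] jk; apply/ltnW/finc.
have dist i j : (i <= j)%N -> (j <= k)%N -> (j - i <= f j - f i)%N.
  elim: j => [|j IH]; first by rewrite leqn0 => /eqP ->; rewrite subnn.
  rewrite leq_eqVlt => /predU1P[<-|ij] jk; first by rewrite subnn.
  have h1 := IH ij (ltnW jk); have h2 := finc j j.+1 (ltnSn j) jk.
  have h3 := le i j ij (ltnW jk).
  move: h1 h2 h3 ij; move: (f j) (f j.+1) (f i); clear; lia.
have main i j : (i <= j)%N -> (j <= k)%N ->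
    `|i%:R - j%:R| * beta <= `|alpha + beta * (f i)%:R - (alpha + beta * (f j)%:R)|.
  move=> ij jk.
  have -> : alpha + beta * (f i)%:R - (alpha + beta * (f j)%:R) =
    - (beta * ((f j)%:R - (f i)%:R)) by ring.
  rewrite normrN [`|i%:R - _|]distrC -(natrB R ij) -(natrB R (le i j ij jk)).
  rewrite normrM (ger0_norm b0) !normr_nat.
  by rewrite mulrC ler_wpM2l // ler_nat dist.
move=> i j ik jk; have [ij|/ltnW ji] := leqP i j; first exact: main.
by rewrite distrC [leRHS]distrC; apply: main.
Qed.

(* Substitution of univariate polynomials, [T i k] standing for the [k]-th
   power of the [i]-th variable. *)
Definition psub {R : realType} (n : nat) (p : mpoly n R)
    (T : 'I_n -> nat -> {poly R}) : {poly R} :=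
  \sum_(m <- msupp p) mcoeff m p *: \prod_(i < n) T i (m i).

Lemma size_psub {R : realType} (n d : nat) (p : mpoly n R)
    (T : 'I_n -> nat -> {poly R}) :
  (msize p <= d.+1)%N -> (forall i k, (size (T i k) <= k.+1)%N) ->
  (size (psub n p T) <= d.+1)%N.
Proof.
move=> dp sT; rewrite /psub big_seq; elim/big_ind: _ => [|q r hq hr|m mp].
- by rewrite size_poly0.
- by apply: leq_trans (size_polyD _ _) _; rewrite geq_max hq hr.
apply: leq_trans (size_scale_leq _ _) _; apply: leq_trans (size_prod_leq _ _) _.
apply: (@leq_trans ((\sum_(i < n) (m i).+1).+1 - n)%N).
  by rewrite card_ord leq_sub2r // ltnS; apply: leq_sum.
rewrite -[X in (_ <= X)%N]/(d.+1); under eq_bigr do rewrite -addn1.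
rewrite big_split /= sum1_card card_ord -addSn addnK -mdegE.
exact: leq_trans (msize_mdeg_lt mp) dp.
Qed.

Lemma volume_dilate {R : realType} (n : nat) (a : 'rV[R]_n.+1) (s : R)
    (A : set 'rV[R]_n.+1) : 0 < s -> (lebesgue_n A < +oo)%E ->
  (lebesgue_n (dilate n.+1 a s A) < +oo)%E /\
  volume (dilate n.+1 a s A) = s ^- n.+1 * volume A.
Proof.
move=> s0 Afin; have E := lebesgue_n_dilate n a s A s0.
by rewrite /volume E (volume_fin n.+1 A Afin) -EFinM /= ltry.
Qed.

Lemma ucube_box (R : realType) (n : nat) :
  ucube R n = box (0, const_mx 1).
Proof. by apply/seteqP; split=> x xu i; have := xu i; rewrite !mxE. Qed.

Lemma ucube_measurable (R : realType) (n : nat) : lebesgue_measurable (ucube R n.+1).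
Proof. by rewrite ucube_box; apply: box_measurable. Qed.

(** The set on the right is a preimage of A [&] S, where S is the image of the cube under the
    homothety of centre z and ratio s. By convexity S lies in the cube, and by Bernoulli's
    inequality the rest of the cube has volume at most (n+1) kappa. *)
Lemma volume_shrink {R : realType} (n : nat) (z : 'rV[R]_n.+1) (A : set 'rV[R]_n.+1)
    (s kappa : R) :
  ucube R n.+1 z -> A `<=` ucube R n.+1 -> 0 < s -> 1 - kappa <= s <= 1 ->
  0 <= kappa <= 1 ->
  volume A - n.+1%:R * kappa <=
  volume (ucube R n.+1 `&` dilate n.+1 ((1 - s) *: z) s A).
Proof.
move=> zu Au s0 /andP[ks s1] /andP[k0 k1].
pose a := (1 - s) *: z; have si0 : 0 < s^-1 by rewrite invr_gt0.
pose S := dilate n.+1 (- s^-1 *: a) s^-1 (ucube R n.+1).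
have SM : lebesgue_measurable S by apply: dilate_measurable => //; apply: ucube_measurable.
have ufin := sub_ucube_fin n _ (@subset_refl _ (ucube R n.+1)).
have Afin := sub_ucube_fin n A Au.
have Su : S `<=` ucube R n.+1.
  move=> y; rewrite /S /dilate /= => ys i; have := ys i; rewrite !mxE.
  have -> : - s^-1 * ((1 - s) * z 0 i) + s^-1 * y 0 i =
     s^-1 * (y 0 i - (1 - s) * z 0 i) by ring.
  rewrite mulrC ler_pdivlMr // ler_pdivrMr // mul0r mul1r => /andP[h1 h2].
  have /andP[z0 z1] := zu i.
  have b1 : 0 <= (1 - s) * z 0 i by rewrite mulr_ge0 // subr_ge0.
  have b2 : (1 - s) * z 0 i <= 1 - s by rewrite ler_piMr // subr_ge0.
  by apply/andP; split; lra.
have E : ucube R n.+1 `&` dilate n.+1 a s A = dilate n.+1 a s (A `&` S).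
  rewrite setIC; apply/seteqP; split=> x [h1 h2]; split=> //.
    rewrite /S /dilate /=.
    by rewrite scalerDr !scalerA mulNr mulVf ?gt_eqF // scale1r addrA scaleNr addNr add0r.
  move: h2; rewrite /S /dilate /=.
  by rewrite scalerDr !scalerA mulNr mulVf ?gt_eqF // scale1r addrA scaleNr addNr add0r.
have ASfin : (lebesgue_n (A `&` S) < +oo)%E.
  by apply: sub_ucube_fin => x [/Au].
rewrite E (volume_dilate n a s _ s0 ASfin).2.
have sn : 1 - n.+1%:R * kappa <= s ^+ n.+1.
  apply: (@le_trans _ _ ((1 - kappa) ^+ n.+1)); last by rewrite lerXn2r ?nnegrE ?subr_ge0 // ltW.
  elim: n.+1 => [|k IH]; first by rewrite expr0; lra.
  rewrite exprS -natr1 mulrDl mul1r.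
  have k10 : 0 <= 1 - kappa by rewrite subr_ge0.
  apply: le_trans (ler_wpM2l k10 IH).
  have : 0 <= k%:R * kappa * kappa by rewrite !mulr_ge0.
  move: (k%:R * kappa) => u; lra.
have s1n : 1 <= s ^- n.+1.
  by rewrite invf_ge1 ?exprn_gt0 // exprn_ile1 // ltW.
apply: (@le_trans _ _ (volume (A `&` S))); last first.
  by rewrite ler_peMl // volume_ge0.
rewrite (volume_split n.+1 A S Afin SM).
have h1 : volume (A `&` ~` S) <= volume (ucube R n.+1 `&` ~` S).
  apply: volume_le; first by apply: sub_ucube_fin => x [].
  by move=> x [/Au].
have := volume_split n.+1 _ S ufin SM.
have -> : ucube R n.+1 `&` S = S by apply/setIidr.
have -> : volume S = s ^+ n.+1 * volume (ucube R n.+1).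
  by rewrite /S (volume_dilate n _ _ _ si0 ufin).2 exprVn invrK.
have u1 := volume_ucube R n; have u0 := volume_ge0 n.+1 (ucube R n.+1).
have snu : (1 - n.+1%:R * kappa) * volume (ucube R n.+1) <= s ^+ n.+1 * volume (ucube R n.+1).
  by rewrite ler_wpM2r.
have nk : n.+1%:R * kappa * volume (ucube R n.+1) <= n.+1%:R * kappa.
  by rewrite ler_piMr // mulr_ge0.
move: h1 snu nk; rewrite mulrBl mul1r.
set vu := volume (ucube R n.+1); set vus := volume (ucube R n.+1 `&` ~` S).
set vas := volume (A `&` ~` S); set va := volume (A `&` S).
move: (s ^+ n.+1 * vu) (n.+1%:R * kappa * vu) (n.+1%:R * kappa).
by move: vu vus vas va => v1 v2 v3 v4 w1 w2 w3; lra.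
Qed.

Definition line_poly {R : realType} (n : nat) (z x : 'rV[R]_n) (i : 'I_n) : {poly R} :=
  (z 0 i)%:P + (x 0 i - z 0 i) *: 'X.

Lemma size_line_poly {R : realType} (n : nat) (z x : 'rV[R]_n) (i : 'I_n) :
  (size (line_poly n z x i) <= 2)%N.
Proof.
apply: leq_trans (size_polyD _ _) _; rewrite geq_max.
rewrite (leq_trans (size_polyC_leq1 _)) //.
by apply: leq_trans (size_scale_leq _ _) _; rewrite size_polyX.
Qed.

Lemma psub_line {R : realType} (n : nat) (p : mpoly n R) (z x : 'rV[R]_n) (s : R) :
  (psub n p (fun i k => line_poly n z x i ^+ k)).[s] =
  ev n ((1 - s) *: z + s *: x) p.
Proof.
rewrite horner_sum /ev mevalE; apply: eq_bigr => m _.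
rewrite hornerZ horner_prod; congr (_ * _); apply: eq_bigr => i _.
by rewrite horner_exp /line_poly !hornerE !mxE; congr (_ ^+ _); ring.
Qed.

Lemma size_psub_line {R : realType} (n d : nat) (p : mpoly n R) (z x : 'rV[R]_n) :
  (msize p <= d.+1)%N ->
  (size (psub n p (fun i k => line_poly n z x i ^+ k)) <= d.+1)%N.
Proof.
move=> dp; apply: size_psub => // i k; apply: leq_trans (size_poly_exp_leq _ _) _.
rewrite ltnS -[leqRHS]mul1n leq_mul2r; apply/orP; right.
by have := size_line_poly n z x i; case: size => [|[|[|]]].
Qed.

(** Take z where |p| is large. If the sublevel set were not small, its homothetic copies with centre
    z and ratios near 1 would overlap so much that some x lies in more than d of them. On the
    segment from z to x, p would then be small at d + 1 spaced points, hence small at z. *)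
Lemma sublevel_small {R : realType} (n d : nat) (eta : R) : 0 < eta ->
  exists c : R, 0 < c /\ forall p : mpoly n.+1 R, (msize p <= d.+1)%N ->
    0 < coef_norm p ->
    volume [set y | ucube R n.+1 y /\ `|ev n.+1 y p| <= c * coef_norm p] <= eta.
Proof.
move=> eta0.
pose eta' := Num.min eta 1.
have eta'0 : 0 < eta' by rewrite lt_min eta0 ltr01.
have eta'1 : eta' <= 1 by rewrite ge_min lexx orbT.
have eta'e : eta' <= eta by rewrite ge_min lexx.
have N0 : 0 < n.+1%:R :> R by rewrite ltr0n.
have N1 : 1 <= n.+1%:R :> R by rewrite ler1n.
pose kappa := eta' / (2 * n.+1%:R).
have k0 : 0 < kappa by rewrite divr_gt0 // mulr_gt0.
have nk : n.+1%:R * kappa = eta' / 2 by rewrite /kappa; field; rewrite gt_eqF.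
have k1 : kappa <= 2^-1.
  by rewrite ler_pdivrMr ?mulr_gt0 // mulrA mulVf // mul1r (le_trans eta'1).
(* M' copies, each of volume at least eta'/2, have total volume above d. *)
pose M' := (Num.truncn (2 * d%:R / eta')).+1.
have M'0 : 0 < M'%:R :> R by rewrite ltr0n.
have M'eta : d%:R < M'%:R * (eta' / 2).
  have : 2 * d%:R / eta' < M'%:R by apply: truncnS_gt.
  by rewrite ltr_pdivrMr // => h; lra.
pose beta := kappa / M'%:R; have b0 : 0 < beta by rewrite divr_gt0.
pose s (j : nat) : R := 1 - kappa + beta * j%:R.
have sk j : 1 - kappa <= s j by rewrite lerDl mulr_ge0 // ltW.
have s0 j : 0 < s j by apply: lt_le_trans (sk j); lra.
have s1 j : (j <= M')%N -> s j <= 1.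
  move=> jM; rewrite /s -lerBrDl opprB addrCA subrr addr0 /beta mulrAC.
  by rewrite ler_pdivrMr // ler_wpM2l ?(ltW k0) // ler_nat.
have [c0 [c00 large]] := large_value R n.+1 d.
pose CL := (2 / beta) ^+ d / d`!%:R.
have CL0 : 0 <= CL by rewrite divr_ge0 // exprn_ge0 // divr_ge0 // ltW.
(* Chosen so that the interpolation bound 2 c CL stays below c0. *)
pose c := c0 / (2 * (CL + 1)).
have c1 : 0 < c by rewrite divr_gt0 // mulr_gt0 // ltr_wpDl.
exists c; split=> // p dp p0.
have [z zu zp] := large p dp.
set A := [set y | _]; rewrite leNgt; apply/negP => Abig.
(* Overlap counting calls for measurable sets. The grid boxes that meet A form such a set A', and
   the mesh 1/M is so fine that the bound on |p| at most doubles there. *)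
pose M := (Num.truncn (d%:R / c)).+1.
have M0 : 0 < M%:R :> R by rewrite ltr0n.
have dM : d%:R / M%:R <= c.
  have : d%:R / c < M%:R by apply: truncnS_gt.
  by rewrite ltr_pdivrMr // => /ltW h; rewrite ler_pdivrMr // mulrC.
pose G (w : {ffun 'I_n.+1 -> 'I_M}) := box (grid_box R n.+1 M w).
have Gu w : G w `<=` ucube R n.+1.
  move=> y yw i; have := yw i; rewrite !mxE => /andP[h1 h2].
  rewrite (le_trans _ h1) ?divr_ge0 //= (le_trans h2) // ler_pdivrMr // mul1r.
  by rewrite ler_nat ltn_ord.
pose F w := if pselect (exists y, (A `&` G w) y) then G w else set0.
pose A' := \big[setU/set0]_w F w.
have A'P y : A' y <-> exists2 w, G w y & exists y', (A `&` G w) y'.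
  rewrite /A' -bigcup_seq; split=> [[w _]|[w Gy H]].
    by rewrite /F; case: pselect => // H Gy; exists w.
  by exists w => /=; [rewrite mem_index_enum|rewrite /F; case: pselect].
have A'M : lebesgue_measurable A'.
  apply: (big_ind (@lebesgue_measurable R n.+1)) => [|B C|w _].
  - exact: caratheodory_measurable_set0.
  - exact: caratheodory_measurable_setU.
  rewrite /F; case: pselect => h; first exact: box_measurable.
  exact: caratheodory_measurable_set0.
have A'u : A' `<=` ucube R n.+1 by move=> y /A'P[w /Gu].
have AA' : A `<=` A'.
  move=> y Ay; apply/A'P; have [w yw] := ucube_grid n.+1 M y isT Ay.1.
  by exists w => //; exists y.
have A'small y : A' y -> `|ev n.+1 y p| <= 2 * c * coef_norm p.
  move=> A'y; have yu := A'u y A'y; have /A'P[w Gy [y' [[y'u y'A] Gy']]] := A'y.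
  have h i : `|y 0 i - y' 0 i| <= M%:R^-1.
    have := Gy i; have := Gy' i; rewrite !mxE -natr1 mulrDl mul1r.
    move=> /andP[u1 u2] /andP[v1 v2].
    by rewrite ler_norml; apply/andP; split; lra.
  have Mi0 : 0 <= M%:R^-1 :> R by rewrite invr_ge0 ltW.
  have := ev_lipschitz R n.+1 d p dp y' y _ y'u yu Mi0 h.
  have cd : coef_norm p * (d%:R / M%:R) <= c * coef_norm p.
    by rewrite mulrC ler_wpM2r // ltW.
  move=> /le_trans/(_ cd) h1.
  have := ler_normD (ev n.+1 y p - ev n.+1 y' p) (ev n.+1 y' p).
  rewrite subrK => h2; apply: le_trans h2 _.
  have := lerD h1 y'A; rewrite -mulrDl.
  by have -> : c + c = 2 * c by ring.
have A'vol : eta' < volume A'.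
  apply: le_lt_trans eta'e _; apply: lt_le_trans Abig _.
  by apply: volume_le => //; apply: sub_ucube_fin.
pose B j := dilate n.+1 ((1 - s j) *: z) (s j) A'.
have BM j : lebesgue_measurable (B j) by apply: dilate_measurable.
have ufin := sub_ucube_fin n _ (@subset_refl _ (ucube R n.+1)).
have [few|/existsNP[x /not_implyP[xu /negP]]] := pselect
    (forall x, ucube R n.+1 x -> (multiplicity n.+1 B M' x <= d)%N).
  have := multiplicity_le n B M' d _ BM ufin few; apply/negP; rewrite -ltNge.
  apply: (@le_lt_trans _ _ d%:R); first by rewrite ler_piMr // volume_ucube.
  apply: lt_le_trans M'eta _.
  rewrite -[M' in M'%:R]card_ord -sum1_card natr_sum mulr_suml.
  apply: ler_sum => j _; rewrite mul1r.
  have sj : 1 - kappa <= s j <= 1 by rewrite sk s1 // ltnW.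
  have kk : 0 <= kappa <= 1 by rewrite (ltW k0) (le_trans k1) // invf_le1 // ler1n.
  have := volume_shrink n z A' (s j) kappa zu A'u (s0 j) sj kk.
  rewrite nk => h; apply: le_trans h; rewrite lerBrDr -splitr.
  exact: ltW.
rewrite -ltnNge => many.
have [f [fP finc]] := pick_indices (fun j => x \in B j) M' d many.
pose g := psub n.+1 p (fun i k => line_poly n.+1 z x i ^+ k).
pose nodes i := 1 - kappa + beta * (f i)%:R.
have gx : gapped d beta nodes by apply: gapped_affine => //; apply: ltW.
have := @interpolation_bound R d beta 0 (2 * c * coef_norm p) nodes g b0 gx
  (size_psub_line n.+1 d p z x dp) _ _ 0%N.
rewrite addr0 comp_polyXr -horner_coef0 psub_line subr0 scale1r scale0r addr0.
rewrite bin0 mulr1 => H.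
have {}H : `|ev n.+1 z p| <= 2 * c * coef_norm p * CL.
  rewrite mulrA; apply: H => j jd; have [fM fB] := fP j jd.
    rewrite sub0r normrN ger0_norm; last exact/ltW/s0.
    by apply: s1; apply: ltnW.
  rewrite psub_line; apply: A'small; have := fB; rewrite inE.
  by [].
have := le_trans zp H.
have -> : 2 * c * coef_norm p * CL = 2 * c * CL * coef_norm p by ring.
rewrite ler_pM2r // leNgt => /negP; apply.
rewrite /c (_ : 2 * (c0 / (2 * (CL + 1))) * CL = c0 * (CL / (CL + 1))); last first.
  by field; rewrite gt_eqF // ltr_wpDl.
by rewrite gtr_pMr // ltr_pdivrMr ?ltr_wpDl // mul1r ltrDl.
Qed.

(** * Images under polynomial maps with a large Jacobian *)

Lemma msize_mderiv {R : realType} (n : nat) (i : 'I_n) (p : mpoly n R) :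
  (msize (mderiv i p) <= msize p)%N.
Proof.
rewrite {1}msizeE big_seq; apply/bigmax_leqP_seq => m _ mp.
have : (mpoly.mnm_add m (mnm1 i)) \in msupp p.
  move: mp; rewrite !mcoeff_msupp mcoeff_mderiv.
  by apply: contraNneq => ->; rewrite mul0rn.
by move=> /msize_mdeg_lt; rewrite mdegD mdeg1 addn1 => h; apply: ltnW.
Qed.

Lemma msize_prod_le {R : realType} (n d : nat) (I : Type) (r : seq I)
    (F : I -> mpoly n R) :
  (forall i, (msize (F i) <= d)%N) ->
  (msize (\prod_(i <- r) F i) <= (size r * d.+1).+1)%N.
Proof.
move=> Fd; elim: r => [|i r IH]; first by rewrite big_nil msize1.
rewrite big_cons; apply: leq_trans (msizeM_le _ _) _.
by have := Fd i; move: IH => /=; clear; lia.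
Qed.

Lemma msize_jacobian {R : realType} (n d : nat) (P : 'I_n -> mpoly n R) :
  (forall i, (msize (P i) <= d)%N) ->
  (msize (poly_jacobian P) <= (n * d.+1).+1)%N.
Proof.
move=> Pd; rewrite /poly_jacobian /determinant.
apply: leq_trans (mmeasure_sum _ _ _ _) _; apply/bigmax_leqP => s _.
have H : (msize (\prod_i (\matrix_(i, j) mderiv j (P i)) i (s i)) <= (n * d.+1).+1)%N.
  have := @msize_prod_le R n d 'I_n (index_enum 'I_n)
    (fun i => (\matrix_(i, j) mderiv j (P i)) i (s i)).
  rewrite -sum1_size big_const_ord iter_addn addn0 mul1n; apply=> i; rewrite mxE.
  exact: leq_trans (msize_mderiv _ _ _) (Pd i).
by case: (odd_perm s); rewrite ?expr1 ?expr0 ?mul1r ?mulN1r ?msizeN.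
Qed.

Lemma ev_jacobian {R : realType} (n : nat) (P : 'I_n -> mpoly n R) (y : 'rV[R]_n) :
  ev n y (poly_jacobian P) = \det (\matrix_(i, j) ev n y (mderiv j (P i))).
Proof.
rewrite /ev /poly_jacobian -(det_map_mx (meval (fun i => y 0 i))).
by congr (\det _); apply/matrixP => i j; rewrite !mxE.
Qed.

Lemma det_bound {R : realType} (n : nat) (A : 'M[R]_n) (E : R) :
  (forall i j, `|A i j| <= E) -> `|\det A| <= (n`!)%:R * E ^+ n.
Proof.
move=> AE; apply: le_trans (ler_norm_sum _ _ _) _.
rewrite -card_Sn -sum1_card natr_sum mulr_suml.
apply: ler_sum => s _; rewrite normrM normrX normrN1 expr1n !mul1r normr_prod.
rewrite -[n in E ^+ n]card_ord -prodr_const; apply: ler_prod => i _.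
by rewrite normr_ge0 AE.
Qed.

Lemma adjugate_bound {R : realType} (n : nat) (A : 'M[R]_n.+1) (E : R) :
  (forall i j, `|A i j| <= E) -> forall i j, `|(\adj A)%R i j| <= (n`!)%:R * E ^+ n.
Proof.
move=> AE i j; rewrite mxE /cofactor normrM normrX normrN1 expr1n mul1r.
by apply: det_bound => k l; rewrite !mxE.
Qed.

(** Cramer's rule in the form adj(A) A v = det(A) v. *)
Lemma inverse_bound {R : realType} (n : nat) (A : 'M[R]_n.+1) (E : R)
    (v : 'cV[R]_n.+1) (u : R) :
  (forall i j, `|A i j| <= E) -> (forall i, `|(A *m v) i 0| <= u) ->
  forall k, `|\det A| * `|v k 0| <= n.+1%:R * ((n`!)%:R * E ^+ n) * u.
Proof.
move=> AE vu k.
have -> : `|\det A| * `|v k 0| = `|(\adj A *m (A *m v)) k 0|.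
  by rewrite mulmxA mul_adj_mx mul_scalar_mx mxE normrM.
rewrite mxE; apply: le_trans (ler_norm_sum _ _ _) _.
rewrite -[X in X%:R]card_ord -sum1_card natr_sum !mulr_suml.
apply: ler_sum => i _; rewrite mul1r normrM ler_pM //.
exact: adjugate_bound.
Qed.

Lemma max_coord {R : realType} (n : nat) (v : 'I_n.+1 -> R) :
  exists k, forall i, `|v i| <= `|v k|.
Proof.
exists [arg max_(k > ord0) `|v k|]%O; case: (@Order.TotalTheory.arg_maxP) => // k _ kP i.
exact: kP.
Qed.

Lemma volume_setU {R : realType} (n : nat) (A B : set 'rV[R]_n.+1) :
  (lebesgue_n (A `|` B) < +oo)%E -> volume (A `|` B) <= volume A + volume B.
Proof.
move=> ABfin.
have Afin : (lebesgue_n A < +oo)%E.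
  by apply: le_lt_trans ABfin; apply: lebesgue_n_le; apply: subsetUl.
have Bfin : (lebesgue_n B < +oo)%E.
  by apply: le_lt_trans ABfin; apply: lebesgue_n_le; apply: subsetUr.
rewrite -lee_fin EFinD -!volume_fin //.
exact: (outer_measureU2 (@lebesgue_n R n.+1)).
Qed.

(** Off a small sublevel set the Jacobian determinant is at least c delta. On a sufficiently fine
    grid box the linear part then prevails over the Taylor remainder, so the map is injective there
    with an L-Lipschitz inverse. By pigeonhole some box keeps a fixed amount of A, and its image
    cannot be small since the inverse recovers that amount. *)
Lemma polynomial_image_volume {R : realType} (n d : nat) (delta C eta : R) :
  0 < delta -> 0 < C -> 0 < eta ->
  exists eps : R, 0 < eps /\ forall P : 'I_n.+1 -> mpoly n.+1 R,
    (forall i, (msize (P i) <= d.+1)%N) -> (forall i, coef_norm (P i) <= C) ->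
    delta <= coef_norm (poly_jacobian P) ->
    forall A : set 'rV[R]_n.+1, A `<=` ucube R n.+1 -> eta <= volume A ->
    (eps%:E <= lebesgue_n ((fun y => \row_i ev n.+1 y (P i)) @` A))%E.
Proof.
move=> delta0 C0 eta0.
have eta2 : 0 < eta / 2 by rewrite divr_gt0.
have [c [c0 small]] := sublevel_small n (n.+1 * d.+2) (eta / 2) eta2.
pose E := C * d%:R; pose Cc := n.+1%:R * ((n`!)%:R * E ^+ n) + 1.
have E0 : 0 <= E by rewrite mulr_ge0 // ltW.
have Cc0 : 0 < Cc by rewrite ltr_wpDl // !mulr_ge0 // exprn_ge0.
pose kap := c * delta; have kap0 : 0 < kap by rewrite mulr_gt0.
(* With this mesh the quadratic remainder contributes at most (kap/2) h and is absorbed. *)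
pose M := (Num.truncn (2 * Cc * (C * d%:R ^+ 2) / kap)).+1.
have M0 : 0 < M%:R :> R by rewrite ltr0n.
have MP : Cc * (C * d%:R ^+ 2) / M%:R <= kap / 2.
  have : 2 * Cc * (C * d%:R ^+ 2) / kap < M%:R by apply: truncnS_gt.
  by rewrite ltr_pdivrMr // => h; rewrite ler_pdivrMr //; lra.
(* If every box held at most v, A1 would have volume at most eta/4, less than eta/2. *)
pose v := eta / (4 * (M ^ n.+1)%:R).
have Mn0 : 0 < (M ^ n.+1)%:R :> R by rewrite ltr0n expn_gt0.
have v0 : 0 < v by rewrite divr_gt0 // mulr_gt0.
pose L := 2 * Cc / kap; have L0 : 0 < L by rewrite divr_gt0 // mulr_gt0.
pose T := (2 * L) ^+ n.+1; have T0 : 0 < T by rewrite exprn_gt0 // mulr_gt0.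
exists (v / T); split=> [|P Pd PC Pj A Au Aeta]; first by rewrite divr_gt0.
set J := poly_jacobian P in Pj.
have Jd : (msize J <= (n.+1 * d.+2).+1)%N by apply: msize_jacobian.
have J0 : 0 < coef_norm J by apply: lt_le_trans Pj.
have {}small := small J Jd J0.
set S := [set y | _] in small.
pose A1 := A `&` ~` S.
have A1u : A1 `<=` ucube R n.+1 by move=> y [/Au].
have A1J y : A1 y -> kap <= `|ev n.+1 y J|.
  move=> [Ay nS]; have yu := Au y Ay.
  have h : c * coef_norm J < `|ev n.+1 y J| by rewrite ltNge; apply/negP => h; apply: nS.
  by apply: ltW; apply: le_lt_trans h; rewrite /kap ler_wpM2l // ltW.
have A1v : eta / 2 <= volume A1.
  have ASu : A1 `|` S `<=` ucube R n.+1 by move=> y [/A1u|[]].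
  have := volume_setU n A1 S (sub_ucube_fin n _ ASu).
  have : volume A <= volume (A1 `|` S).
    apply: volume_le; first exact: sub_ucube_fin.
    by move=> y Ay; have [Sy|nSy] := pselect (S y); [right|left].
  by move: small Aeta; clear; lra.
have [z zv] : exists z : {ffun 'I_n.+1 -> 'I_M},
    v < volume (A1 `&` box (grid_box R n.+1 M z)).
  apply: contrapT => /forallNP h.
  have := grid_pigeonhole n M A1 v isT A1u.
  move=> /(_ (fun z => _)) h'; have {}h' : volume A1 <= (M ^ n.+1)%:R * v.
    by apply: h' => z; rewrite leNgt; apply/negP; apply: h.
  have := le_trans A1v h'.
  have -> : (M ^ n.+1)%:R * v = eta / 4 by rewrite /v; field; rewrite gt_eqF.
  by move: eta0; clear; lra.
set F := A1 `&` box _ in zv.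
have Fu : F `<=` ucube R n.+1 by move=> y [/A1u].
pose Rm (y : 'rV[R]_n.+1) : 'rV[R]_n.+1 := \row_i ev n.+1 y (P i).
have inv (y y' : 'rV[R]_n.+1) (D : R) : F y -> F y' ->
    (forall i, `|Rm y' 0 i - Rm y 0 i| <= D) -> forall i, `|y' 0 i - y 0 i| <= L * D.
  move=> Fy Fy' yD.
  have [k km] := max_coord n (fun i => y' 0 i - y 0 i).
  set h := `|_| in km.
  have h0 : 0 <= h by apply: normr_ge0.
  have hM : h <= M%:R^-1.
    have [_ /(_ k)] := Fy; have [_ /(_ k)] := Fy'.
    rewrite /h !mxE -natr1 mulrDl mul1r; clear=> /andP[u1 u2] /andP[v1 v2].
    by rewrite ler_norml; apply/andP; split; lra.
  pose B := \matrix_(i, j) ev n.+1 y (mderiv j (P i)).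
  pose dv : 'cV[R]_n.+1 := \col_i (y' 0 i - y 0 i).
  have BE i j : `|B i j| <= E.
    rewrite mxE; apply: le_trans (ev_mderiv_bound R n.+1 d (P i) (Pd i) y j (Fu y Fy)) _.
    by rewrite ler_wpM2r.
  have Bu i : `|(B *m dv) i 0| <= D + C * (d%:R * h) ^+ 2.
    have t := ev_taylor2 R n.+1 d (P i) (Pd i) y y' h (Fu y Fy) (Fu y' Fy') h0 km.
    have e : (B *m dv) i 0 = \sum_j ev n.+1 y (mderiv j (P i)) * (y' 0 j - y 0 j).
      by rewrite mxE; apply: eq_bigr => j _; rewrite !mxE.
    rewrite -e in t; have yDi := yD i; rewrite !mxE in yDi.
    have h2 : coef_norm (P i) * (d%:R * h) ^+ 2 <= C * (d%:R * h) ^+ 2.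
      by rewrite ler_wpM2r // sqr_ge0.
    move: t yDi h2; set a := ev _ _ _ - _; set b := (B *m dv) i 0.
    move: (coef_norm _ * _) (C * _) => X Y; clear.
    rewrite !ler_norml => /andP[u1 u2] /andP[v1 v2] w.
    by apply/andP; split; lra.
  have := inverse_bound n B E dv _ BE Bu k.
  rewrite -ev_jacobian -/J mxE -/h => H.
  have kh : kap * h <= Cc * (D + C * (d%:R * h) ^+ 2).
    apply: le_trans (ler_wpM2r h0 (A1J y Fy.1)) _; apply: le_trans H _.
    rewrite /Cc [leRHS]mulrDl lerDl mul1r.
    have := Bu ord0; apply: le_trans; exact: normr_ge0.
  have h2 : C * (d%:R * h) ^+ 2 <= C * d%:R ^+ 2 / M%:R * h.
    have -> : C * (d%:R * h) ^+ 2 = C * d%:R ^+ 2 * h * h by ring.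
    have -> : C * d%:R ^+ 2 / M%:R * h = C * d%:R ^+ 2 * h * M%:R^-1 by ring.
    by rewrite ler_wpM2l // !mulr_ge0 // ?(ltW C0) // exprn_ge0.
  have h3 : Cc * (C * (d%:R * h) ^+ 2) <= kap / 2 * h.
    apply: le_trans (ler_wpM2l (ltW Cc0) h2) _.
    by rewrite !mulrA ler_wpM2r //; move: MP; rewrite !mulrA.
  have h4 : h <= L * D.
    have H2 : kap * h <= 2 * Cc * D by move: kh h3; rewrite mulrDr; lra.
    have -> : L * D = 2 * Cc * D / kap by rewrite /L; ring.
    by rewrite ler_pdivlMr // mulrC.
  by move=> i; apply: le_trans h4; exact: km.
(* A right inverse by choice. It recovers F because [inv] with D = 0 is injectivity. *)
have [psi psiP] : {psi : 'rV[R]_n.+1 -> 'rV[R]_n.+1 &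
    forall x, (Rm @` F) x -> F (psi x) /\ Rm (psi x) = x}.
  apply: (@choice _ _ (fun x y => (Rm @` F) x -> F y /\ Rm y = x)) => x.
  have [[y Fy yx]|nx] := pselect ((Rm @` F) x); first by exists y.
  by exists 0.
have psiF : psi @` (Rm @` F) = F.
  apply/seteqP; split=> [_ [x /psiP[h _] <-] //|y Fy].
  have Ry : (Rm @` F) (Rm y) by exists y.
  exists (Rm y) => //; have [Fp e] := psiP _ Ry.
  have /inv H : forall i, `|Rm (psi (Rm y)) 0 i - Rm y 0 i| <= 0.
    by move=> i; rewrite e subrr normr0.
  apply/rowP => i; apply/eqP; rewrite -subr_eq0 -normr_eq0 eq_le normr_ge0 andbT.
  by have := H Fy Fp i; rewrite mulr0.
have := @lipschitz_image R n (Rm @` F) psi L L0.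
rewrite psiF => /(_ _) h.
have {}h : (lebesgue_n F <= T%:E * lebesgue_n (Rm @` F))%E.
  apply: h => x1 x2 /psiP[F1 e1] /psiP[F2 e2] D xD; apply: inv => // i.
  by rewrite e1 e2.
apply: (@le_trans _ _ (lebesgue_n (Rm @` F))); last first.
  by apply: lebesgue_n_le => _ [y [[Ay _] _] <-]; exists y.
have : (v%:E <= T%:E * lebesgue_n (Rm @` F))%E.
  apply: le_trans h; rewrite (volume_fin n.+1 F) ?lee_fin ?(ltW zv) //.
  exact: sub_ucube_fin.
by rewrite EFinM -lee_pdivrMl // muleC.
Qed.

(** * Coordinatewise roots *)

Definition rootv {R : realType} (n q : nat) (x : 'rV[R]_n) : 'rV[R]_n :=
  \row_i (x 0 i `^ (q%:R^-1)).

Definition powv {R : realType} (n q : nat) (y : 'rV[R]_n) : 'rV[R]_n :=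
  \row_i (y 0 i ^+ q).

Lemma powR_root {R : realType} (q : nat) (x : R) : (1 <= q)%N -> 0 <= x ->
  (x `^ (q%:R^-1)) ^+ q = x.
Proof.
by move=> q1 x0; rewrite -powR_mulrn ?powR_ge0 // -powRrM mulVf ?powRr1 // pnatr_eq0 -lt0n.
Qed.

Lemma rootv_ucube {R : realType} (n q : nat) (x : 'rV[R]_n) :
  ucube R n x -> ucube R n (rootv n q x).
Proof.
move=> xu i; have /andP[x0 x1] := xu i; rewrite mxE powR_ge0 /=.
apply: (@le_trans _ _ (1 `^ (q%:R^-1))); last by rewrite powR1.
by rewrite ge0_ler_powR // ?nnegrE // ?invr_ge0.
Qed.

Lemma rootvK {R : realType} (n q : nat) (x : 'rV[R]_n) : (1 <= q)%N ->
  ucube R n x -> powv n q (rootv n q x) = x.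
Proof.
move=> q1 xu; apply/rowP => i; rewrite !mxE powR_root //.
by have /andP[] := xu i.
Qed.

Lemma powv_lipschitz {R : realType} (n q : nat) (y y' : 'rV[R]_n) (D : R) :
  ucube R n y -> ucube R n y' -> (forall i, `|y 0 i - y' 0 i| <= D) ->
  forall i, `|powv n q y 0 i - powv n q y' 0 i| <= q%:R * D.
Proof.
move=> yu y'u yD i; rewrite !mxE subrXX mulrC normrM.
have /andP[a0 a1] := yu i; have /andP[b0 b1] := y'u i.
apply: ler_pM => //; apply: le_trans (ler_norm_sum _ _ _) _.
rewrite -[X in X%:R]card_ord -sum1_card natr_sum; apply: ler_sum => j _.
by rewrite normrM !normrX !ger0_norm // mulr_ile1 ?exprn_ge0 ?exprn_ile1.
Qed.

(** F is the image of its set of roots under the power map, which is Lipschitz on the cube; the root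
    map itself need not be. *)
Lemma root_pullback {R : realType} (n q : nat) (F : set 'rV[R]_n.+1) :
  (1 <= q)%N -> F `<=` ucube R n.+1 ->
  volume F <= (2 * q%:R) ^+ n.+1 * volume (rootv n.+1 q @` F).
Proof.
move=> q1 Fu.
have Gu : rootv n.+1 q @` F `<=` ucube R n.+1.
  by move=> _ [x /Fu xu <-]; apply: rootv_ucube.
rewrite -lee_fin EFinM -!volume_fin ?sub_ucube_fin //.
have := @lipschitz_image R n (rootv n.+1 q @` F) (powv n.+1 q) q%:R.
rewrite ltr0n q1 => /(_ isT) h.
have e : powv n.+1 q @` (rootv n.+1 q @` F) = F.
  apply/seteqP; split=> [_ [_ [x Fx <-] <-]|x Fx].
    by rewrite rootvK //; apply: Fu.
  by exists (rootv n.+1 q x); [exists x|rewrite rootvK //; apply: Fu].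
rewrite e in h; apply: h => x y /Gu xu /Gu yu D; exact: powv_lipschitz.
Qed.

(** A polynomial bounded on a set of fixed volume cannot have large coefficients, because its
    sublevel sets relative to the coefficient norm are small. This bounds the coefficients of R_w
    uniformly in w. *)
Lemma root_coef_bound {R : realType} (n d q : nat) (delta C : R) :
  (1 <= q)%N -> 0 < delta -> 0 < C ->
  exists Cf : R, 0 < Cf /\ forall (p : mpoly n.+1 R) (F : set 'rV[R]_n.+1),
    (msize p <= d.+1)%N -> F `<=` ucube R n.+1 -> delta <= volume F ->
    (forall x, F x -> `|ev n.+1 (rootv n.+1 q x) p| <= C) -> coef_norm p <= Cf.
Proof.
move=> q1 delta0 C0; pose Q : R := (2 * q%:R) ^+ n.+1.
have Q0 : 0 < Q by rewrite exprn_gt0 // mulr_gt0 // ltr0n.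
have eta0 : 0 < delta / (2 * Q) by rewrite divr_gt0 // mulr_gt0.
have [c [c0 small]] := sublevel_small n d _ eta0.
exists (C / c); split=> [|p F dp Fu Fd FC]; first exact: divr_gt0.
rewrite leNgt; apply/negP => big.
have p0 : 0 < coef_norm p by apply: lt_trans big; rewrite divr_gt0.
have Gu : rootv n.+1 q @` F `<=` ucube R n.+1.
  by move=> _ [x /Fu xu <-]; apply: rootv_ucube.
have := small p dp p0; set S := [set y | _] => Ssmall.
have GS : volume (rootv n.+1 q @` F) <= volume S.
  apply: volume_le; first by apply: sub_ucube_fin => y [].
  move=> y Gy; split; first exact: Gu.
  case: Gy => x Fx <-; apply: le_trans (FC x Fx) _.
  by apply: ltW; rewrite mulrC -ltr_pdivrMr.
have := le_trans Fd (root_pullback n q F q1 Fu); rewrite -/Q leNgt => /negP; apply.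
apply: le_lt_trans (ler_wpM2l (ltW Q0) (le_trans GS Ssmall)) _.
have -> : Q * (delta / (2 * Q)) = delta / 2 by field; rewrite gt_eqF.
by move: delta0; clear; lra.
Qed.

Lemma root_image_volume {R : realType} (n d q : nat) (delta C eta : R) :
  (1 <= q)%N -> 0 < delta -> 0 < C -> 0 < eta ->
  exists eps : R, 0 < eps /\ forall P : 'I_n.+1 -> mpoly n.+1 R,
    (forall i, (msize (P i) <= d.+1)%N) -> (forall i, coef_norm (P i) <= C) ->
    delta <= coef_norm (poly_jacobian P) ->
    forall F : set 'rV[R]_n.+1, F `<=` ucube R n.+1 -> eta <= volume F ->
    (eps%:E <= lebesgue_n ((fun x => \row_i ev n.+1 (rootv n.+1 q x) (P i)) @` F))%E.
Proof.
move=> q1 delta0 C0 eta0; pose Q : R := (2 * q%:R) ^+ n.+1.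
have Q0 : 0 < Q by rewrite exprn_gt0 // mulr_gt0 // ltr0n.
have eta'0 : 0 < eta / Q by rewrite divr_gt0.
have [eps [eps0 H]] := polynomial_image_volume n d delta C _ delta0 C0 eta'0.
exists eps; split=> // P Pd PC Pj F Fu Feta.
have Gu : rootv n.+1 q @` F `<=` ucube R n.+1.
  by move=> _ [x /Fu xu <-]; apply: rootv_ucube.
have := H P Pd PC Pj _ Gu; rewrite image_comp; apply.
rewrite ler_pdivrMr // mulrC; apply: le_trans Feta _; exact: root_pullback.
Qed.

(** * Uniform bounds for admissible collections *)

Lemma coord_le_norm {R : realType} (n : nat) (x : 'rV[R]_n.+1) (i : 'I_n.+1) :
  `|x 0 i| <= `|x|.
Proof.
rewrite /Num.norm /= mx_normrE.
exact: (@le_bigmax_cond _ _ _ _ (0, i) _ (fun ij => `|x ij.1 ij.2|)).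
Qed.

Lemma compact_coord_bound {R : realType} (n : nat) (K : set 'rV[R]_n.+1) :
  compact K -> exists C : R, 0 < C /\ forall x, K x -> forall i, `|x 0 i| <= C.
Proof.
move=> /compact_bounded [C0 [_ KC]].
exists (Num.max C0 0 + 1); split; first by rewrite ltr_wpDl // le_max lexx orbT.
move=> x Kx i; apply: le_trans (coord_le_norm _ _ _) _.
by apply: (KC (Num.max C0 0 + 1)) => //; rewrite ltr_pwDr // le_max lexx.
Qed.

Lemma admissible_image_volume {R : realType} (n d q : nat) (T : Type) (W : set T)
    (KW : T -> set 'rV[R]_n.+1) (Ups : T -> 'rV[R]_n.+1 -> 'rV[R]_n.+1)
    (P : T -> 'I_n.+1 -> mpoly n.+1 R) (delta1 delta2 C eta : R) :
  0 < delta1 -> 0 < delta2 -> (1 <= q)%N -> 0 < C -> 0 < eta ->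
  (forall w, W w -> KW w `<=` ucube R n.+1) ->
  (forall w, W w -> delta1 <= volume (KW w)) ->
  (forall w i, W w -> (msize (P w i) <= d.+1)%N) ->
  (forall w, W w -> delta2 <= coef_norm (poly_jacobian (P w))) ->
  (forall w x, W w -> KW w x ->
     Ups w x = \row_i ev n.+1 (rootv n.+1 q x) (P w i)) ->
  (forall w x i, W w -> KW w x -> `|Ups w x 0 i| <= C) ->
  exists eps : R, 0 < eps /\ forall w F, W w -> F `<=` KW w -> eta <= volume F ->
    (eps%:E <= lebesgue_n (Ups w @` F))%E.
Proof.
move=> d10 d20 q1 C0 eta0 KWu KW1 Pd PJ UpsE UpsC.
have [Cf [Cf0 HCf]] := root_coef_bound n d q delta1 C q1 d10 C0.
have [eps [eps0 H]] := root_image_volume n d q delta2 Cf eta q1 d20 Cf0 eta0.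
exists eps; split=> // w F Ww FK Feta.
have PC i : coef_norm (P w i) <= Cf.
  apply: (HCf (P w i) (KW w)) => //; [exact: Pd|exact: KWu|exact: KW1|].
  by move=> x Kx; have := UpsC w x i Ww Kx; rewrite UpsE // mxE.
have := H (P w) (fun i => Pd w i Ww) PC (PJ w Ww) F (subset_trans FK (KWu w Ww)) Feta.
rewrite (_ : _ @` F = Ups w @` F) //.
by apply: eq_imagel => x Fx; rewrite UpsE //; apply: FK.
Qed.

(** * Polynomial curves in admissible sets *)

Lemma mpoly_ucube_eq0 {R : realType} (n : nat) (p : mpoly n R) :
  (forall y : 'rV[R]_n, ucube R n y -> ev n y p = 0) -> p = 0.
Proof.
move=> p0.
have [c [c0 H]] := large_value R n (msize p).
have [z zu] := H p (leqnSn _); rewrite p0 // normr0 pmulr_rle0 // => h.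
apply/mpolyP => m; rewrite mcoeff0.
have [mp|/memN_msupp_eq0 //] := boolP (m \in msupp p).
have := h; rewrite /coef_norm (bigD1_seq m) ?msupp_uniq //= => h'.
apply/eqP; rewrite -normr_le0; apply: le_trans h'.
by rewrite lerDl sumr_ge0.
Qed.

(** A univariate polynomial in the i-th variable, so that exponents not divisible by q can be
    detected on coefficients. *)
Definition slice {R : realType} (n : nat) (p : mpoly n R) (i : 'I_n)
    (y : 'rV[R]_n) : {poly R} :=
  \sum_(m <- msupp p) (mcoeff m p * \prod_(l < n | l != i) y 0 l ^+ m l) *: 'X^(m i).

Lemma slice_horner {R : realType} (n : nat) (p : mpoly n R) (i : 'I_n)
    (y : 'rV[R]_n) (s : R) : (slice n p i y).[s] = ev n (set_coord y i s) p.
Proof.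
rewrite /slice horner_sum /ev mevalE; apply: eq_bigr => m _.
rewrite hornerZ hornerXn -mulrA; congr (_ * _).
rewrite [RHS](bigD1 i) //= !mxE eqxx mulrC; congr (_ * _).
by apply: eq_bigr => l li; rewrite !mxE (negbTE li).
Qed.

Lemma poly_eq_ge0 {R : realType} (p q : {poly R}) :
  (forall s, 0 <= s -> p.[s] = q.[s]) -> p = q.
Proof.
move=> pq; apply/eqP; rewrite -subr_eq0; apply/negPn/negP => r0.
have := @max_poly_roots R (p - q) [seq (k%:R : R) | k <- iota 0 (size (p - q))] r0.
rewrite size_map size_iota ltnn => h; have : false; last by [].
apply: h; last by rewrite map_inj_uniq ?iota_uniq // => a b /eqP; rewrite eqr_nat => /eqP.
apply/allP => _ /mapP[k _ ->].
by rewrite rootE hornerD hornerN pq ?ler0n // subrr.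
Qed.

(** In direction i, P_j is a polynomial in s^q. If q does not divide m_i, its coefficient of s^(m_i)
    therefore vanishes wherever the other variables lie in the unit interval; up to a power of the
    i-th variable this coefficient is p', so p' = 0. *)
Lemma polynomial_in_dvdn {R : realType} (n q : nat) (Ups : 'rV[R]_n -> 'rV[R]_n)
    (P : 'I_n -> mpoly n R) (i : 'I_n) : (1 <= q)%N ->
  (forall x, orthant x -> Ups x = \row_j ev n (rootv n q x) (P j)) ->
  polynomial_in i Ups ->
  forall j m, m \in msupp (P j) -> (q %| m i)%N.
Proof.
move=> q1 UpsE pol j m mp; apply/negPn/negP => ndvd.
pose p' : mpoly n R := \sum_(k <- msupp (P j) | k i == m i) mcoeff k (P j) *: mpolyX R k.
have p'0 : p' = 0.
  apply: mpoly_ucube_eq0 => y yu.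
  pose x : 'rV[R]_n := powv n q y.
  have xo : orthant x by move=> l; rewrite mxE exprn_ge0 //; have /andP[] := yu l.
  have [g gP] := pol j x xo.
  have sE : slice n (P j) i y = g \Po 'X^q.
    apply: poly_eq_ge0 => s s0; rewrite slice_horner horner_comp hornerXn.
    rewrite -gP ?exprn_ge0 // UpsE => [|l]; last first.
      by rewrite !mxE; case: eqP => _; rewrite exprn_ge0 //; have /andP[] := yu l.
    rewrite mxE; congr (ev _ _ _); apply/rowP => l; rewrite !mxE.
    have rt t : 0 <= t -> t = (t ^+ q) `^ q%:R^-1.
      move=> t0; rewrite -powR_mulrn // -powRrM mulfV ?powRr1 // pnatr_eq0 -lt0n.
      exact: q1.
    by case: eqP => _; rewrite -rt //; have /andP[] := yu l.
  have cz : (slice n (P j) i y)`_(m i) = 0.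
    by rewrite sE coef_comp_poly_Xn // (negbTE ndvd).
  rewrite /ev /p' raddf_sum /= -[RHS](mulr0 (y 0 i ^+ m i)) -[in RHS]cz /slice coef_sum.
  rewrite mulr_sumr big_mkcond /=; apply: eq_bigr => k _.
  rewrite coefZ coefXn eq_sym; case: eqP => [e|_]; last by rewrite !mulr0.
  rewrite mulr1 mevalZ mevalX (bigD1 i) //= e; ring.
have := congr1 (mcoeff m) p'0; rewrite mcoeff0 /p' raddf_sum /=.
rewrite big_mkcond /= (bigD1_seq m) ?msupp_uniq //= eqxx mcoeffZ mcoeffX eqxx mulr1.
rewrite big1 ?addr0 => [|k km].
  by apply/eqP; rewrite -mcoeff_msupp.
by case: ifP => // _; rewrite mcoeffZ mcoeffX (negbTE km) mulr0.
Qed.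

(** In a coordinate where Ups is polynomial, every exponent k is a multiple of q, and the k-th power
    of the root is (a_i + s^q (x_i - a_i))^(k/q). In the others a_i = 0, and the root of s^q x_i is
    s times the root of x_i. In both cases exponent k gives degree at most k in s, so the total
    degree stays at most d. *)
Lemma star_curve {R : realType} (n d q : nat) (Ups : 'rV[R]_n -> 'rV[R]_n)
    (P : 'I_n -> mpoly n R) (a x : 'rV[R]_n) : (1 <= q)%N ->
  (forall i, (msize (P i) <= d.+1)%N) ->
  (forall x, orthant x -> Ups x = \row_j ev n (rootv n q x) (P j)) ->
  (forall i, ~ polynomial_in i Ups -> a 0 i = 0) ->
  ucube R n a -> ucube R n x ->
  exists c : 'I_n -> {poly R}, (forall i, (size (c i) <= d.+1)%N) /\
    forall s, 0 <= s <= 1 -> curve n c s = Ups (a + s ^+ q *: (x - a)).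
Proof.
move=> q1 Pd UpsE a0 au xu.
(* In the polynomial case the division [k %/ q] is exact for every exponent that occurs. *)
pose T (i : 'I_n) (k : nat) : {poly R} :=
  if pselect (polynomial_in i Ups) then
    ((a 0 i)%:P + (x 0 i - a 0 i) *: 'X^q) ^+ (k %/ q)
  else ((x 0 i `^ q%:R^-1) *: 'X) ^+ k.
exists (fun j => psub n (P j) T); split=> [j|s /andP[s0 s1]].
  apply: size_psub => // i k; rewrite /T; case: pselect => ? /=.
    apply: (leq_trans (size_poly_exp_leq _ _)); rewrite ltnS.
    apply: (@leq_trans (q * (k %/ q))); last by rewrite mulnC leq_trunc_div.
    rewrite leq_mul2r; apply/orP; right.
    have : (size ((a 0 i)%:P + (x 0 i - a 0 i) *: 'X^q)%R <= q.+1)%N.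
      apply: leq_trans (size_polyD _ _) _; rewrite geq_max size_polyC.
      apply/andP; split; first by case: (_ != 0).
      by apply: leq_trans (size_scale_leq _ _) _; rewrite size_polyXn.
    by case: size.
  apply: (leq_trans (size_poly_exp_leq _ _)); rewrite ltnS -[leqRHS]mul1n leq_mul2r.
  apply/orP; right; have := size_scale_leq (x 0 i `^ q%:R^-1) ('X : {poly R}).
  by rewrite size_polyX; case: size => [|[|[|]]].
have sq : 0 <= s ^+ q <= 1 by rewrite exprn_ge0 // exprn_ile1.
have zu : ucube R n (a + s ^+ q *: (x - a)).
  move=> i; rewrite !mxE; have /andP[u1 u2] := au i; have /andP[v1 v2] := xu i.
  by have /andP[t0 t1] := sq; apply/andP; split; nra.
rewrite UpsE => [|i]; last by have /andP[] := zu i.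
apply/rowP => j; rewrite !mxE /psub horner_sum /ev mevalE.
rewrite big_seq [RHS]big_seq; apply: eq_bigr => m mp.
rewrite hornerZ; congr (_ * _); rewrite horner_prod; apply: eq_bigr => i _.
rewrite /T; case: pselect => [pol|npol]; rewrite !horner_exp !hornerE !mxE.
  have dv := polynomial_in_dvdn n q Ups P i q1 UpsE pol j m mp.
  rewrite -{2}(divnK dv) mulnC exprM powR_root //.
    by rewrite mulrC.
  by have := zu i; rewrite !mxE => /andP[].
rewrite a0 // subr0 add0r; congr (_ ^+ _).
have /andP[x0 _] := xu i.
rewrite powRM // ?exprn_ge0 // -(powR_mulrn q s0) -powRrM mulfV ?powRr1 //.
  by rewrite mulrC.
by rewrite pnatr_eq0 -lt0n.
Qed.

(** * Well-spaced points on a line or curve *)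

Lemma multiplicityC {R : realType} (n : nat) (B : nat -> set 'rV[R]_n.+1) (M : nat)
    (x : 'rV[R]_n.+1) :
  (\sum_(i < M) (x \notin B i) + multiplicity n.+1 B M x = M)%N.
Proof.
rewrite /multiplicity -big_split /= -[RHS]card_ord -sum1_card.
by apply: eq_bigr => i _; case: (x \in B i).
Qed.

Lemma gapped_le {R : realType} (k : nat) (delta delta' : R) (x : nat -> R) :
  delta' <= delta -> gapped k delta x -> gapped k delta' x.
Proof.
move=> dd g i j ik jk; apply: le_trans (g i j ik jk).
by rewrite ler_wpM2l.
Qed.

(** For a ratio s_j >= 1/2, the points x sent into the hull H of F have volume at most 2^(q (n+1))
    |H|. As F is small, some x is bad for at most k + 1 of the 2(k + 1) ratios; the remaining ones
    are nodes. *)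
Lemma star_nodes {R : realType} (n q k : nat) (X F : set 'rV[R]_n.+1)
    (a : 'rV[R]_n.+1) (delta : R) :
  (1 <= k)%N -> 0 < delta -> star_shaped X a -> X `<=` ucube R n.+1 ->
  delta <= volume X -> F `<=` X -> volume F < delta / (4 * 2 ^+ (q * n.+1)) ->
  exists (x : 'rV[R]_n.+1) (s : nat -> R), [/\ X x,
    gapped k (8^-1 / k%:R) s, forall i, (i < k)%N -> s i < s i.+1,
    forall i, (i <= k)%N -> 0 < s i < 1 &
    forall i, (i <= k)%N -> (X `\` F) (a + s i ^+ q *: (x - a))].
Proof.
move=> k1 delta0 star Xu Xd FX Fsmall.
pose Q : R := 2 ^+ (q * n.+1); have Q0 : 0 < Q by rewrite exprn_gt0.
rewrite -/Q in Fsmall.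
have e0 : 0 < delta / (8 * Q) by rewrite divr_gt0 // mulr_gt0.
have [H [HM FH Hfin Hv]] := measurable_hull n F _
  (sub_ucube_fin n F (subset_trans FX Xu)) e0.
have {}Hv : 2 * Q * volume H < delta.
  have : volume H < delta / (4 * Q) + delta / (8 * Q).
    by apply: le_lt_trans Hv _; rewrite ltrD2r.
  move=> h; apply: (@lt_trans _ _ (2 * Q * (delta / (4 * Q) + delta / (8 * Q)))).
    by rewrite ltr_pM2l // mulr_gt0.
  have -> : 2 * Q * (delta / (4 * Q) + delta / (8 * Q)) = delta * (3 / 4).
    by field; rewrite gt_eqF.
  by move: delta0; clear; lra.
pose M := (2 * k.+1)%N.
have M0 : 0 < M%:R :> R by rewrite ltr0n.
(* This is 1/(4 (k+1)), at least the required 1/(8k). *)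
pose beta : R := (2 * M%:R)^-1; have beta0 : 0 < beta by rewrite invr_gt0 mulr_gt0.
pose s j : R := 2^-1 + beta * j%:R.
have s2 j : 2^-1 <= s j by rewrite lerDl mulr_ge0 // ltW.
have s0 j : 0 < s j by apply: lt_le_trans (s2 j).
have s1 j : (j < M)%N -> s j < 1.
  move=> jM; have : beta * j%:R < 2^-1.
    have -> : 2^-1 = beta * M%:R by rewrite /beta invfM -mulrA mulVf ?mulr1 // gt_eqF.
    by rewrite ltr_pM2l // ltr_nat.
  by rewrite /s; clear; lra.
pose B j := dilate n.+1 ((1 - s j ^+ q) *: a) (s j ^+ q) H.
have BE j x : B j x = H (a + s j ^+ q *: (x - a)).
  rewrite /B /dilate /=; congr H; apply/rowP => i; rewrite !mxE; ring.
have BM j : lebesgue_measurable (B j) by apply: dilate_measurable; rewrite ?exprn_gt0.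
have Xfin : (lebesgue_n X < +oo)%E by apply: sub_ucube_fin.
have Bv j : volume (X `&` B j) <= Q * volume H.
  have [Bfin Bv] := volume_dilate n ((1 - s j ^+ q) *: a) (s j ^+ q) H
    (exprn_gt0 _ (s0 j)) Hfin.
  apply: (@le_trans _ _ (volume (B j))); first exact: volume_le.
  rewrite Bv ler_wpM2r ?volume_ge0 // -exprM -exprVn lerXn2r ?nnegrE ?invr_ge0 ?(ltW (s0 j)) //.
  by rewrite -[leRHS]invrK lef_pV2 ?posrE.
have [x [Xx few]] : exists x, X x /\ (multiplicity n.+1 B M x <= k.+1)%N.
  apply: contrapT => /forallNP none.
  have := multiplicity_ge n B M k.+2 X BM Xfin; apply/not_implyP; split.
    by move=> x Xx; rewrite ltnNge; apply/negP => h; apply: (none x).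
  apply/negP; rewrite -ltNge; apply: (@le_lt_trans _ _ (M%:R * (Q * volume H))).
    rewrite -[X in X%:R]card_ord -sum1_card natr_sum mulr_suml.
    by apply: ler_sum => j _; rewrite mul1r.
  apply: (@lt_le_trans _ _ (k.+2%:R * delta)); last by rewrite ler_wpM2l.
  have -> : M%:R * (Q * volume H) = k.+1%:R * (2 * Q * volume H).
    by rewrite /M natrM; ring.
  have -> : k.+2%:R * delta = k.+1%:R * delta + delta by rewrite -[k.+2%:R]natr1; ring.
  by rewrite ltr_wpDr ?(ltW delta0) // ltr_pM2l // ltr0n.
have good : (k < \sum_(i < M) (x \notin B i))%N.
  by move: few (multiplicityC n B M x); rewrite /M; clear; lia.
have [f [fP finc]] := pick_indices (fun i => x \notin B i) M k good.
exists x, (fun i => s (f i)); split=> //.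
- apply: gapped_le (gapped_affine k f 2^-1 beta (ltW beta0) finc).
  rewrite /beta -invfM lef_pV2 ?posrE ?mulr_gt0 // ?ltr0n //.
  by rewrite -!natrM ler_nat /M; move: k1; clear; lia.
- by move=> i ik; rewrite ltrD2l ltr_pM2l // ltr_nat finc.
- by move=> i ik; have [fM _] := fP i ik; rewrite s0 s1.
move=> i ik; have [fM fB] := fP i ik.
split; last first.
  move=> /FH; rewrite -BE => h; move/negP: fB; apply; exact: mem_set.
apply: star => //; rewrite exprn_ge0 ?(ltW (s0 _)) //= exprn_ile1 ?(ltW (s0 _)) //.
exact/ltW/s1.
Qed.

(** Dilated from w by the factors 1/s_j in (1, 2], the copies of E stay in a cube of side 4 D, and
    each has volume at least |E|. With more than (k+2)/c copies some x lies in k + 2 of them. The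
    last one provides the end point y in E, so that convexity will keep the segment in L; the others
    provide the k + 1 nodes. *)
Lemma ray_nodes {R : realType} (n k : nat) (E : set 'rV[R]_n.+1)
    (w : 'rV[R]_n.+1) (D : R) :
  (1 <= k)%N -> 0 < D -> lebesgue_measurable E ->
  (forall y, E y -> forall i, `|y 0 i - w 0 i| <= D) -> 0 < volume E ->
  let c := volume E / (4 * D) ^+ n.+1 in c <= 1 /\
  exists (y : 'rV[R]_n.+1) (s : nat -> R), [/\ E y,
    gapped k (c / 8 / k%:R) s, forall i, (i < k)%N -> s i < s i.+1,
    forall i, (i <= k)%N -> 0 < s i < 1 &
    forall i, (i <= k)%N -> E (w + s i *: (y - w))].
Proof.
move=> k1 D0 EM ED E0 c.
pose V : R := (4 * D) ^+ n.+1; have V0 : 0 < V by rewrite exprn_gt0 // mulr_gt0.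
pose X := box ((\row_i (w 0 i - 2 * D))%R, (\row_i (w 0 i + 2 * D))%R).
have XV' : (lebesgue_n X <= V%:E)%E.
  apply: le_trans (lebesgue_n_box n.+1 _ isT) _; rewrite lee_fin /box_volume.
  have -> : V = \prod_(i < n.+1) (4 * D) by rewrite prodr_const card_ord.
  apply: ler_prod => i _.
  rewrite !mxE le_max lexx /= ge_max; move: D0 (w 0 i); clear=> D0 u.
  by apply/andP; split; lra.
have Xfin : (lebesgue_n X < +oo)%E by apply: le_lt_trans XV' (ltry _).
have XV : volume X <= V by rewrite -lee_fin -volume_fin.
have Efin : (lebesgue_n E < +oo)%E.
  apply: le_lt_trans Xfin; apply: lebesgue_n_le => y Ey i; rewrite !mxE.
  by have := ED y Ey i; rewrite ler_norml => /andP[]; move: D0; clear; move=> *; apply/andP; split; lra.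
have EV : volume E <= V.
  apply: le_trans XV; apply: volume_le => // y Ey i; rewrite !mxE.
  by have := ED y Ey i; rewrite ler_norml => /andP[]; move: D0; clear; move=> *; apply/andP; split; lra.
have c1 : c <= 1 by rewrite ler_pdivrMr // mul1r.
have c0 : 0 < c by rewrite divr_gt0.
split=> //.
(* M c lies between k + 2 and k + 3: enough for the overlap, while 1/(2M) >= c/(8k) because k + 3 <=
   4k. *)
pose M := (Num.truncn (k.+2%:R / c)).+1.
have M0 : 0 < M%:R :> R by rewrite ltr0n.
have Mlo : k.+2%:R < M%:R * c.
  have : k.+2%:R / c < M%:R by apply: truncnS_gt.
  by rewrite ltr_pdivrMr.
have Mhi : M%:R * c <= k.+3%:R.
  have : M%:R <= k.+2%:R / c + 1.
    rewrite /M -natr1 lerD2r; by have /andP[] := truncn_bounds (k.+2%:R / c) (divr_ge0 (ler0n R _) (ltW c0)).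
  move=> /(ler_wpM2r (ltW c0)) h; apply: le_trans h _.
  rewrite mulrDl divfK ?gt_eqF // mul1r -[k.+3%:R]natr1.
  by move: c1; clear; lra.
pose beta : R := (2 * M%:R)^-1; have beta0 : 0 < beta by rewrite invr_gt0 mulr_gt0.
pose s j : R := 2^-1 + beta * j%:R.
have s2 j : 2^-1 <= s j by rewrite lerDl mulr_ge0 // ltW.
have s0 j : 0 < s j by apply: lt_le_trans (s2 j).
have s1 j : (j < M)%N -> s j < 1.
  move=> jM; have : beta * j%:R < 2^-1.
    have -> : 2^-1 = beta * M%:R by rewrite /beta invfM -mulrA mulVf ?mulr1 // gt_eqF.
    by rewrite ltr_pM2l // ltr_nat.
  by rewrite /s; clear; lra.
pose B j := dilate n.+1 ((1 - s j) *: w) (s j) E.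
have BE j x : B j x = E (w + s j *: (x - w)).
  rewrite /B /dilate /=; congr E; apply/rowP => i; rewrite !mxE; ring.
have BM j : lebesgue_measurable (B j) by apply: dilate_measurable.
have BX j : B j `<=` X.
  move=> x; rewrite BE => /ED h i; have := h i.
  have -> : (w + s j *: (x - w)) 0 i - w 0 i = s j * (x 0 i - w 0 i) by rewrite !mxE; ring.
  rewrite !mxE normrM (gtr0_norm (s0 j)) => h'.
  have {}h' : 2^-1 * `|x 0 i - w 0 i| <= D.
    by apply: le_trans h'; rewrite ler_wpM2r.
  have : `|x 0 i - w 0 i| <= 2 * D by move: h'; clear; lra.
  by rewrite ler_norml => /andP[]; clear; move=> *; apply/andP; split; lra.
have Bv j : (j < M)%N -> volume E <= volume (X `&` B j).
  move=> jM; rewrite setIidr //.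
  have [_ ->] := volume_dilate n ((1 - s j) *: w) (s j) E (s0 j) Efin.
  rewrite ler_peMl ?volume_ge0 // invf_ge1 ?exprn_gt0 //.
  by rewrite exprn_ile1 ?(ltW (s0 j)) // ltW // s1.
have [x [Xx many]] : exists x, X x /\ (k.+1 < multiplicity n.+1 B M x)%N.
  apply: contrapT => /forallNP none.
  have := multiplicity_le n B M k.+1 X BM Xfin; apply/not_implyP; split.
    by move=> x Xx; rewrite leqNgt; apply/negP => h; apply: (none x).
  apply/negP; rewrite -ltNge; apply: (@lt_le_trans _ _ (M%:R * volume E)); last first.
    rewrite -[X in X%:R]card_ord -sum1_card natr_sum mulr_suml.
    by apply: ler_sum => j _; rewrite mul1r Bv.
  have -> : volume E = c * V by rewrite /c divfK // gt_eqF.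
  rewrite mulrA; apply: (@le_lt_trans _ _ (k.+1%:R * V)); first by rewrite ler_wpM2l.
  by rewrite ltr_pM2r //; apply: lt_trans Mlo; rewrite ltr_nat.
have [f [fP finc]] := pick_indices (fun i => x \in B i) M k.+1 many.
have fE i : (i <= k.+1)%N -> E (w + s (f i) *: (x - w)).
  by move=> ik; have [_] := fP i ik; rewrite inE BE.
pose S := s (f k.+1).
have S0 : 0 < S := s0 _.
have S1 : S < 1 by apply: s1; have [] := fP k.+1 (leqnn _).
(* Reparametrising by the end point divides the ratios by S < 1, which only widens the gaps. *)
exists (w + S *: (x - w)), (fun i => s (f i) / S); split.
- exact: fE.
- have finc' i j : (i < j)%N -> (j <= k)%N -> (f i < f j)%N.
    by move=> ij jk; apply: finc => //; apply: ltnW.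
  move=> i j ik jk; have := gapped_affine k f 2^-1 beta (ltW beta0) finc' i j ik jk.
  rewrite -/(s (f i)) -/(s (f j)) => h.
  rewrite -mulrBl normrM (gtr0_norm (_ : 0 < S^-1)) ?invr_gt0 //.
  apply: (@le_trans _ _ `|s (f i) - s (f j)|); last first.
    by rewrite ler_peMr // invf_ge1 // ltW.
  apply: le_trans h; rewrite ler_wpM2l // ler_pdivrMr ?ltr0n //.
  rewrite /beta [leRHS]mulrC ler_pdivlMr ?mulr_gt0 //.
  have k1R : 1 <= k%:R :> R by rewrite ler1n.
  move: Mhi k1R; rewrite -[k.+3%:R]natr1 -[k.+2%:R]natr1 -[k.+1%:R]natr1; clear.
  move: (k%:R : R) => z h1 h2.
  have -> : c / 8 * (2 * M%:R) = M%:R * c / 4 by field.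
  lra.
- move=> i ik; rewrite ltr_pM2r ?invr_gt0 // ltrD2l ltr_pM2l // ltr_nat.
  have i1 : (i.+1 <= k.+1)%N by move: ik; clear; lia.
  exact: finc.
- move=> i ik; rewrite divr_gt0 //= ltr_pdivrMr // mul1r.
  by rewrite ltrD2l ltr_pM2l // ltr_nat finc.
move=> i ik; have := fE i (leqW ik).
by congr E; apply/rowP => l; rewrite !mxE; field; rewrite gt_eqF.
Qed.

(** * The degree and the constants *)

Lemma admissible_weight_gt0 {R : realType} (mu : nat -> R) : admissible_weight mu ->
  forall j, (1 <= j)%N -> 0 < mu j.
Proof.
move=> [m1 mS]; elim=> // j IH _; case: j IH => // j IH.
by apply: lt_le_trans (mS _ _) => //; apply: IH.
Qed.

Lemma admissible_weight_homo {R : realType} (mu : nat -> R) : admissible_weight mu ->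
  forall i j, (1 <= i <= j)%N -> mu i <= mu j.
Proof.
move=> [m1 mS] i; elim=> [|j IH] /andP[i1 ij].
  by move: i1 ij; case: i.
move: ij; rewrite leq_eqVlt => /orP[/eqP->//|ij].
have ij' : (i <= j)%N := ij.
apply: le_trans (IH _) (mS j _); first by rewrite i1.
exact: leq_trans ij'.
Qed.

(** Here k is the largest index whose partial sum is below e, so the sum up to k + 1 reaches e,
    which is the time Bang's walk needs. As b < A, j0 >= 1 and hence k >= 1. *)
Lemma degree_spec {R : realType} (mu : nat -> R) (A a b : R) :
  admissible_weight mu -> admissible_tuple mu A a b -> b < A ->
  exists k, [/\ degree mu A a b = (2 * k)%N,
    (1 <= k)%N, (degree_start A b <= k)%N,
    1 <= bang_time k.+1 (fun j => a * mu j) (degree_start A b) &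
    A / b <= expR (degree_start A b)%:R].
Proof.
move=> muw [A0 a0 b0 H] bA.
have mu0 := admissible_weight_gt0 mu muw.
have Ab1 : 1 < A / b by rewrite ltr_pdivlMr // mul1r.
have ln0 : 0 < ln (A / b) by rewrite ln_gt0.
set j0 := degree_start A b in H *.
have j0E : ln (A / b) <= j0%:R.
  rewrite /j0 /degree_start max_r ?(ltW ln0) //.
  have c0 : 0 <= Num.ceil (ln (A / b)) by rewrite ceil_ge0; apply: lt_trans ln0.
  by rewrite pmulrn gez0_abs // ceil_ge.
have j01 : (1 <= j0)%N by rewrite -(ltr0n R); apply: lt_le_trans j0E.
pose s (k : nat) : R := \sum_(j0.+1 <= j < k.+1) (a * mu j)^-1.
have sS k : (j0 <= k)%N -> s k.+1 = s k + (a * mu k.+1)^-1.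
  by move=> jk; rewrite /s big_nat_recr.
have s_homo k l : (k <= l)%N -> s k <= s l.
  elim: l => [|l IH]; first by rewrite leqn0 => /eqP->.
  rewrite leq_eqVlt => /orP[/eqP->//|kl]; apply: le_trans (IH kl) _.
  have [jl|lj] := leqP j0 l.
    by rewrite sS // lerDl invr_ge0 mulr_ge0 ?(ltW a0) ?(ltW (mu0 _ _)).
  by rewrite /s !big_geq // ltnW.
have [n sn] : exists n, expR 1 <= s n.
  apply: contrapT => /forallNP none.
  move: H; apply/negP; rewrite -leNgt; apply: lime_le.
    apply: is_cvg_nneseries => j jj _; rewrite lee_fin invr_ge0.
    by apply/ltW/mu0; apply: leq_trans jj.
  apply: nearW => k; rewrite sumEFin lee_fin.
  have [kj|jk] := leqP k j0.+1.
    by rewrite big_geq // mulr_ge0 ?(ltW a0) // expR_ge0.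
  have : s k.-1 <= expR 1 by rewrite leNgt; apply/negP => /ltW; apply: none.
  rewrite /s prednK; last by apply: leq_trans jk.
  move=> h; rewrite -ler_pdivrMl //; apply: le_trans h.
  by rewrite mulr_sumr; apply: ler_sum => j _; rewrite invfM.
set S := [set k : nat | s k < expR 1].
have SE : degree mu A a b = (2 * Num.truncn (sup [set (k%:R : R) | k in S]))%N by [].
have Sub : has_ubound [set (k%:R : R) | k in S].
  exists n%:R => _ [k Sk <-]; rewrite ler_nat leqNgt; apply/negP => nk.
  by move: Sk; rewrite /S /= ltNge; apply/negP/negPn; apply: le_trans sn (s_homo _ _ (ltnW nk)).
have Sj0 : S j0 by rewrite /S /= /s big_geq // expR_gt0.
set sp := sup _ in SE.
have spj : j0%:R <= sp by apply: ub_le_sup => //; exists j0.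
have sp0 : 0 <= sp by apply: le_trans spj; apply: ler0n.
exists (Num.truncn sp); have jt : (j0 <= Num.truncn sp)%N by rewrite truncn_ge_nat.
split=> //; first exact: leq_trans jt.
  rewrite leNgt; apply/negP => lt1.
  have : S (Num.truncn sp).+1.
    rewrite /S /= -[ltRHS]mulr1 -ltr_pdivrMl ?expR_gt0 //.
    apply: le_lt_trans lt1; rewrite /bang_time /s mulr_sumr.
    by apply: ler_sum => j _; rewrite [leRHS]invfM.
  move=> St; have : (Num.truncn sp).+1%:R <= sp by apply: ub_le_sup => //; exists (Num.truncn sp).+1.
  by rewrite leNgt truncnS_gt.
apply: le_trans (_ : _ <= expR (ln (A / b))) _; last by rewrite ler_expR.
by rewrite lnK // posrE (lt_trans _ Ab1).
Qed.

Lemma weight_derivative_ge0 {R : realType} (mut : R -> R) (s : R) :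
  {in `[1, +oo[ &, {homo mut : s t / s <= t}} -> 1 <= s ->
  0 <= weight_derivative mut s.
Proof.
move=> mono s1.
have homo u v : 1 <= u -> u <= v -> mut u <= mut v.
  move=> u1 uv; apply: mono => //; rewrite in_itv /= andbT //.
  exact: le_trans uv.
have lim_ge0 (F : set_system R) (FF : ProperFilter F) (g : R -> R) :
    (\forall h \near F, 0 <= g h) -> 0 <= lim (g @ F).
  (* A limit that does not exist has the default value 0. *)
  move=> g0; have [cv|ncv] := pselect (cvg (g @ F)); first exact: limr_ge.
  by rewrite dvgP.
rewrite /weight_derivative; case: ltP => [s1'|_]; apply: lim_ge0.
  have e : 1 - s < 0 by rewrite subr_lt0.
  near=> h.
  have h0 : h < 0 by near: h; exact: nbhs_left_lt.
  have hs : 1 - s < h by near: h; exact: nbhs_left_gt.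
  rewrite mulr_le0 ?invr_le0 ?(ltW h0) // subr_le0; apply: homo.
    by rewrite -lerBlDl ltW.
  by rewrite gerDl ltW.
near=> h.
have h0 : 0 < h by near: h; exact: nbhs_right_gt.
by rewrite divr_ge0 ?(ltW h0) // subr_ge0 homo // lerDl ltW.
Unshelve. all: by end_near.
Qed.

Lemma gamma_weight_ge0 {R : realType} (mut : R -> R) (k : R) :
  (forall s, 1 <= s -> 0 < mut s) ->
  {in `[1, +oo[ &, {homo mut : s t / s <= t}} -> 0 <= gamma_weight mut k.
Proof.
move=> mut0 mono; rewrite /gamma_weight.
set X := [set _ | _ in _].
have [Xs|nX] := pselect (has_sup X); last by rewrite sup_out.
have [[x Xx] Xub] := Xs.
have h : x <= sup X := ub_le_sup Xub Xx.
apply: le_trans h.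
case: Xx => s; rewrite /= in_itv /= => /andP[s1 _] <-.
by rewrite divr_ge0 ?(ltW (mut0 s s1)) // mulr_ge0 ?weight_derivative_ge0 // (le_trans _ s1).
Qed.

(** For V = |K|, e = |E| and x = 1 - e/V one has ln x >= -e/(V - e) >= -e/e0, and 1 - x^nu <= -nu ln
    x. *)
Lemma powR_gap {R : realType} (V e e0 nu tau : R) :
  0 < e -> 0 < e0 -> e + e0 <= V -> 0 < nu -> nu * e / e0 <= tau ->
  V `^ nu - (V - e) `^ nu <= tau * V `^ nu.
Proof.
move=> ep e0p eV nu0 nut.
have V0 : 0 < V by apply: lt_le_trans eV; rewrite addr_gt0.
have Ve : e0 <= V - e by rewrite lerBrDl.
have Ve0 : 0 < V - e by apply: lt_le_trans Ve.
pose x := (V - e) / V; have x0 : 0 < x by rewrite divr_gt0.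
have -> : V - e = x * V by rewrite /x divfK // gt_eqF.
rewrite powRM ?(ltW x0) ?(ltW V0) // -{1}[V `^ nu]mul1r -mulrBl.
rewrite ler_wpM2r ?powR_ge0 // /powR gt_eqF //.
have lnx : - (e / e0) <= ln x.
  rewrite -[x]invrK lnV ?posrE ?invr_gt0 // lerN2.
  have -> : x^-1 = 1 + e / (V - e).
    by rewrite /x invf_div; field; rewrite gt_eqF.
  apply: le_trans (le_ln1Dx _) _; first by apply: lt_trans (_ : 0 < _); rewrite ?divr_gt0.
  by rewrite ler_wpM2l ?(ltW ep) // lef_pV2 ?posrE.
have h1 := expR_ge1Dx (nu * ln x).
have h2 : nu * - (e / e0) <= nu * ln x by rewrite ler_wpM2l // ltW.
move: h1 h2 nut; rewrite mulrN mulrA; clear; lra.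
Qed.

(** The power r^(2k) pays for (8 r^2)^k, and 2e <= (2e)^k reduces the rest to 64 e^3 <= 16 e^8, with
    e^(4 + gamma) >= e^4. *)
Lemma remez_constant {R : realType} (k m : nat) (r tau gamma : R) :
  (1 <= k)%N -> (1 <= m)%N -> 1 <= r -> 0 < tau -> tau^-1 <= 8 * r ^+ 2 ->
  0 <= gamma ->
  m%:R * (2 * expR 1 * (4 * expR 1 ^+ 2 / tau) ^+ k) <=
  (4 * expR (4 + gamma)) ^+ (2 * k) * (m%:R * r) ^+ (2 * k).
Proof.
move=> k1 m1 r1 tau0 taur g0.
pose e : R := expR 1; rewrite -/e.
have e2 : 2 <= e by have := expR_ge1Dx (1 : R); rewrite /e; lra.
have e0 : 0 < e by apply: lt_le_trans e2.
have m1R : 1 <= m%:R :> R by rewrite ler1n.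
have e0' := ltW e0; have r0 : 0 <= r by apply: le_trans r1.
have t0 : 0 <= tau^-1 by rewrite invr_ge0 ltW.
rewrite [(m%:R * r) ^+ _]exprMn [leRHS]mulrCA.
apply: ler_pM => //.
- by rewrite ?(mulr_ge0, exprn_ge0).
- by apply: ler_eXnr => //; move: k1; clear; lia.
apply: (@le_trans _ _ ((16 * e ^+ 8 * r ^+ 2) ^+ k)); last first.
  have -> : 16 * e ^+ 8 * r ^+ 2 = (4 * e ^+ 4 * r) ^+ 2 by ring.
  rewrite -exprM -[leRHS]exprMn; apply: lerXn2r.
  - by rewrite nnegrE ?(mulr_ge0, exprn_ge0).
  - by rewrite nnegrE ?(mulr_ge0, exprn_ge0, expR_ge0).
  rewrite ler_wpM2r // ler_wpM2l // /e -expRM_natl mulr1 ler_expR.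
  by move: g0; clear; lra.
apply: (@le_trans _ _ ((2 * e) ^+ k * (4 * e ^+ 2 / tau) ^+ k)).
  rewrite ler_wpM2r ?(mulr_ge0, exprn_ge0) //.
  by apply: ler_eXnr => //; move: e2; clear; lra.
rewrite -exprMn; apply: lerXn2r.
- by rewrite nnegrE ?(mulr_ge0, exprn_ge0).
- by rewrite nnegrE ?(mulr_ge0, exprn_ge0).
have -> : 2 * e * (4 * e ^+ 2 / tau) = 8 * e ^+ 3 * tau^-1 by ring.
apply: (@le_trans _ _ (8 * e ^+ 3 * (8 * r ^+ 2))).
  by rewrite ler_wpM2l ?(mulr_ge0, exprn_ge0).
have -> : 8 * e ^+ 3 * (8 * r ^+ 2) = 16 * r ^+ 2 * e ^+ 3 * 4 by ring.
have -> : 16 * e ^+ 8 * r ^+ 2 = 16 * r ^+ 2 * e ^+ 3 * e ^+ 5 by ring.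
rewrite ler_wpM2l ?(mulr_ge0, exprn_ge0) //.
have e1 : 1 <= e by move: e2; clear; lra.
apply: (@le_trans _ _ (e ^+ 2)); last exact: ler_weXn2l.
by have := mulr_ge0 e0' e0'; move: e2; rewrite expr2; clear; nra.
Qed.

(** * Remez inequality along a curve *)

(** For d >= 2, G is D times [markov_poly] with h = 1/(2 d^2). Then G(1/a) <= 10 d^2 D/a, at most
    1/2 if a >= 20 d^2 D, and the range 1/a <= h/10 of this estimate means a >= 20 d^2; hence max(D,
    1). *)
Lemma curve_majorant {R : realType} (n d : nat) (mu : nat -> R) (M0 a D : R)
    (c : 'I_n -> {poly R}) :
  (1 <= d)%N -> (forall i, (size (c i) <= d.+1)%N) ->
  (forall i s t, 0 <= s <= 1 -> 0 <= t <= 1 -> `|(c i).[t] - (c i).[s]| <= D) ->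
  0 <= D -> 0 < M0 -> (forall j, (1 <= j)%N -> j%:R <= mu j) -> 0 < a ->
  (if (2 <= d)%N then 20 * d%:R ^+ 2 * Num.max D 1 <= a else D <= a) ->
  exists G : {poly R}, [/\ G.[0] = 0, forall r, 0 <= G^`()`_r,
    forall i s, 0 <= s <= 1 -> dominated ((c i)^`() \Po ('X + s%:P)) G^`() &
    forall j, \sum_(l < j.+1) (j`!)%:R / (l`!)%:R * (G ^+ l)`_j * weight_bound mu M0 l <=
      a ^+ j * weight_bound mu M0 j].
Proof.
move=> d1 cd osc D0 M00 muj a0; case: ifP => [d2 Da|d2 Da].
  pose h : R := (2 * d%:R ^+ 2)^-1.
  have dR : 0 < d%:R :> R by rewrite ltr0n.
  have h0 : 0 < h by rewrite invr_gt0 mulr_gt0 // exprn_gt0.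
  have G0 := markov_poly_ge0 d h D h0 D0.
  have hi : h / 10 = (20 * d%:R ^+ 2)^-1 by rewrite /h; field; rewrite gt_eqF.
  have d20 : 0 < 20 * d%:R ^+ 2 :> R by rewrite mulr_gt0 // exprn_gt0.
  have DM : D <= Num.max D 1 by rewrite le_max lexx.
  have M1 : 1 <= Num.max D 1 by rewrite le_max lexx orbT.
  have a1 : 20 * d%:R ^+ 2 <= a by apply: le_trans Da; rewrite ler_peMr // ltW.
  have a2 : 20 * d%:R ^+ 2 * D <= a by apply: le_trans Da; rewrite ler_wpM2l // ltW.
  exists (D *: markov_poly d h); split.
  - apply/eqP; rewrite eq_le; apply/andP; split; last first.
      by rewrite horner_coef0 G0.
    have := markov_poly_horner d h 0 h0 (lexx _); rewrite mul0r mulr0.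
    move=> /(_ (divr_ge0 (ltW h0) _)) H; rewrite hornerZ mulr_ge0_le0 //.
    by apply: H.
  - by move=> r; rewrite coef_deriv mulrn_wge0.
  - move=> i s s01; apply: dominated_taylor => // t t01; exact: osc.
  move=> j; apply: poly_majorant_bound => //.
  rewrite hornerZ.
  have z1 : a^-1 <= h / 10 by rewrite hi lef_pV2 ?posrE.
  have ai0 : 0 <= a^-1 by rewrite invr_ge0 ltW.
  apply: le_trans (ler_wpM2l D0 (markov_poly_horner d h a^-1 h0 ai0 z1)) _.
  have -> : D * (5 * (a^-1 / h)) = 10 * d%:R ^+ 2 * D / a.
    by rewrite /h; field; rewrite !gt_eqF.
  by rewrite ler_pdivrMr //; move: a2; clear; lra.
have {d2} dE : d = 1%N by move: d1 d2; clear; lia.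
exists (D *: 'X); split.
- by rewrite hornerZ hornerX mulr0.
- by move=> r; rewrite derivZ derivX coefZ coefC; case: eqP => // _; rewrite ?mulr1 ?mulr0.
- move=> i s s01.
  have ci2 : (size (c i) <= 2)%N by rewrite -dE.
  have e : (c i)^`() = ((c i)`_1)%:P.
    apply/polyP => r; rewrite coef_deriv coefC; case: r => [//|r].
    by rewrite nth_default ?mul0rn // (leq_trans ci2).
  rewrite e comp_polyC derivZ derivX => r; rewrite coefZ !coefC.
  case: eqP => _; last by rewrite normr0 mulr0.
  have s0 : 0 <= (0 : R) <= 1 by rewrite lexx ler01.
  have s1 : 0 <= (1 : R) <= 1 by rewrite lexx ler01.
  have <- : (c i).[1] - (c i).[0] = (c i)`_1.
    rewrite !(horner_coef_wide _ ci2) !big_ord_recr !big_ord0 /=; ring.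
  by rewrite ?mulr1; apply: osc.
move=> j; rewrite line_majorant ler_wpM2r //.
  rewrite /weight_bound mulr_ge0 ?(ltW M00) //.
  rewrite big_nat; apply: prodr_ge0 => i /andP[i1 _].
  by apply: le_trans (muj i i1); apply: ler0n.
by rewrite lerXn2r // nnegrE ltW.
Qed.

(** The one-variable inequality with A_j = a^j M_j and the weight a mu_j. *)
Lemma curve_remez {R : realType} (n k j0 : nat) (U L : set 'rV[R]_n)
    (g : 'rV[R]_n -> R) (c : 'I_n -> {poly R}) (mu : nat -> R) (M0 a : R)
    (G : {poly R}) (x : nat -> R) (tau eps : R) :
  (1 <= k)%N -> admissible_weight mu -> 0 < M0 -> 0 < a ->
  open U -> L `<=` U -> Ck_on k.+1 U g ->
  (forall s, 0 <= s <= 1 -> L (curve n c s)) ->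
  (forall l y, (l <= k.+1)%N -> L y ->
    \sum_(alpha : {ffun 'I_n -> 'I_l.+1} | (\sum_(k < n) alpha k == l)%N)
      (l`!)%:R / (\prod_(k < n) (alpha k)`!)%:R * `|mpartial alpha g y| <=
    weight_bound mu M0 l) ->
  G.[0] = 0 -> (forall r, 0 <= G^`()`_r) ->
  (forall i s, 0 <= s <= 1 -> dominated ((c i)^`() \Po ('X + s%:P)) G^`()) ->
  (forall j, \sum_(l < j.+1) (j`!)%:R / (l`!)%:R * (G ^+ l)`_j * weight_bound mu M0 l <=
      a ^+ j * weight_bound mu M0 j) ->
  (j0 <= k)%N -> 1 <= bang_time k.+1 (fun j => a * mu j) j0 ->
  M0 * expR (- j0%:R) <= `|g (curve n c 0)| ->
  0 < tau <= 1 -> gapped k (tau / k%:R) x ->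
  (forall i, (i < k)%N -> x i < x i.+1) ->
  (forall i, (i <= k)%N -> 0 < x i < 1) ->
  (forall i, (i <= k)%N -> `|g (curve n c (x i))| <= eps) ->
  `|g (curve n c 0)| <= 2 * expR 1 * (4 * expR 1 ^+ 2 / tau) ^+ k * eps.
Proof.
move=> k1 muw M00 a0 Uo LU gC cL gM G0 Gp cG GM j0k bang big tau01 gx xinc x01 xeps.
have mu0 := admissible_weight_gt0 mu muw.
pose A j := a ^+ j * weight_bound mu M0 j.
have wS j : weight_bound mu M0 j.+1 = weight_bound mu M0 j * mu j.+1.
  by rewrite /weight_bound big_nat_recr //= mulrA.
have w0 : weight_bound mu M0 0 = M0 by rewrite /weight_bound big_geq // mulr1.
have wp j : 0 < weight_bound mu M0 j.
  by elim: j => [|j IH]; rewrite ?w0 // wS mulr_gt0 // mu0.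
have := remez_chain R k j0 A (fun j => a * mu j) (curve_deriv n g c) x tau eps k1.
rewrite !curve_deriv0; apply=> //.
- by move=> j; rewrite mulr_gt0 // exprn_gt0.
- by move=> j; rewrite /A wS exprS; ring.
- by move=> j j1; rewrite mulr_gt0 // mu0.
- by move=> i j ij; rewrite ler_pM2l // admissible_weight_homo.
- by apply: (deriv_chain_curve n k.+1 U) => // s /cL /LU.
- move=> j s jk s01; apply: le_trans (GM j).
  apply: (curve_deriv_bound n k.+1 U g c s G) => //.
  + exact/LU/cL.
  + by move=> i; apply: cG.
  by move=> l lj; apply: gM; [apply: leq_trans jk|apply: cL].
- by rewrite /A expr0 mul1r w0.
by move=> i ik; rewrite curve_deriv0 xeps.
Qed.

(** * Diameter and sup norm *)

(** The bound C guarantees that the supremum defining [diam] is finite. *)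
Lemma diam_coord {R : realType} (n : nat) (K : set 'rV[R]_n) (C : R) :
  (forall x, K x -> forall i, `|x 0 i| <= C) ->
  forall x y, K x -> K y -> forall i, `|x 0 i - y 0 i| <= diam K.
Proof.
move=> KC x y Kx Ky i.
apply: (@le_trans _ _ (euclidean_dist x y)).
  rewrite -sqrtr_sqr /euclidean_dist ler_sqrt ?sumr_ge0 // => [|j _]; last exact: sqr_ge0.
  by rewrite (bigD1 i) //= lerDl sumr_ge0 // => j _; apply: sqr_ge0.
rewrite /diam; apply: ub_le_sup; last by exists (x, y).
exists (Num.sqrt (\sum_(j < n) (2 * C) ^+ 2)) => _ [[u v] [/= Ku Kv] <-].
rewrite ler_sqrt ?sumr_ge0 // => [|j _]; last exact: sqr_ge0.
apply: ler_sum => j _; rewrite -real_normK ?num_real // lerXn2r ?nnegrE //.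
  by rewrite mulr_ge0 // (le_trans _ (KC u Ku j)).
apply: le_trans (ler_normB _ _) _.
by have := lerD (KC u Ku j) (KC v Kv j); rewrite -mulr2n mulr_natl.
Qed.

Lemma coord_bound_fin {R : realType} (n : nat) (K : set 'rV[R]_n.+1) (C : R) :
  (forall x, K x -> forall i, `|x 0 i| <= C) -> (lebesgue_n K < +oo)%E.
Proof.
move=> KC.
have KB : K `<=` box ((\row_i (- C))%R, (\row_i C)%R).
  by move=> x Kx i; rewrite !mxE -ler_norml KC.
apply: le_lt_trans (lebesgue_n_le n.+1 _ _ KB) _.
exact: le_lt_trans (lebesgue_n_box n.+1 _ isT) (ltry _).
Qed.

(** The point w maximises the component with the largest maximum, not the norm. That component
    carries at least 1/m of the norm, which explains the factor m in the bound and m M_0 in the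
    degree. *)
Lemma sup_norm_attained {R : realType} (n m : nat) (K : set 'rV[R]_n)
    (f : 'rV[R]_n -> 'rV[R]_m.+1) :
  K !=set0 -> compact K -> (forall i, {in K, continuous (fun x => f x 0 i)}) ->
  exists (w : 'rV[R]_n) (i : 'I_m.+1), [/\ K w, norm_on K f <= m.+1%:R * `|f w 0 i| &
    forall (E : set 'rV[R]_n) y j, E `<=` K -> E y -> `|f y 0 j| <= norm_on E f].
Proof.
move=> K0 Kc fc.
have [v vP] : {v : 'I_m.+1 -> 'rV[R]_n & forall j, K (v j) /\
    forall y, K y -> `|f y 0 j| <= `|f (v j) 0 j|}.
  apply: (@choice _ _ (fun j v => K v /\ forall y, K y -> `|f y 0 j| <= `|f v 0 j|)) => j.
  have cj : {within K, continuous (fun x => `|f x 0 j|)}.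
    apply: continuous_in_subspaceT => x xK.
    apply: (@continuous_comp _ _ _ (fun x => f x 0 j) (fun r : R => `|r|)).
      exact: fc.
    exact: norm_continuous.
  have [v vK vmax] := EVT_max_rV K0 Kc cj.
  exists v; split; first exact: set_mem.
  by move=> y Ky; apply: vmax; apply: mem_set.
have [i imax] := max_coord m (fun j => f (v j) 0 j).
have bound y : K y -> \sum_j `|f y 0 j| <= m.+1%:R * `|f (v i) 0 i|.
  move=> Ky; rewrite -[X in X%:R]card_ord -sum1_card natr_sum mulr_suml.
  apply: ler_sum => j _; rewrite mul1r; apply: le_trans (imax j).
  by have [_] := vP j; apply.
exists (v i), i; split.
- by have [] := vP i.
- apply: ge_sup; last by move=> _ [y Ky <-]; exact: bound.
  by have [y Ky] := K0; exists (\sum_j `|f y 0 j|); exists y.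
move=> E y j EK Ey; apply: (@le_trans _ _ (\sum_l `|f y 0 l|)).
  by rewrite (bigD1 j) //= lerDl sumr_ge0.
apply: ub_le_sup; last by exists y.
by exists (m.+1%:R * `|f (v i) 0 i|) => _ [z Ez <-]; apply: bound; apply: EK.
Qed.

Lemma derivative_size_component {R : realType} (n m : nat)
    (f : 'rV[R]_n -> 'rV[R]_m) (j : nat) (x : 'rV[R]_n) (i : 'I_m) :
  \sum_(alpha : {ffun 'I_n -> 'I_j.+1} | (\sum_(k < n) alpha k == j)%N)
      (j`!)%:R / (\prod_(k < n) (alpha k)`!)%:R *
      `|mpartial alpha (fun y => f y 0 i) x| <= derivative_size f j x.
Proof.
rewrite /derivative_size [leRHS](bigD1 i) //= lerDl.
by apply: sumr_ge0 => l _; apply: sumr_ge0 => alpha _; rewrite mulr_ge0 // divr_ge0.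
Qed.

(** Derivatives up to order k + 1 enter, and k + 1 <= 2k is within the available smoothness. *)
Lemma smooth_curve_remez {R : realType} (n m d k j0 : nat) (L : set 'rV[R]_n)
    (f : 'rV[R]_n -> 'rV[R]_m) (mu : nat -> R) (M0 a D : R)
    (c : 'I_n -> {poly R}) (x : nat -> R) (tau eps : R) (i : 'I_m) :
  (1 <= k)%N -> admissible_weight mu -> (forall j, (1 <= j)%N -> j%:R <= mu j) ->
  0 < M0 -> 0 < a -> weight_smooth mu (2 * k) M0 L f ->
  (1 <= d)%N -> (forall l, (size (c l) <= d.+1)%N) ->
  (forall l s t, 0 <= s <= 1 -> 0 <= t <= 1 -> `|(c l).[t] - (c l).[s]| <= D) ->
  0 <= D ->
  (if (2 <= d)%N then 20 * d%:R ^+ 2 * Num.max D 1 <= a else D <= a) ->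
  (forall s, 0 <= s <= 1 -> L (curve n c s)) ->
  (j0 <= k)%N -> 1 <= bang_time k.+1 (fun j => a * mu j) j0 ->
  M0 * expR (- j0%:R) <= `|f (curve n c 0) 0 i| ->
  0 < tau <= 1 -> gapped k (tau / k%:R) x ->
  (forall l, (l < k)%N -> x l < x l.+1) ->
  (forall l, (l <= k)%N -> 0 < x l < 1) ->
  (forall l, (l <= k)%N -> `|f (curve n c (x l)) 0 i| <= eps) ->
  `|f (curve n c 0) 0 i| <= 2 * expR 1 * (4 * expR 1 ^+ 2 / tau) ^+ k * eps.
Proof.
move=> k1 muw muj M00 a0 [[U [Uo LU fC]] fM] d1 cd osc D0 Da cL j0k bang big.
move=> tau01 gx xinc x01 xeps.
have [G [G0 Gp cG GM]] := curve_majorant n d mu M0 a D c d1 cd osc D0 M00 muj a0 Da.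
have k2 : (k.+1 <= 2 * k)%N by move: k1; clear; lia.
have gC := Ck_on_le n (2 * k) k.+1 U _ k2 (fC i).
apply: (curve_remez n k j0 U L (fun y => f y 0 i) c mu M0 a G x tau eps) => //.
move=> l y lk Ly; apply: le_trans (derivative_size_component n m f l y i) _.
by apply: fM => //; apply: leq_trans k2.
Qed.

Lemma a_const_large {R : realType} (n d : nat) (K : set 'rV[R]_n) : (2 <= d)%N ->
  20 * d%:R ^+ 2 * Num.max (diam K) 1 <= a_const d K.
Proof.
move=> d2; rewrite /a_const d2; apply: ler_wpM2r; first by rewrite le_max ler01 orbT.
have p0 : 0 < (d.-1 ^ d.-1)%:R :> R by rewrite ltr0n expn_gt0; case: d d2 => [|[]].
rewrite ler_pdivlMr // (_ : 20 * d%:R ^+ 2 * (d.-1 ^ d.-1)%:R =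
  4 * (5 * d ^ 2 * d.-1 ^ d.-1)%:R :> R); last by rewrite !natrM natrX; ring.
by rewrite ler_pM2l // ler_nat markov_constant.
Qed.

Lemma a_const_diam {R : realType} (n d : nat) (K : set 'rV[R]_n) : (1 <= d)%N ->
  diam K <= a_const d K.
Proof.
move=> d1; case: (ltnP 1 d) => [d2|d2]; last by rewrite /a_const ltnNge d2.
apply: le_trans (a_const_large n d K d2).
apply: (@le_trans _ _ (Num.max (diam K) 1)); first by rewrite le_max lexx.
rewrite ler_peMl ?le_max ?ler01 ?orbT //.
have : 1 <= d%:R ^+ 2 :> R by rewrite -natrX ler1n expn_gt0 d1.
by clear; lra.
Qed.

Theorem theorem4p13 (R : realType) (n d : nat) (K : set 'rV[R]_n)
    (hn : (1 <= n)%N) (hK : admissible_set d K) :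
  exists nu : R, 0 < nu <= 1 /\
    forall (L : set 'rV[R]_n) (mu : nat -> R) (mut : R -> R) (M0 b0 : R)
      (m : nat),
    convex_body L -> K `<=` L ->
    admissible_weight mu -> (forall j, (1 <= j)%N -> j%:R <= mu j) ->
    weight_interpolation mu mut ->
    0 < b0 -> b0 < M0 -> (1 <= m)%N ->
    admissible_tuple mu (m%:R * M0) (a_const d K) b0 ->
    let N := degree mu (m%:R * M0) (a_const d K) b0 in
    forall (f : 'rV[R]_n -> 'rV[R]_m) (E : set 'rV[R]_n),
    weight_smooth mu N M0 L f -> b0 <= norm_on K f ->
    lebesgue_measurable E -> E `<=` K -> (0 < lebesgue_n E)%E ->
    norm_on K f <=
      C_const mut N *
      (m%:R * volume K `^ nu /
         (volume K `^ nu - (volume K - volume E) `^ nu)) ^+ N *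
      norm_on E f.
Proof.
case: n hn K hK => // n _ K.
case=> K0 Kc [KW [aW [Ups [[d1 [KWP [delta1 [delta2 [delta3 [q [P
  [d10 d20 _ q1 PP]]]]]]]] UpsW KE]]]].
have [C [C0 KC]] := compact_coord_bound n K Kc.
have Kfin := coord_bound_fin n K C KC.
have Kdiam := diam_coord n.+1 K C KC.
have KWu w : K w -> KW w `<=` ucube R n.+1 by move=> /KWP[].
have KWfin w : K w -> (lebesgue_n (KW w) < +oo)%E by move=> /KWu /sub_ucube_fin.
have KWd w : K w -> delta1 <= volume (KW w).
  by move=> Kw; rewrite -lee_fin -volume_fin ?KWfin //; have [_ [[]]] := PP w Kw.
have UpsE w x : K w -> orthant x ->
    Ups w x = \row_i ev n.+1 (rootv n.+1 q x) (P w i).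
  move=> Kw xo; have [_ [_ -> // _ _]] := PP w Kw.
  by apply/rowP => i; rewrite !mxE; apply: meval_eq => j; rewrite mxE.
have UpsK w x : K w -> KW w x -> K (Ups w x).
  by move=> Kw Kx; rewrite KE; exists w => //; exists x.
have orth w x : K w -> KW w x -> orthant x.
  by move=> Kw Kx i; have /andP[] := KWu w Kw x Kx i.
(* The threshold of [star_nodes] for the volume of the bad part of K_w. *)
pose eta := delta1 / (4 * 2 ^+ (q * n.+1)).
have eta0 : 0 < eta by rewrite divr_gt0 // mulr_gt0 // exprn_gt0.
have [e0 [e00 image]] : exists eps : R, 0 < eps /\ forall w F, K w ->
    F `<=` KW w -> eta <= volume F -> (eps%:E <= lebesgue_n (Ups w @` F))%E.
  apply: (admissible_image_volume n d q _ K KW Ups P delta1 delta2 C eta) => //.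
  - by move=> w i Kw; have [] := PP w Kw.
  - by move=> w Kw; have [_ [_ _ /andP[]]] := PP w Kw.
  - by move=> w x Kw Kx; apply: UpsE => //; apply: orth Kx.
  by move=> w x i Kw Kx; apply: KC; apply: UpsK.
have diam0 : 0 <= diam K.
  by have [w Kw] := K0; have := Kdiam w w Kw Kw ord0; rewrite subrr normr0.
pose D := diam K + 1; have D0 : 0 < D by rewrite ltr_wpDl.
pose V0 : R := 8 * (4 * D) ^+ n.+1.
have V00 : 0 < V0 by rewrite mulr_gt0 // exprn_gt0 // mulr_gt0.
(* On a ray tau is |E|/(8 (4D)^(n+1)) = |E|/V0, while 1 - (1 - |E|/|K|)^nu <= nu |E|/e0 when |K| -
   |E| >= e0. With nu <= e0/V0 the latter does not exceed tau. *)
pose nu := Num.min 1 (e0 / V0).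
have nu0 : 0 < nu by rewrite lt_min ltr01 divr_gt0.
exists nu; split; first by rewrite nu0 ge_min lexx.
move=> L mu mut M0 b0 m; case: m => // m [_ Lconv _] KL muw muj [mut0 mono _ _ _].
move=> b00 bM _ adm N f E fs fb EM EK E0.
have M00 : 0 < M0 by apply: lt_trans bM.
have mR : 1 <= m.+1%:R :> R by rewrite ler1n.
have bmM : b0 < m.+1%:R * M0 by apply: lt_le_trans bM _; rewrite ler_peMl // ltW.
have [k [Nk k1 j0k bang Ab]] := degree_spec mu _ _ b0 muw adm bmM.
rewrite {}/N Nk in fs *.
set j0 := degree_start _ _ in j0k bang Ab.
have a0 : 0 < a_const d K by case: adm.
have fK i : {in K, continuous (fun x => f x 0 i)}.
  have [[U [_ LU fC]] _] := fs; have := fC i; case: (2 * k)%N => [|N] [cont _] x xK.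
    by apply: cont; apply/mem_set/LU/KL/set_mem.
  by apply: cont; apply/mem_set/LU/KL/set_mem.
have [w [i [Kw fw fE]]] := sup_norm_attained n.+1 m K f K0 Kc fK.
pose eps := norm_on E f; rewrite -/eps.
have Efin : (lebesgue_n E < +oo)%E.
  by apply: le_lt_trans Kfin; apply: lebesgue_n_le.
have e_gt0 : 0 < volume E by rewrite -lte_fin -volume_fin.
have eV : volume E <= volume K by apply: volume_le.
have eps0 : 0 <= eps.
  have [y Ey] : E !=set0.
    apply/set0P/eqP => E_; move: E0; rewrite E_ lebesgue_n_set0 ?ltxx //.
  by apply: le_trans (fE E y i EK Ey).
set r := volume K `^ nu / (volume K `^ nu - (volume K - volume E) `^ nu).
have V_gt0 : 0 < volume K by apply: lt_le_trans eV.
have den0 : 0 < volume K `^ nu - (volume K - volume E) `^ nu.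
  rewrite subr_gt0 gt0_ltr_powR // ?nnegrE ?subr_ge0 ?(ltW V_gt0) //.
  by rewrite gtrBl.
have r1 : 1 <= r.
  by rewrite ler_pdivlMr // mul1r gerBl powR_ge0.
(* From m |f_i(w)| >= b0 and e^(j0) >= m M0/b0: the lower bound that Bang's argument contradicts. *)
have big : M0 * expR (- j0%:R) <= `|f w 0 i|.
  have h : b0 <= m.+1%:R * `|f w 0 i| by apply: le_trans fw.
  rewrite expRN ler_pdivrMr ?expR_gt0 //.
  move: Ab; rewrite ler_pdivrMr // => h2.
  have {}h2 : m.+1%:R * M0 <= m.+1%:R * (`|f w 0 i| * expR j0%:R).
    apply: le_trans h2 _; rewrite mulrA [leRHS]mulrC ler_wpM2l ?expR_ge0 //.
  by move: h2; rewrite ler_pM2l // ltr0n.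
suff [tau [tau0 taur H]] : exists tau : R, [/\ 0 < tau, tau^-1 <= 8 * r ^+ 2 &
    `|f w 0 i| <= 2 * expR 1 * (4 * expR 1 ^+ 2 / tau) ^+ k * eps].
  apply: le_trans fw _; apply: le_trans (ler_wpM2l (ler0n R m.+1) H) _.
  rewrite mulrA ler_wpM2r // (_ : m.+1%:R * volume K `^ nu / _ = m.+1%:R * r).
    rewrite /C_const; apply: remez_constant => //; exact: gamma_weight_ge0.
  by rewrite /r mulrA.
have [far|near] := leP e0 (volume K - volume E).
  have ED y : E y -> forall i, `|y 0 i - w 0 i| <= D.
    move=> Ey l; apply: le_trans (Kdiam y w (EK y Ey) Kw l) _; by rewrite lerDl.
  have [] := ray_nodes n k E w D k1 D0 EM ED e_gt0.
  set cc := volume E / _ => cc1 [y [x [Ey gx xinc x01 xE]]].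
  have cc0 : 0 < cc by rewrite divr_gt0 // exprn_gt0 // mulr_gt0.
  pose c (l : 'I_n.+1) : {poly R} := (w 0 l)%:P + (y 0 l - w 0 l) *: 'X.
  have cE s : curve n.+1 c s = w + s *: (y - w).
    by apply/rowP => l; rewrite !mxE !hornerE mulrC.
  have c0 : curve n.+1 c 0 = w by rewrite cE scale0r addr0.
  exists (cc / 8); split; first by rewrite divr_gt0.
    (* On a segment 1/tau <= r holds, stronger than required as r >= 1. *)
    apply: (@le_trans _ _ r); last by move: r1; clear; nra.
    have r0 : 0 < r by apply: lt_le_trans r1.
    have t0 : 0 < cc / 8 by rewrite divr_gt0.
    rewrite -[r]invrK lef_pV2 ?posrE ?invr_gt0 //.
    rewrite /r invf_div.
    rewrite ler_pdivrMr ?powR_gt0 //; apply: (powR_gap _ _ e0) => //.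
      by rewrite addrC -lerBrDr.
    rewrite ler_pdivrMr //.
    have -> : cc / 8 * e0 = e0 / V0 * volume E.
      have : (4 * D) ^+ n.+1 != 0 by rewrite gt_eqF // exprn_gt0 // mulr_gt0.
      by rewrite /cc /V0; move: ((4 * D) ^+ n.+1) => X X0; field.
    by rewrite ler_wpM2r ?(ltW e_gt0) // ge_min lexx orbT.
  rewrite -c0; apply: (smooth_curve_remez n.+1 m.+1 1 k j0 L f mu M0 (a_const d K)
    (diam K) c x (cc / 8) eps i) => //.
  - move=> l; apply: leq_trans (size_polyD _ _) _; rewrite geq_max size_polyC.
    apply/andP; split; first by case: (_ != 0).
    by apply: leq_trans (size_scale_leq _ _) _; rewrite size_polyX.
  - move=> l s t s01 t01; rewrite !hornerE.
    have -> : w 0 l + (y 0 l - w 0 l) * t - (w 0 l + (y 0 l - w 0 l) * s) =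
      (y 0 l - w 0 l) * (t - s) by ring.
    rewrite normrM -[leRHS]mulr1 ler_pM ?Kdiam //; first exact: EK.
    move: s01 t01; clear => /andP[? ?] /andP[? ?].
    by rewrite ler_norml; apply/andP; split; lra.
  - by rewrite a_const_diam.
  - move=> s /andP[s0 s1]; rewrite cE.
    have := Lconv y w (Itv01 s0 s1) (mem_set (KL y (EK y Ey))) (mem_set (KL w Kw)).
    rewrite inE; congr L; rewrite /conv /=; apply/rowP => l.
    by rewrite !mxE /= /unstable.onem; ring.
  - by rewrite c0.
  - by rewrite divr_gt0 //= ler_pdivrMr // mul1r (le_trans cc1) // ler1n.
  by move=> l lk; rewrite cE; apply: fE => //; apply: xE.
pose F := [set x | KW w x /\ ~ E (Ups w x)].
have FK : F `<=` KW w by move=> x [].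
have Fsmall : volume F < eta.
  rewrite ltNge; apply/negP => Fbig.
  have := image w F Kw FK Fbig; apply/negP; rewrite -ltNge.
  have sub : Ups w @` F `<=` K `&` ~` E.
    by move=> _ [x [Kx nE] <-]; split=> //; apply: UpsK.
  apply: le_lt_trans (lebesgue_n_le n.+1 _ _ sub) _.
  rewrite volume_fin ?lte_fin; last first.
    by apply: le_lt_trans Kfin; apply: lebesgue_n_le => x [].
  have := volume_split n.+1 K E Kfin EM; rewrite setIidr // => VE.
  by move: near; rewrite VE addrAC subrr add0r.
have [Pd [[star _] _ _ a_zero]] := PP w Kw.
have [x [s [Kx gs sinc s01 sgood]]] :=
  star_nodes n q k (KW w) F (aW w) delta1 k1 d10 star (KWu w Kw) (KWd w Kw) FK Fsmall.
have aK : KW w (aW w) by have [] := KWP w Kw.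
have UE z : orthant z -> Ups w z = \row_j ev n.+1 (rootv n.+1 q z) (P w j).
  exact: UpsE.
have [c [cd cE]] := star_curve n.+1 d q (Ups w) (P w) (aW w) x q1 Pd UE a_zero
  (KWu w Kw _ aK) (KWu w Kw _ Kx).
have cK t : 0 <= t <= 1 -> K (curve n.+1 c t).
  move=> t01; rewrite cE //; apply: UpsK => //; apply: star => //.
  by have /andP[t0 t1] := t01; rewrite exprn_ge0 //= exprn_ile1.
have c0 : curve n.+1 c 0 = w.
  by rewrite cE ?lexx ?ler01 // expr0n gtn_eqF //= scale0r addr0 UpsW.
(* The spacing is independent of E, and 8 <= 8 r^2. *)
exists 8^-1; split; first by rewrite invr_gt0.
  by rewrite invrK; move: r1; clear; nra.
rewrite -c0; apply: (smooth_curve_remez n.+1 m.+1 d k j0 L f mu M0 (a_const d K)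
    (diam K) c s 8^-1 eps i) => //.
- move=> l t u t01 u01; have := Kdiam _ _ (cK u u01) (cK t t01) l; by rewrite !mxE.
- by case: ifP => d2; [apply: a_const_large|apply: a_const_diam].
- by move=> t /cK /KL.
- by rewrite c0.
- by rewrite invr_gt0 ltr0n invf_le1 ?ler1n.
move=> l lk; have /andP[l0 l1] := s01 l lk; rewrite cE ?(ltW l0) ?(ltW l1) //.
have [Kl nF] := sgood l lk.
apply: fE => //; apply: contrapT => nE; by apply: nF.
Qed.
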